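(* For $l\ge0$ let $a_l=|\mathcal{PPT}(A)|$ be the number of pointed pseudo-triangulations of a single chain $A$ with $l$ interior vertices, and let $C_n=\frac1{n+1}\binom{2n}{n}$ be the Catalan numbers. Then for every $l\ge1$: $$a_l = 2^{l+1} C_l - a_{l-1}.$$ Hence, $$\left(1-\sum_{i=\lfloor 2+\frac{(-1)^l}{2}\rfloor}^{l}(-1)^{l-i}\prod_{j=i}^{l}\frac{j+1}{4(2j-1)}\right)\cdot 2^{l+1}C_l \ \le\ a_l\ \le\ 2^{l+1}C_l.$$ Moreover, the parenthesis in the left-hand side tends to $\frac{8}{9}$ when $l\to\infty$.
   Context: All point sets are finite planar sets in general position (no three points collinear). A pseudo-triangle is a planar simple polygon with exactly three convex vertices (internal angle less than $\pi$). A pseudo-triangulation of a point set $A$ is a partition of $\operatorname{conv}(A)$ into pseudo-triangles whose vertex set is exactly $A$. A vertex is pointed if it has an incident angle greater than $\pi$; a pseudo-triangulation is pointed if all its vertices are pointed. $\mathcal{PPT}(A)$ is the set of pointed pseudo-triangulations of $A$. A single chain with $l$ interior vertices is a set $A$ of $l+3$ points: $l+2$ points labelled $0,1,\dots,l,l+1$ forming (in this cyclic order) a convex $(l+2)$-gon, plus a point $p$ (the tip) exterior to this polygon and seeing all edges of it except the edge $(0,l+1)$ (for $l=0$, $A$ is just a triangle). Its convex hull vertices are $p,0,l+1$ and its interior points are $1,\dots,l$. *)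

(* Defs.v *)
(* The plane is R * R for an arbitrary R : realType. *)
From HB Require Import structures.
From mathcomp Require Import all_boot all_order all_algebra.
From mathcomp Require Import all_classical all_reals all_analysis.

Set Implicit Arguments.
Unset Strict Implicit.
Unset Printing Implicit Defensive.

Import Order.TTheory GRing.Theory Num.Theory.
Import numFieldNormedType.Exports.

Local Open Scope classical_set_scope.
Local Open Scope card_scope.
Local Open Scope ring_scope.

Section Geometry.
Variable R : realType.
Local Notation pt := (R * R)%type.

(* Twice the signed area of abc: positive iff a, b, c turn counterclockwise,
   zero iff they are collinear. *)
Definition orient (a b c : pt) : R :=
  (b.1 - a.1) * (c.2 - a.2) - (b.2 - a.2) * (c.1 - a.1).

Definition segment (a b : pt) : set pt :=
  [set x | exists2 t : R, 0 <= t <= 1 & x = (1 - t) *: a + t *: b].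

Definition hull (A : set pt) : set pt := smallest (@convex_set R pt) A.

Definition general_position (A : set pt) : Prop :=
  forall a b c, A a -> A b -> A c ->
    a <> b -> a <> c -> b <> c -> orient a b c != 0.

(* P is a simple polygon (a region) with vertices s 0, ..., s (n-1) in this
   cyclic order: a compact set, equal to the closure of its interior, whose
   frontier is the simple closed polygonal line through the s i. Straight
   angles are excluded, so P determines s up to rotation and reversal. *)
Definition simple_polygon (n : nat) (s : 'I_n -> pt) (P : set pt) : Prop :=
  [/\ (2 < n)%N,
      injective s,
      (forall i, orient (s (ord_pred i)) (s i) (s (ordS i)) != 0),
      (forall i j, i != j ->
         segment (s i) (s (ordS i)) `&` segment (s j) (s (ordS j)) `<=`
         [set s i; s (ordS i)] `&` [set s j; s (ordS j)])
    & [/\ compact P, regclosed P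
    & closure P `\` P° = \bigcup_i segment (s i) (s (ordS i))]].

(* The internal angle of P at s i is less than pi: near s i, the region P
   contains the sector (of angle < pi) spanned by the two sides at s i; if the
   internal angle is greater than pi, P avoids the interior of that sector. *)
Definition convex_vertex (n : nat) (s : 'I_n -> pt) (P : set pt) (i : 'I_n)
    : Prop :=
  exists2 e : R, 0 < e & forall a b : R, 0 <= a -> 0 <= b -> a + b <= e ->
    P (s i + a *: (s (ord_pred i) - s i) + b *: (s (ordS i) - s i)).

Definition pseudo_triangle (P : set pt) : Prop :=
  exists n (s : 'I_n -> pt),
    simple_polygon s P /\ [set i | convex_vertex s P i] #= `I_3.

Definition vertices (P : set pt) : set pt :=
  [set x | exists n (s : 'I_n -> pt), simple_polygon s P /\ range s x].

Definition side (P : set pt) (x y : pt) : Prop :=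
  exists n (s : 'I_n -> pt), simple_polygon s P /\
    exists i, [set x; y] = [set s i; s (ordS i)].

(* A partition of hull A into closed regions: their interiors are disjoint. *)
Definition pseudo_triangulation (A : set pt) (T : set (set pt)) : Prop :=
  [/\ (forall P, T P -> pseudo_triangle P),
      trivIset T (fun P => P°),
      \bigcup_(P in T) P = hull A
    & \bigcup_(P in T) vertices P = A].

Definition edge (T : set (set pt)) (x y : pt) : Prop :=
  exists2 P, T P & side P x y.

(* The angle at v going counterclockwise from the edge vu to the edge vw is
   greater than pi and contains no other edge at v: these all lie in the
   complementary sector, going counterclockwise from vw to vu. Angles outside
   the convex hull count as incident angles. *)
Definition pointed_vertex (T : set (set pt)) (v : pt) : Prop :=
  exists u w, [/\ edge T v u, edge T v w, orient v u w < 0 &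
    forall x, edge T v x -> x <> u -> x <> w ->
      0 < orient v w x /\ 0 < orient v x u].

Definition PPT (A : set pt) : set (set (set pt)) :=
  [set T | pseudo_triangulation A T /\ forall v, A v -> pointed_vertex T v].

(* q 0, ..., q m form, in this cyclic order, a strictly convex polygon, with
   either orientation; no condition if m < 2. *)
Definition convex_cycle (m : nat) (q : nat -> pt) : Prop :=
  forall i j k i' j' k', (i < j < k)%N -> (k <= m)%N ->
    (i' < j' < k')%N -> (k' <= m)%N ->
    0 < orient (q i) (q j) (q k) * orient (q i') (q j') (q k').

Definition sees (K : set pt) (p a b : pt) : Prop :=
  forall x, segment a b x -> segment p x `&` K = [set x].

(* For l = 0 the polygon degenerates to the segment (0, 1), whose only edge is
   both (0, 1) and (0, l + 1); A is then any triangle. *)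
Definition single_chain (l : nat) (A : set pt) : Prop :=
  exists (q : nat -> pt) (p : pt),
    let Q := q @` `I_l.+2 in
    [/\ A = p |` Q,
        general_position A,
        (forall i j, (i <= l.+1)%N -> (j <= l.+1)%N -> q i = q j -> i = j),
        convex_cycle l.+1 q
      & [/\ ~ hull Q p,
            (forall i, (i <= l)%N -> sees (hull Q) p (q i) (q i.+1))
          & (0 < l)%N -> ~ sees (hull Q) p (q 0%N) (q l.+1)]].

End Geometry.

Definition catalan (R : realType) (n : nat) : R :=
  'C(n.*2, n)%:R / n.+1%:R.

Definition lower_factor (R : realType) (l : nat) : R :=
  1 - \sum_(`|Num.floor (2 + (-1) ^+ l / 2 : R)|%N <= i < l.+1)
        (-1) ^+ (l - i) *
        \prod_(i <= j < l.+1) ((j%:R + 1) / (4 * (2 * j%:R - 1))).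

(* Main.v *)
From HB Require Import structures.
Require Import Defs.
From mathcomp Require Import all_boot all_order all_algebra.
From mathcomp Require Import all_classical all_reals all_analysis.
From mathcomp Require Import ring lra zify.
Import Order.TTheory GRing.Theory Num.Theory.
Import numFieldNormedType.Exports.
Local Open Scope classical_set_scope.
Local Open Scope card_scope.
Local Open Scope ring_scope.

(** Let the chain be q 0, ..., q n with tip p, so that n = l + 1.

    The combinatorial side. A pseudo-triangulation is determined by its edges:
    the set D of edges between points of the chain and the set S of interior
    points joined to p. Which pairs (D, S) occur is the content of [edge_set]:
    edges do not cross, an interior point joined to p has no neighbours on both
    sides in the chain (it is pointed), q 0 and q n are joined, and each edge
    of D has a face above it. Such a face is a triangle q i, q j, q k, or a fan
    with corner p ([cell], [is_face]); in both cases its shape lets one cut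
    (D, S) along it, so that edge sets correspond to binary trees with two kinds
    of nodes ([edge_sets_trees]).

    From pseudo-triangulations to edge sets. By [face_classification], a
    pseudo-triangle with vertices in the chain and without points of the chain
    in its interior is a triangle or a fan. Indeed, a vertex where an affine
    function is maximal is convex ([extreme_turn]): without p all vertices are
    convex, and with p this leaves no choice for the three convex vertices. Walking from an edge a small
    way towards p one enters the cell above it ([cell_above]).

    From edge sets to pseudo-triangulations. The boundary of a face is a simple
    closed polygonal line, and bounds a region by the parity argument for
    Jordan's theorem ([cyclic_path_bounds]). A point z of the open wedge at p
    between q g and q (g + 1) lies in the region of a face exactly if it is
    above the lower side of this face over the gap g and not above its upper side
    ([face_memberP]). Hence generic points are covered exactly once, by the face
    above the highest edge below z; density extends this to the whole hull.
    Together these give [PPT_edge_sets].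

    Counting. If G is the generating function of the trees by size, splitting off
    the root gives G = 1 + (G - 1)^2 + X G^2. Then B = (1 + X) G - 1 satisfies
    B = 2X + B^2, like 2X times the Catalan series at 2X, so that the coefficients
    a_l + a_(l-1) of B are 2^(l+1) C_l ([tree_pair_catalan]). Dividing by
    2^(l+1) C_l turns this into r_l = 1 - f_l r_(l-1) with f_l = [ratio l], which
    tends to 1/8. The lower bound follows the same recursion, with a start that
    makes the error nonpositive for the given parity, and the recursion contracts
    towards its fixed point 8/9. *)

(** * Planar points, orientations and local arguments *)

Ltac coords := repeat match goal with a : (_ * _)%type |- _ => destruct a end;
  rewrite /orient /= /GRing.scale /=.

Section Plane.
Context {R : realType}.
Implicit Types (a b c d u v w x y z p : (R * R)%type) (s t e : R)
  (C U : set (R * R)).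

Lemma pt_ext a b : a.1 = b.1 -> a.2 = b.2 -> a = b.
Proof. by case: a b => [? ?] [? ?] /= -> ->. Qed.

Definition lerp a b t := (1 - t) *: a + t *: b.

Lemma ex_smaller (r s : R) : 0 < r -> 0 < s -> exists t, [/\ 0 < t, t < r & t < s].
Proof.
move=> r0 s0; exists (Num.min r s / 2).
have h : 0 < Num.min r s by rewrite lt_min r0 s0.
have hr : Num.min r s <= r by rewrite ge_min lexx.
have hs : Num.min r s <= s by rewrite ge_min lexx orbT.
by split; lra.
Qed.

Lemma mix_gt0 (r s t : R) : 0 < r -> 0 < s -> 0 <= t <= 1 ->
  0 < (1 - t) * r + t * s.
Proof.
move=> x0 y0 /andP[]; rewrite le_eqVlt => /predU1P[<-|t0] t1; first lra.
by apply: ltr_wpDl; [apply: mulr_ge0; lra | exact: mulr_gt0].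
Qed.

Lemma lerp0 a b : lerp a b 0 = a.
Proof. by rewrite /lerp subr0 scale1r scale0r addr0. Qed.

Lemma lerp1 a b : lerp a b 1 = b.
Proof. by rewrite /lerp subrr scale0r add0r scale1r. Qed.

Lemma lerpC a b t : lerp a b t = lerp b a (1 - t).
Proof. by rewrite /lerp subKr addrC. Qed.

Lemma segmentP a b z :
  segment a b z <-> exists2 t, 0 <= t <= 1 & z = lerp a b t.
Proof. by []. Qed.

Lemma segmentC a b : segment a b = segment b a.
Proof.
apply/seteqP; split=> z /segmentP[t t01 ->]; apply/segmentP.
  by exists (1 - t); [lra | exact: lerpC].
by exists (1 - t); [lra | exact: lerpC].
Qed.

Lemma segment_l a b : segment a b a.
Proof. by apply/segmentP; exists 0; rewrite ?lexx ?ler01 ?lerp0. Qed.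

Lemma segment_r a b : segment a b b.
Proof. by rewrite segmentC; exact: segment_l. Qed.

Lemma orient_cyc a b c : orient b c a = orient a b c.
Proof. by coords; ring. Qed.

Lemma orient_swap a b c : orient b a c = - orient a b c.
Proof. by coords; ring. Qed.

Lemma orient_flip a b c : orient a c b = - orient a b c.
Proof. by coords; ring. Qed.

Lemma orient_rev a b c : orient c b a = - orient a b c.
Proof. by coords; ring. Qed.

Lemma orient_aab a b : orient a a b = 0.
Proof. by coords; ring. Qed.

Lemma orient_abb a b : orient a b b = 0.
Proof. by coords; ring. Qed.

Lemma orient_aba a b : orient a b a = 0.
Proof. by coords; ring. Qed.

Lemma orient_lerp a b c d t :
  orient a b (lerp c d t) = (1 - t) * orient a b c + t * orient a b d.
Proof. by rewrite /lerp; coords; ring. Qed.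

(** Barycentric coordinates of z in the triangle abc turn the value at z of
    any affine function into a combination of its values at a, b and c. *)
Lemma orient_bary a b c u v z :
  orient a b c * orient u v z =
    orient b c z * orient u v a + orient c a z * orient u v b
    + orient a b z * orient u v c.
Proof. by coords; ring. Qed.

(** Affine functions on the plane; those used are sums of orientations. *)
Definition affine (f : R * R -> R) :=
  exists k l m : R, forall z, f z = k * z.1 + l * z.2 + m.

Lemma affine_orient a b : affine (orient a b).
Proof.
exists (a.2 - b.2), (b.1 - a.1), ((b.2 - a.2) * a.1 - (b.1 - a.1) * a.2).
by move=> z; coords; ring.
Qed.

Lemma affineD (f g : R * R -> R) :
  affine f -> affine g -> affine (fun z => f z + g z).
Proof.
move=> [k [l [m fE]]] [k' [l' [m' gE]]].
by exists (k + k'), (l + l'), (m + m') => z; rewrite fE gE; ring.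
Qed.

Lemma affineN (f : R * R -> R) : affine f -> affine (fun z => - f z).
Proof.
move=> [k [l [m fE]]].
by exists (- k), (- l), (- m) => z; rewrite fE; ring.
Qed.

Lemma affine_lerp {f : R * R -> R} : affine f ->
  forall a b t, f (lerp a b t) = (1 - t) * f a + t * f b.
Proof.
by move=> [k [l [m fE]]] a b t; rewrite !fE /lerp; coords; ring.
Qed.

Lemma affine_continuous f : affine f -> continuous f.
Proof.
move=> [k [l [m fE]]] z; rewrite (_ : f = fun z => k * z.1 + l * z.2 + m);
  last exact/funext.
apply: cvgD; last exact: cvg_cst.
apply: cvgD; apply: cvgM; [exact: cvg_cst| |exact: cvg_cst|].
  exact: cvg_fst.
exact: cvg_snd.
Qed.

Lemma near_pos (f : R * R -> R) z :
  continuous f -> 0 < f z -> \forall z' \near z, 0 < f z'.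
Proof. by move=> cf fz; exact: (cvgr_gt _ (cf z)). Qed.

Lemma near_neg (f : R * R -> R) z :
  continuous f -> f z < 0 -> \forall z' \near z, f z' < 0.
Proof. by move=> cf fz; exact: (cvgr_lt _ (cf z)). Qed.

Lemma continuous_orient a b : continuous (orient a b).
Proof. by apply: affine_continuous; exact: affine_orient. Qed.

Lemma near_affine2 v a b (U : set (R * R)) : nbhs v U ->
  exists2 e, 0 < e & forall s t, `|s| < e -> `|t| < e ->
    U (v + s *: a + t *: b).
Proof.
move=> vU.
pose g (st : R * R) := v + st.1 *: a + st.2 *: b.
have g0 : g (0, 0) = v by rewrite /g /= !scale0r !addr0.
have gc : g st @[st --> (0, 0)] --> g (0, 0).
  apply: cvgD; last by apply: cvgZr_tmp; exact: cvg_snd.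
  by apply: cvgD; [exact: cvg_cst | apply: cvgZr_tmp; exact: cvg_fst].
rewrite g0 in gc; have /nbhs_ballP[e /= e0 he] := gc _ vU.
exists e => // s t se te; apply: (he (s, t)).
by split; rewrite /ball /= sub0r normrN.
Qed.

Lemma near_affine1 v a (U : set (R * R)) : nbhs v U ->
  exists2 e, 0 < e & forall s, `|s| < e -> U (v + s *: a).
Proof.
move=> /(near_affine2 v a 0)[e e0 he]; exists e => // s se.
by have := he s 0 se; rewrite normr0 scaler0 addr0; apply.
Qed.

Lemma lerpE a b t : lerp a b t = a + t *: (b - a).
Proof. by rewrite /lerp scalerBl scale1r scalerBr addrA addrAC. Qed.

Lemma lerp_shift a b t s : lerp a b (t + s) = lerp a b t + s *: (b - a).
Proof. by rewrite !lerpE scalerDl addrA. Qed.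

Lemma lerp_lerp a b r s t :
  lerp (lerp a b r) (lerp a b s) t = lerp a b ((1 - t) * r + t * s).
Proof. by rewrite /lerp; apply: pt_ext; coords; ring. Qed.

Lemma near_lerp a b t U : nbhs (lerp a b t) U ->
  exists2 e, 0 < e & forall s, `|s - t| < e -> U (lerp a b s).
Proof.
move=> /(near_affine1 _ (b - a))[e e0 he]; exists e => // s se.
by rewrite -[s](subrKC t) lerp_shift; exact: he.
Qed.

Lemma lerp_continuous a b : continuous (lerp a b).
Proof.
move=> t; apply: cvgD.
  apply: cvgZr_tmp; apply: cvgB; [exact: cvg_cst | exact: cvg_id].
by apply: cvgZr_tmp; exact: cvg_id.
Qed.

Lemma near_ltn n (Q : nat -> R * R -> Prop) w :
  (forall k, (k < n)%N -> \forall z \near w, Q k z) ->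
  \forall z \near w, forall k, (k < n)%N -> Q k z.
Proof.
elim: n => [|n IHn] h; first by near=> z => k.
have h1 := IHn (fun k kn => h k (ltnW kn)); have h2 := h n (ltnSn n).
near=> z => k; rewrite ltnS leq_eqVlt => /orP[/eqP->|].
  by near: z.
by move: k; near: z.
Unshelve. all: by end_near. Qed.

Lemma segment_closed a b : closed (segment a b).
Proof.
have -> : segment a b = lerp a b @` `[0, 1].
  apply/seteqP; split=> z /=.
    by move=> /segmentP[t t01 ->]; exists t => //=; rewrite in_itv.
  by move=> [t /=]; rewrite in_itv/= => t01 <-; apply/segmentP; exists t.
apply: compact_closed; first exact: norm_hausdorff.
apply: continuous_compact; last exact: segment_compact.
by apply: continuous_subspaceT; exact: lerp_continuous.
Qed.

(** ** Convex sets are connected *)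

Definition cvx C := forall x y t, C x -> C y -> 0 <= t <= 1 -> C (lerp x y t).

Lemma cvxI C U : cvx C -> cvx U -> cvx (C `&` U).
Proof.
by move=> hC hU x y t [? ?] [? ?] t01; split; [exact: hC | exact: hU].
Qed.

Lemma cvx_pos (f : R * R -> R) : affine f -> cvx [set z | 0 < f z].
Proof.
move=> af x y t /= fx fy /andP[t0 t1]; rewrite (affine_lerp af).
by apply: mix_gt0 => //; rewrite t0.
Qed.

Lemma cvx_ge0 (f : R * R -> R) : affine f -> cvx [set z | 0 <= f z].
Proof.
move=> af x y t /= fx fy /andP[t0 t1]; rewrite (affine_lerp af).
by apply: addr_ge0; apply: mulr_ge0; lra.
Qed.

(** Connectedness of segments, in the form used throughout. *)
Lemma cvx_const C (b : R * R -> Prop) : cvx C ->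
  (forall w, C w -> \forall z \near w, C z -> (b z <-> b w)) ->
  forall x y, C x -> C y -> b x -> b y.
Proof.
move=> cC loc x y Cx Cy bx.
have CI t : 0 <= t <= 1 -> C (lerp x y t) by exact: cC.
pose I := [set t : R | 0 <= t <= 1].
have loct t : I t -> \forall t' \near t, I t' ->
    (b (lerp x y t') <-> b (lerp x y t)).
  move=> t01.
  have [e e0 he] := near_lerp _ _ _ _ (loc _ (CI t t01)).
  near=> t' => t01'; apply: he; last exact: CI.
  by rewrite distrC; near: t'; apply/nbhs_ballP; exists e.
pose T1 := [set t | I t -> b (lerp x y t)].
pose T0 := [set t | I t -> ~ b (lerp x y t)].
have : [set t | I t /\ b (lerp x y t)] = I.
  have -> : I = `[0, 1]%classic :> set R.
    by apply/seteqP; split=> t /=; rewrite in_itv.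
  apply: (@segment_connected R 0 1).
  - by exists 0; split; rewrite ?lerp0//= in_itv/= lexx ler01.
  - exists (T1°); first exact: open_interior.
    apply/seteqP; split=> t /=; rewrite in_itv/=.
      move=> [It bt]; split=> //; apply: filterS (loct t It) => t' h It'.
      exact/h.
    by move=> [It /nbhs_singleton h]; split=> //; exact: h.
  - exists (~` T0°); first by apply: open_closedC; exact: open_interior.
    apply/seteqP; split=> t /=; rewrite in_itv/=.
      by move=> [It bt]; split=> // /nbhs_singleton; apply.
    move=> [It nT0]; split=> //; apply: contra_notP nT0 => nb.
    by apply: filterS (loct t It) => t' h It' /(h It').
move=> /seteqP[_ /(_ 1)]; rewrite /I /= lexx ler01 lerp1.
by move=> /(_ isT)[].
Unshelve. all: by end_near. Qed.

End Plane.

(** * Simple polygons and the regions that they bound *)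

Section Polygon.
Context {R : realType}.
Implicit Types (a b c d u v w x y z : (R * R)%type) (s t e : R)
  (C U P : set (R * R)) (f : nat -> R * R).

Lemma orient_perturb a b z U : a <> b -> nbhs z U ->
  exists z1 z2, [/\ U z1, U z2, orient a b z1 < orient a b z
    & orient a b z < orient a b z2].
Proof.
move=> ab zU; pose d : R * R := (a.2 - b.2, b.1 - a.1).
have [e e0 he] := near_affine1 z d U zU.
have oE s : orient a b (z + s *: d) =
    orient a b z + s * ((b.1 - a.1) ^+ 2 + (b.2 - a.2) ^+ 2).
  by rewrite /d {zU he}; clear d; coords; ring.
have n0 : 0 < (b.1 - a.1) ^+ 2 + (b.2 - a.2) ^+ 2.
  rewrite lt_neqAle addr_ge0 ?sqr_ge0// andbT eq_sym paddr_eq0 ?sqr_ge0//.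
  rewrite !sqrf_eq0 !subr_eq0; apply/negP => /andP[/eqP h1 /eqP h2].
  by apply: ab; apply: pt_ext.
exists (z + (- (e / 2)) *: d), (z + (e / 2) *: d); split.
- by apply: he; rewrite normrN gtr0_norm; lra.
- by apply: he; rewrite gtr0_norm; lra.
- by rewrite oE; nra.
- by rewrite oE; nra.
Qed.

Lemma convex_nbhd w U : nbhs w U ->
  exists B : set (R * R), [/\ cvx B, nbhs w B & B `<=` U].
Proof.
move=> /nbhs_ballP[e /= e0 he].
exists (ball w e); split=> //; last exact: nbhsx_ballx.
move=> x y t [x1 x2] [y1 y2] t01.
have cb (p q r : R) : `|p - q| < e -> `|p - r| < e ->
    `|p - ((1 - t) * q + t * r)| < e.
  move=> h1 h2.
  have -> : p - ((1 - t) * q + t * r) = (1 - t) * (p - q) + t * (p - r).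
    by ring.
  apply: (le_lt_trans (ler_normD _ _)); rewrite !normrM.
  have [t1 t2] : `|1 - t| = 1 - t /\ `|t| = t.
    by split; apply: ger0_norm; lra.
  rewrite t1 t2; move: t01 => /andP[]; rewrite le_eqVlt => /predU1P[<-|t0] t3.
    by lra.
  have := mulr_gt0 t0 (etrans (subr_gt0 _ _) h2).
  have : 0 <= (1 - t) * (e - `|p - q|) by apply: mulr_ge0; lra.
  lra.
by split; exact: cb.
Qed.

(** The conditions that a polygonal line must satisfy to be the boundary of
    a simple polygon.  The vertices are indexed by all natural numbers, with
    period n, so that cyclic shifts need no arithmetic. *)
Definition cyclic_path n f := [/\ (2 < n)%N,
  (forall i j, f i = f j <-> i = j %[mod n]),
  (forall k, orient (f k) (f k.+1) (f k.+2) != 0) &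
  (forall i j, f i <> f j ->
     segment (f i) (f i.+1) `&` segment (f j) (f j.+1) `<=`
     [set f i; f i.+1] `&` [set f j; f j.+1])].

Definition sides f : set (R * R) := [set z | exists k, segment (f k) (f k.+1) z].

Definition bounded_by f P :=
  [/\ compact P, regclosed P & closure P `\` P° = sides f].

Definition polygon n f P := cyclic_path n f /\ bounded_by f P.

Section CyclicPath.
Variables (n : nat) (f : nat -> R * R).
Hypothesis fn : cyclic_path n f.

Lemma cyc_eq i j : f i = f j <-> i = j %[mod n].
Proof. by case: fn. Qed.

Lemma cyc_mod k : f (k %% n) = f k.
Proof. by apply/cyc_eq; rewrite modn_mod. Qed.

Lemma cyc_succ i j : f i = f j <-> f i.+1 = f j.+1.
Proof.
rewrite !cyc_eq; have [n2 _ _ _] := fn.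
split=> [h|]; first by rewrite -addn1 -modnDml h modnDml addn1.
by move/eqP; rewrite -(add1n i) -(add1n j) eqn_modDl => /eqP.
Qed.

Lemma cyc_neqS k : f k <> f k.+1.
Proof.
have [_ _ /(_ k) h _] := fn => e.
by move: h; rewrite -e orient_aab eqxx.
Qed.

Lemma cyc_turn k : orient (f k) (f k.+1) (f k.+2) != 0.
Proof. by case: fn. Qed.

Lemma cyc_neqSS k : f k <> f k.+2.
Proof.
by move=> e; have := cyc_turn k; rewrite -e orient_aba eqxx.
Qed.

Lemma sides_lt z : sides f z ->
  exists2 k, (k < n)%N & segment (f k) (f k.+1) z.
Proof.
move=> [k kz]; have [n2 _ _ _] := fn.
exists (k %% n)%N; first by rewrite ltn_mod; exact: ltn_trans n2.
have e : f (k %% n) = f k by exact: cyc_mod.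
by rewrite e; have /cyc_succ -> := e.
Qed.

Lemma near_sides w (K : nat -> Prop) :
  (forall k, segment (f k) (f k.+1) w -> K k) ->
  \forall z \near w, sides f z -> exists2 k, K k & segment (f k) (f k.+1) z.
Proof.
move=> hK.
have h : \forall z \near w, forall k, (k < n)%N -> ~ K k ->
    ~ segment (f k) (f k.+1) z.
  apply: (near_ltn n (fun k z => ~ K k -> ~ segment (f k) (f k.+1) z)).
  move=> k _; have [Kk|nKk] := pselect (K k); first by near=> z => nK.
  have wk : (~` segment (f k) (f k.+1)) w by move=> /hK.
  have : nbhs w (~` segment (f k) (f k.+1)).
    by apply: open_nbhs_nbhs; split=> //; exact/closed_openC/segment_closed.
  by apply: filterS => z hz _.
apply: filterS h => z hz /sides_lt[k kn kz]; exists k => //.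
by apply: contrapT => nK; exact: (hz k kn nK).
Unshelve. all: by end_near. Qed.

Lemma lerp_neq a b t : a <> b -> 0 < t < 1 -> lerp a b t <> a.
Proof.
move=> ab t01; rewrite lerpE => /(congr1 (fun z => z - a)).
rewrite addrC addKr subrr => /eqP; rewrite scaler_eq0 subr_eq0.
by move=> /orP[/eqP|/eqP/esym//]; lra.
Qed.

Lemma lerp_neqr a b t : a <> b -> 0 < t < 1 -> lerp a b t <> b.
Proof.
move=> ab t01; rewrite lerpC; apply: lerp_neq; last lra.
exact: nesym.
Qed.

Lemma open_side_only k t j : 0 < t < 1 ->
  segment (f j) (f j.+1) (lerp (f k) (f k.+1) t) -> f j = f k.
Proof.
move=> t01 h; apply: contrapT => jk; have [_ _ _ nc] := fn.
have [] := nc _ _ jk (lerp (f k) (f k.+1) t).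
  by split=> //; apply/segmentP; exists t => //; lra.
move=> _ [] /=; first by apply: lerp_neq => //; exact: cyc_neqS.
by apply: lerp_neqr => //; exact: cyc_neqS.
Qed.

Lemma vertex_side_only k j :
  segment (f j) (f j.+1) (f k.+1) -> f j = f k \/ f j = f k.+1.
Proof.
move=> h; have [?|jk] := pselect (f j = f k.+1); first by right.
left; have [_ _ _ nc] := fn.
have [] := nc _ _ jk (f k.+1); first by split=> //; exact: segment_l.
by move=> [/= e|/= e] _; [case: jk | apply/cyc_succ].
Qed.

Lemma near_open_side k t : 0 < t < 1 ->
  \forall z \near lerp (f k) (f k.+1) t,
    sides f z -> segment (f k) (f k.+1) z.
Proof.
move=> t01.
have := near_sides _ (fun j => f j = f k) (fun j => open_side_only k t j t01).
apply: filterS => z h /h [j e].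
by rewrite e; have /cyc_succ -> := e.
Qed.

Lemma segment_orient0 a b z : segment a b z -> orient a b z = 0.
Proof.
by move=> /segmentP[t _ ->]; rewrite orient_lerp orient_aba orient_abb; ring.
Qed.

Section Region.
Variable P : set (R * R).
Hypothesis Pf : bounded_by f P.

Lemma region_closed : closed P.
Proof.
by have [/compact_closed h _ _] := Pf; apply: h; exact: norm_hausdorff.
Qed.

Lemma regionE z : P z -> ~ P° z -> sides f z.
Proof.
move=> Pz iz; have [_ _ <-] := Pf; split=> //.
exact: subset_closure.
Qed.

Lemma side_region z : sides f z -> P z /\ ~ P° z.
Proof.
have [_ _ <-] := Pf; move=> [cz iz]; split=> //.
by rewrite (closure_id P).1//; exact: region_closed.
Qed.

Lemma region_interior z U : P z -> nbhs z U -> exists2 y, U y & P° y.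
Proof.
have [_ reg _] := Pf; rewrite -{1}reg => cz /cz [y [Py Uy]].
by exists y.
Qed.

(** Off the boundary, membership in the region is locally constant. *)
Lemma cvx_region C : cvx C -> (forall z, C z -> ~ sides f z) ->
  forall x y, C x -> C y -> P x -> P y.
Proof.
move=> cC dC; apply: cvx_const => // w Cw.
have [Pw|nPw] := pselect (P w).
  have : P° w by apply: contrapT => /(regionE w Pw); exact: dC.
  by apply: filterS => z Pz _.
have : nbhs w (~` P).
  by apply: open_nbhs_nbhs; split=> //; exact/closed_openC/region_closed.
by apply: filterS => z Pz _.
Qed.

Definition left_at k w := \forall z \near w,
  (0 < orient (f k) (f k.+1) z -> P z) /\
  (orient (f k) (f k.+1) z < 0 -> ~ P z).

Definition right_at k w := \forall z \near w,
  (orient (f k) (f k.+1) z < 0 -> P z) /\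
  (0 < orient (f k) (f k.+1) z -> ~ P z).

Lemma left_right_at k t : 0 < t < 1 ->
  left_at k (lerp (f k) (f k.+1) t) -> right_at k (lerp (f k) (f k.+1) t) ->
  False.
Proof.
move=> t01 hl hr; set w := lerp _ _ _ in hl hr.
have [_ [z [_ [[Pz _] [_ nPz]] _]]] :=
  orient_perturb _ _ _ _ (cyc_neqS k) (filterI hl hr).
rewrite (segment_orient0 _ _ w) => [oz|]; first exact: nPz (Pz oz).
by apply/segmentP; exists t => //; lra.
Qed.

(** Near an interior point of a side, the region is a half-disc: it cannot
    be the whole disc, because sides are on the frontier, nor empty, because
    the region is the closure of its interior. *)
Lemma half_disc k t : 0 < t < 1 ->
  left_at k (lerp (f k) (f k.+1) t) \/ right_at k (lerp (f k) (f k.+1) t).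
Proof.
move=> t01; set w := lerp _ _ _; set o := orient (f k) (f k.+1).
have kk := cyc_neqS k.
have sw : sides f w by exists k; apply/segmentP; exists t => //; lra.
have [Pw iPw] := side_region _ sw.
have [B [cB wB hB]] := convex_nbhd _ _ (near_open_side k t t01).
have offline z : B z -> o z != 0 -> ~ sides f z.
  by move=> Bz oz /(hB _ Bz) /segment_orient0 e; rewrite /o e eqxx in oz.
have up := cvx_region _ (cvxI _ _ cB (cvx_pos _ (affine_orient (f k) (f k.+1))))
  (fun z h => offline z h.1 (lt0r_neq0 h.2)).
have dn := cvx_region _ (cvxI _ _ cB
    (cvx_pos _ (affineN _ (affine_orient (f k) (f k.+1))))).
have {}dn : forall x y, B x /\ o x < 0 -> B y /\ o y < 0 -> P x -> P y.
  move=> x y [Bx ox] [By oy]; apply: dn.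
  - by move=> z [Bz /=]; rewrite oppr_gt0 => /ltr0_neq0; exact: offline.
  - by split=> //=; rewrite oppr_gt0.
  - by split=> //=; rewrite oppr_gt0.
have ow : o w = 0 by apply: segment_orient0; apply/segmentP; exists t => //; lra.
have [z1 [z2 [Bz1 Bz2]]] := orient_perturb _ _ _ _ kk wB.
rewrite -/o ow => o1 o2.
have [P1|P1] := pselect (P z1); have [P2|P2] := pselect (P z2).
- exfalso; apply: iPw; apply: filterS (nbhs_interior wB) => z Bz.
  apply: region_closed => U Uz.
  have [z' [z'' [[Bz' Uz'] [Bz'' Uz''] h1 h2]]] :=
    orient_perturb _ _ _ _ kk (filterI Bz Uz).
  have [oz|oz|oz] := ltgtP (o z) 0.
  + exists z'; split=> //; apply: (dn z1) => //; split=> //.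
    exact: lt_trans h1 oz.
  + exists z''; split=> //; apply: (up z2) => //; split=> //.
    exact: lt_trans oz h2.
  + exists z''; split=> //; apply: (up z2) => //; split=> //.
    by rewrite -oz.
- right; apply: filterS wB => z Bz; split=> oz; first exact: (dn z1).
  by move=> Pz; apply: P2; apply: (up z).
- left; apply: filterS wB => z Bz; split=> oz; first exact: (up z2).
  by move=> Pz; apply: P1; apply: (dn z).
- exfalso; have [y By Py] := region_interior _ _ Pw (nbhs_interior wB).
  have [z' [z'' [[Bz' Uz'] [Bz'' Uz''] h1 h2]]] :=
    orient_perturb _ _ _ _ kk (filterI By Py).
  have [oz|oz|oz] := ltgtP (o y) 0.
  + by apply: P1; apply: (dn z') => //; split=> //; exact: lt_trans h1 oz.
  + by apply: P2; apply: (up z'') => //; split=> //; exact: lt_trans oz h2.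
  + by apply: P2; apply: (up z'') => //; split=> //=; rewrite -oz.
Qed.

Lemma left_at_side k s t : 0 < s < 1 -> 0 < t < 1 ->
  left_at k (lerp (f k) (f k.+1) s) -> left_at k (lerp (f k) (f k.+1) t).
Proof.
move=> s01 t01; pose C := [set z | exists2 t, 0 < t < 1 & z = lerp (f k) (f k.+1) t].
apply: (cvx_const C); [| |by exists s|by exists t].
  move=> _ _ r [p p01 ->] [q q01 ->] r01; exists ((1 - r) * p + r * q).
    have := mix_gt0 p q r; have := mix_gt0 (1 - p) (1 - q) r; lra.
  by rewrite /lerp; apply: pt_ext; coords; ring.
move=> w [r r01 ->]; have [h|h] := half_disc k r r01.
  by apply: filterS (nbhs_interior h) => z hz _.
apply: filterS (nbhs_interior h) => z hz [q q01 e]; split.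
  by rewrite e => hl; exfalso; apply: (left_right_at k q) => //; rewrite -e.
by move=> hl; exfalso; exact: (left_right_at k r).
Qed.

(** Near the crossing point the segment meets both half-discs, one of which is
    contained in the region. *)
Lemma crossing_interior k a b s t : 0 < s < 1 -> 0 < t < 1 ->
  lerp (f k) (f k.+1) s = lerp a b t -> orient (f k) (f k.+1) a != 0 ->
  exists2 z, segment a b z & P° z.
Proof.
move=> s01 t01 e oa; set o := orient (f k) (f k.+1).
have ow : (1 - t) * o a + t * o b = 0.
  rewrite -orient_lerp -e; apply: segment_orient0.
  by apply/segmentP; exists s => //; lra.
have pick U : nbhs (lerp a b t) U -> exists z1 z2,
   [/\ segment a b z1, segment a b z2, (o z1 < 0)%R, (0 < o z2)%R & U z1 /\ U z2].
  move=> /near_lerp[r r0 hr].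
  have [r' [r0' rr' rt]] := ex_smaller r t r0 ltac:(lra).
  have [m [m0 mr' m1]] := ex_smaller r' (1 - t) r0' ltac:(lra).
  have mr := lt_trans mr' rr'; have mt := lt_trans mr' rt.
  have seg s' : `|s' - t| <= m -> segment a b (lerp a b s').
    by rewrite ler_norml => ?; apply/segmentP; exists s' => //; lra.
  have Us s' : `|s' - t| <= m -> U (lerp a b s').
    by move=> h; apply: hr; exact: le_lt_trans h mr.
  have n1 : `|t - m - t| <= m by rewrite ler_norml; lra.
  have n2 : `|t + m - t| <= m by rewrite ler_norml; lra.
  have o1 : o (lerp a b (t - m)) = m * (o a - o b).
    by rewrite /o orient_lerp -/o; lra.
  have o2 : o (lerp a b (t + m)) = m * (o b - o a).
    by rewrite /o orient_lerp -/o; lra.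
  have [oab|oab] : o a < o b \/ o b < o a.
    have : o a != 0 by []. rewrite neq_lt => /orP[h|h]; [left|right]; nra.
  - exists (lerp a b (t - m)), (lerp a b (t + m)); split=> //;
      [exact: seg | exact: seg | rewrite o1; nra | rewrite o2; nra | split; exact: Us].
  - exists (lerp a b (t + m)), (lerp a b (t - m)); split=> //;
      [exact: seg | exact: seg | rewrite o2; nra | rewrite o1; nra | split; exact: Us].
have co : continuous o by exact: continuous_orient.
have [h|h] := half_disc k s s01; rewrite e in h.
- have [_ [z [_ sz _ oz [_ Uz]]]] := pick _ (nbhs_interior h).
  exists z => //; apply: filterS (filterI Uz (near_pos _ _ co oz)) => y [[hy _] oy].
  exact: hy.
- have [z [_ [sz _ oz _ [Uz _]]]] := pick _ (nbhs_interior h).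
  exists z => //; apply: filterS (filterI Uz (near_neg _ _ co oz)) => y [[hy _] oy].
  exact: hy.
Qed.

End Region.
End CyclicPath.
End Polygon.

(** * Turning angles, convex vertices and orientation of polygons *)

Section Turning.
Context {R : realType}.
Implicit Types (a b c d u v w x y z : (R * R)%type) (s t e : R)
  (C U P : set (R * R)) (f : nat -> R * R).

Definition turn f k := orient (f k) (f k.+1) (f k.+2).

(** Points near the vertex k + 1, in the basis of the two sides there. *)
Definition corner f k s t : R * R :=
  f k.+1 + s *: (f k - f k.+1) + t *: (f k.+2 - f k.+1).

Lemma corner_lerp f k s t s' t' r :
  lerp (corner f k s t) (corner f k s' t') r =
  corner f k ((1 - r) * s + r * s') ((1 - r) * t + r * t').
Proof.
rewrite /lerp /corner.
by move: (f k) (f k.+1) (f k.+2) => a b c; apply: pt_ext; coords; ring.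
Qed.

Lemma corner_orientl f k s t :
  orient (f k) (f k.+1) (corner f k s t) = t * turn f k.
Proof.
rewrite /corner /turn.
by move: (f k) (f k.+1) (f k.+2) => a b c; coords; ring.
Qed.

Lemma corner_orientr f k s t :
  orient (f k.+1) (f k.+2) (corner f k s t) = s * turn f k.
Proof.
rewrite /corner /turn.
by move: (f k) (f k.+1) (f k.+2) => a b c; coords; ring.
Qed.

Lemma corner_l f k s : corner f k s 0 = lerp (f k) (f k.+1) (1 - s).
Proof.
rewrite /corner /lerp.
by move: (f k) (f k.+1) (f k.+2) => a b c; apply: pt_ext; coords; ring.
Qed.

Lemma corner_r f k t : corner f k 0 t = lerp (f k.+1) (f k.+2) t.
Proof.
rewrite /corner /lerp.
by move: (f k) (f k.+1) (f k.+2) => a b c; apply: pt_ext; coords; ring.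
Qed.

Lemma corner_splitl f k s t :
  corner f k s t = corner f k s 0 + t *: (f k.+2 - f k.+1).
Proof. by rewrite /corner scale0r addr0. Qed.

Lemma corner_splitr f k s t :
  corner f k s t = corner f k 0 t + s *: (f k - f k.+1).
Proof. by rewrite /corner scale0r addr0 addrAC. Qed.

(** The condition of convex_vertex, for the vertex k + 1 of a path indexed by
    the natural numbers. *)
Definition convex_at f P k := exists2 e : R, 0 < e &
  forall s t, 0 <= s -> 0 <= t -> s + t <= e -> P (corner f k s t).

Definition on_left f P :=
  forall k t, 0 < t < 1 -> left_at f P k (lerp (f k) (f k.+1) t).

Definition on_right f P :=
  forall k t, 0 < t < 1 -> right_at f P k (lerp (f k) (f k.+1) t).

Definition ccw_polygon n f P := polygon n f P /\ on_left f P.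

Section Turn.
Variables (n : nat) (f : nat -> R * R) (P : set (R * R)).
Hypotheses (fn : cyclic_path n f) (Pf : bounded_by f P).

Lemma near_vertex k : \forall z \near f k.+1, sides f z ->
  segment (f k) (f k.+1) z \/ segment (f k.+1) (f k.+2) z.
Proof.
apply: filterS (near_sides n f fn (f k.+1)
  (fun j => f j = f k \/ f j = f k.+1) (vertex_side_only n f fn k)).
move=> z h /h [j [e|e]]; have /(cyc_succ _ _ fn) e' := e; rewrite e e'.
  by left.
by right.
Qed.

Let turn0 k : turn f k != 0. Proof. exact: (cyc_turn n f fn). Qed.

Lemma sector k : exists2 e : R, 0 < e &
  (forall s t, 0 < s -> 0 < t -> s + t < e -> P (corner f k s t)) \/
  (forall s t, 0 < s -> 0 < t -> s + t < e -> ~ P (corner f k s t)).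
Proof.
have [e e0 he] := near_affine2 _ (f k - f k.+1) (f k.+2 - f k.+1) _ (near_vertex k).
exists e => //.
pose C := [set z | exists st : R * R,
  [/\ 0 < st.1, 0 < st.2, st.1 + st.2 < e & z = corner f k st.1 st.2]].
have cC : cvx C.
  move=> _ _ r [[s t] /= [s0 t0 st ->]] [[s' t'] /= [s0' t0' st' ->]] r01.
  exists ((1 - r) * s + r * s', (1 - r) * t + r * t') => /=.
  have cmb (p q : R) := mix_gt0 p q r.
  split; [exact: cmb | exact: cmb | | exact: corner_lerp].
  have := cmb (e - s - t) (e - s' - t'); lra.
have dC z : C z -> ~ sides f z.
  move=> [[s t] /= [s0 t0 st ->]] h.
  have [] : segment (f k) (f k.+1) (corner f k s t) \/
            segment (f k.+1) (f k.+2) (corner f k s t).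
  - by apply: he => //; rewrite gtr0_norm; lra.
  - move=> /segment_orient0/eqP; rewrite corner_orientl mulf_eq0 (negbTE (turn0 k)).
    by rewrite (gt_eqF t0).
  - move=> /segment_orient0/eqP; rewrite corner_orientr mulf_eq0 (negbTE (turn0 k)).
    by rewrite (gt_eqF s0).
have inC s t : 0 < s -> 0 < t -> s + t < e -> C (corner f k s t).
  by move=> s0 t0 st; exists (s, t).
have [h|h] := pselect (P (corner f k (e / 3) (e / 3))).
  left=> s t s0 t0 st; apply: (cvx_region f P Pf C cC dC _ _ _ _ h); apply: inC => //; lra.
right=> s t s0 t0 st Pz; apply: h.
by apply: (cvx_region f P Pf C cC dC _ _ _ _ Pz); apply: inC => //; lra.
Qed.

(** Both sides at a vertex bound the small sector there, so that P lies on
    the same hand of both. *)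
Lemma sectorP k s t : 0 < s < 1 -> 0 < t < 1 ->
  exists2 e : R, 0 < e &
  (forall s' t', 0 < s' -> 0 < t' -> s' + t' < e ->
    [/\ left_at f P k (lerp (f k) (f k.+1) s) ->
        (0 < turn f k <-> P (corner f k s' t')),
     right_at f P k (lerp (f k) (f k.+1) s) ->
        (turn f k < 0 <-> P (corner f k s' t')),
     left_at f P k.+1 (lerp (f k.+1) (f k.+2) t) ->
        (0 < turn f k <-> P (corner f k s' t')) &
     right_at f P k.+1 (lerp (f k.+1) (f k.+2) t) ->
        (turn f k < 0 <-> P (corner f k s' t'))]).
Proof.
move=> s01 t01; have [e e0 he] := sector k; exists e => // s' t' s0 t0 st.
have const s1 t1 : 0 < s1 -> 0 < t1 -> s1 + t1 < e ->
    P (corner f k s1 t1) <-> P (corner f k s' t').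
  move=> s10 t10 st1.
  by case: he => h; split=> // Pz; [exact: h|exact: h | case: (h _ _ s10 t10 st1) | case: (h _ _ s0 t0 st)].
have [r [r0 re r1]] := ex_smaller e 1 e0 ltr01.
have r01 : 0 < 1 - r < 1 by lra.
have r01' : 0 < r < 1 by lra.
(* a point of the sector close to the first side, resp. to the second one *)
have nl (Q : R * R -> Prop) : (\forall z \near lerp (f k) (f k.+1) (1 - r), Q z) ->
    exists t1, [/\ 0 < t1, P (corner f k r t1) <-> P (corner f k s' t') & Q (corner f k r t1)].
  move=> /(near_affine1 _ (f k.+2 - f k.+1))[q q0 hq].
  have [t1 [t10 t1q t1e]] := ex_smaller q (e - r) q0 ltac:(by rewrite subr_gt0).
  exists t1; split=> //; first by apply: const => //; lra.
  by rewrite corner_splitl corner_l; apply: hq; rewrite gtr0_norm.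
have nr (Q : R * R -> Prop) : (\forall z \near lerp (f k.+1) (f k.+2) r, Q z) ->
    exists s1, [/\ 0 < s1, P (corner f k s1 r) <-> P (corner f k s' t') & Q (corner f k s1 r)].
  move=> /(near_affine1 _ (f k - f k.+1))[q q0 hq].
  have [t1 [t10 t1q t1e]] := ex_smaller q (e - r) q0 ltac:(by rewrite subr_gt0).
  exists t1; split=> //; first by apply: const => //; lra.
  by rewrite corner_splitr corner_r; apply: hq; rewrite gtr0_norm.
have right_const j p q : 0 < p < 1 -> 0 < q < 1 ->
    right_at f P j (lerp (f j) (f j.+1) p) -> right_at f P j (lerp (f j) (f j.+1) q).
  move=> p01 q01 h; have [h'|//] := half_disc n f fn P Pf j q q01.
  by case: (left_right_at n f fn P j p p01) => //; exact: (left_at_side n f fn P Pf j q p).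
have [tp|tn|tz] := ltgtP (turn f k) 0; last by move: (turn0 k); rewrite tz eqxx.
- split=> h.
  + have [t1 [t10 <- [_ hn]]] := nl _ (left_at_side n f fn P Pf k _ _ s01 r01 h).
    by split=> // Pz; case: hn => //; rewrite corner_orientl; nra.
  + have [t1 [t10 <- [hp _]]] := nl _ (right_const k _ _ s01 r01 h).
    by split=> // _; apply: hp; rewrite corner_orientl; nra.
  + have [t1 [t10 <- [_ hn]]] := nr _ (left_at_side n f fn P Pf k.+1 _ _ t01 r01' h).
    by split=> // Pz; case: hn => //; rewrite corner_orientr; nra.
  + have [t1 [t10 <- [hp _]]] := nr _ (right_const k.+1 _ _ t01 r01' h).
    by split=> // _; apply: hp; rewrite corner_orientr; nra.
- split=> h.
  + have [t1 [t10 <- [hp _]]] := nl _ (left_at_side n f fn P Pf k _ _ s01 r01 h).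
    by split=> // _; apply: hp; rewrite corner_orientl; nra.
  + have [t1 [t10 <- [_ hn]]] := nl _ (right_const k _ _ s01 r01 h).
    by split=> // Pz; case: hn => //; rewrite corner_orientl; nra.
  + have [t1 [t10 <- [hp _]]] := nr _ (left_at_side n f fn P Pf k.+1 _ _ t01 r01' h).
    by split=> // _; apply: hp; rewrite corner_orientr; nra.
  + have [t1 [t10 <- [_ hn]]] := nr _ (right_const k.+1 _ _ t01 r01' h).
    by split=> // Pz; case: hn => //; rewrite corner_orientr; nra.
Qed.

Lemma same_hand k s t : 0 < s < 1 -> 0 < t < 1 ->
  left_at f P k (lerp (f k) (f k.+1) s) <->
  left_at f P k.+1 (lerp (f k.+1) (f k.+2) t).
Proof.
move=> s01 t01; have [e e0 he] := sectorP k s t s01 t01.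
have e3 : 0 < e / 3 by lra.
have e3' : e / 3 + e / 3 < e by lra.
have [h1 h2 h3 h4] := he _ _ e3 e3 e3'.
have tdec : ~ (0 < turn f k <-> turn f k < 0).
  by have := turn0 k; rewrite neq_lt => /orP[h|h]; rewrite h ltNge (ltW h) => -[]; intuition.
have [hl|hl] := half_disc n f fn P Pf k s s01;
have [hr|hr] := half_disc n f fn P Pf k.+1 t t01; split=> // hl'.
- by case: tdec; rewrite (h1 hl) (h4 hr).
- by case: tdec; rewrite (h2 hl) (h3 hr).
- by case: (left_right_at n f fn P k s s01).
- by case: (left_right_at n f fn P k.+1 t t01).
Qed.

Lemma on_left_or_right : on_left f P \/ on_right f P.
Proof.
pose h : R := 2^-1; have h01 : 0 < h < 1 by rewrite /h; lra.
have all k : left_at f P k (lerp (f k) (f k.+1) h) <->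
    left_at f P 0%N (lerp (f 0%N) (f 1%N) h).
  elim: k => // k <-; rewrite -(same_hand k h h) //.
have [h0|h0] := half_disc n f fn P Pf 0 h h01.
  left=> k t t01; apply: (left_at_side n f fn P Pf k h) => //.
  by rewrite all.
right=> k t t01; have [hl|//] := half_disc n f fn P Pf k t t01.
case: (left_right_at n f fn P 0 h h01) => //; rewrite -(all k).
exact: (left_at_side n f fn P Pf k t h).
Qed.

Lemma ray_leaves z d : d != 0 -> ~ (forall t, 0 <= t -> P (z + t *: d)).
Proof.
move=> d0 h; have [cP _ _] := Pf.
have [M [_ hM]] : bounded_set P by exact: compact_bounded.
pose N := Num.max (M + 1) 1.
have N1 : 1 <= N by rewrite le_max lexx orbT.
have MN : M < N by rewrite lt_max ltrDl ltr01.
have bd t : 0 <= t -> `|z + t *: d| <= N by move=> t0; apply: (hM N MN); exact: h.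
have nd : 0 < `|d| by rewrite normr_gt0.
pose t := (2 * N + 1) / `|d|.
have t0 : 0 <= t by apply: divr_ge0; [lra | exact: ltW].
have := bd t t0; have := bd 0 (lexx 0); rewrite scale0r addr0 => h0 ht.
have : `|t *: d| <= 2 * N.
  rewrite -[t *: d](addKr z) (le_trans (ler_normD _ _))// normrN.
  by have := lerD h0 ht; lra.
by rewrite normrZ ger0_norm// /t mulfVK ?gt_eqF//; lra.
Qed.

(** The complementary open half-plane is convex and misses the boundary, so that
    it would lie in the region entirely, but the region is bounded. *)
Lemma region_half_plane g M : affine g -> (forall k, g (f k) <= M) ->
  forall z, P z -> g z <= M.
Proof.
move=> ag hg z Pz; rewrite leNgt; apply/negP => gz.
have ag' : affine (fun y => g y + - M).
  by apply: affineD => //; exists 0, 0, (- M) => y; ring.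
have sg y : sides f y -> g y <= M.
  move=> [k /segmentP[t t01 ->]]; rewrite (affine_lerp ag).
  have := hg k; have := hg k.+1; nra.
have cg := cvx_region f P Pf _ (cvx_pos _ ag').
have {}cg x y : M < g x -> M < g y -> P x -> P y.
  move=> gx gy; apply: cg => /=; rewrite ?subr_gt0//.
  by move=> w; rewrite subr_gt0 => gw /sg; rewrite leNgt gw.
have [k [l [m gE]]] := ag.
apply: (ray_leaves z (z - f 0%N)).
  by rewrite subr_eq0; apply/eqP => e; move: gz; rewrite e ltNge hg.
move=> t t0; apply: (cg z) => //.
have -> : g (z + t *: (z - f 0%N)) = g z + t * (g z - g (f 0%N)).
  by rewrite !gE; move: (f 0%N) => a; clear gz Pz ; coords; ring.
have := hg 0%N; nra.
Qed.

Section CCW.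
Hypothesis Pleft : on_left f P.

Lemma convex_atP k : convex_at f P k <-> 0 < turn f k.
Proof.
pose h : R := 2^-1; have h01 : 0 < h < 1 by rewrite /h; lra.
have [e e0 he] := sectorP k h h h01 h01.
have {}he s t : 0 < s -> 0 < t -> s + t < e -> 0 < turn f k <-> P (corner f k s t).
  by move=> s0 t0 st; have [/(_ (Pleft k h h01))] := he s t s0 t0 st.
split=> [[e' e0' he']|tp].
  have [r [r0 re re']] := ex_smaller (e / 2) (e' / 2) ltac:(lra) ltac:(lra).
  by rewrite (he r r)//; [apply: he'; lra | lra].
exists (Num.min (e / 2) 1) => [|s t]; first by rewrite lt_min; lra.
rewrite !le_eqVlt => /predU1P[<-|s0] /predU1P[<-|t0]; rewrite -le_eqVlt => st.
- rewrite corner_l subr0 lerp1; apply: (side_region f P Pf _ _).1.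
  by exists k; exact: segment_r.
- rewrite corner_r; apply: (side_region f P Pf _ _).1.
  exists k.+1; apply/segmentP; exists t => //; rewrite ltW//=.
  by move: st; rewrite add0r le_min => /andP[].
- rewrite corner_l; apply: (side_region f P Pf _ _).1.
  exists k; apply/segmentP; exists (1 - s) => //.
  by move: st; rewrite addr0 le_min => /andP[]; lra.
- by apply/he => //; move: st; rewrite le_min => /andP[]; lra.
Qed.

(** A vertex where an affine function has its strict maximum is a left turn.
    Otherwise the region, on the left of the side that arrives there, would
    fill a half-disc that reaches beyond the maximum. *)
Lemma extreme_turn g k : affine g ->
  (forall j, f j <> f k.+1 -> g (f j) < g (f k.+1)) -> 0 < turn f k.
Proof.
move=> ag hg; have [//|tn|tz] := ltgtP 0 (turn f k); last first.
  by have := turn0 k; rewrite -tz eqxx.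
exfalso; have gP z : P z -> g z <= g (f k.+1).
  apply: region_half_plane => // j.
  by have [->//|/hg/ltW//] := pselect (f j = f k.+1).
have [e e0 he] := near_affine2 _ (f k - f k.+1) (f k.+2 - f k.+1) _ (near_vertex k).
pose C := [set z | exists st : R * R,
  [/\ - e < st.1 < e, - e < st.2 & st.2 < 0 /\ z = corner f k st.1 st.2]].
have cC : cvx C.
  move=> _ _ r [[s t] /= [s0 t0 [t1 ->]]] [[s' t'] /= [s0' t0' [t1' ->]]] r01.
  exists ((1 - r) * s + r * s', (1 - r) * t + r * t') => /=.
  have cmb (p q : R) := mix_gt0 p q r.
  split; last by split; [have := cmb (- t) (- t'); lra | exact: corner_lerp].
    have := cmb (s + e) (s' + e); have := cmb (e - s) (e - s'); lra.
  have := cmb (t + e) (t' + e); lra.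
have dC z : C z -> ~ sides f z.
  move=> [[s t] /= [/andP[s0 s1] t0 [t1 ->]]] h.
  have [] : segment (f k) (f k.+1) (corner f k s t) \/
            segment (f k.+1) (f k.+2) (corner f k s t).
  - by apply: he => //; rewrite ltr_norml; lra.
  - move=> /segment_orient0/eqP; rewrite corner_orientl mulf_eq0 (negbTE (turn0 k)).
    by rewrite (lt_eqF t1).
  - move=> /segmentP[r r01 er].
    have := corner_orientl f k s t; rewrite er -corner_r corner_orientl; nra.
have [r [r0 re r1]] := ex_smaller e 1 e0 ltr01.
have r01 : 0 < 1 - r < 1 by lra.
have [q q0 hq] := near_affine1 _ (f k.+2 - f k.+1) _ (Pleft k (1 - r) r01).
have [t [t0 tq te]] := ex_smaller q e q0 e0.
have Pin : P (corner f k r (- t)).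
  have [|+ _] := hq (- t); first by rewrite normrN gtr0_norm.
  rewrite -corner_l -corner_splitl corner_orientl; apply; nra.
have : P (corner f k (- r) (- t)).
  apply: (cvx_region f P Pf C cC dC _ _ _ _ Pin); [exists (r, - t)|exists (- r, - t)];
    by rewrite /=; split; [lra|lra|split; [lra|]].
move=> /gP.
have -> : g (corner f k (- r) (- t)) = g (f k.+1) - r * (g (f k) - g (f k.+1))
    - t * (g (f k.+2) - g (f k.+1)).
  have [k' [l [m gE]]] := ag; rewrite !gE /corner.
  by move: (f k) (f k.+1) (f k.+2) => a b c; clear; coords; ring.
have := hg k (cyc_neqS n f fn k); have := hg k.+2 (nesym (cyc_neqS n f fn k.+1)).
nra.
Qed.

End CCW.
End Turn.

(** Modulo n, the index k * (n - 1) is - k. *)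
Lemma cyclic_path_rev n f : cyclic_path n f ->
  cyclic_path n (fun k => f (k * n.-1)%N) /\
  sides (fun k => f (k * n.-1)%N) = sides f /\
  forall k, exists j, [/\ f (k * n.-1)%N = f j.+2, f (k.+1 * n.-1)%N = f j.+1
    & f (k.+2 * n.-1)%N = f j].
Proof.
move=> fn; have [n2 inj tn nc] := fn.
have triple k : exists j, [/\ f (k * n.-1)%N = f j.+2, f (k.+1 * n.-1)%N = f j.+1
    & f (k.+2 * n.-1)%N = f j].
  exists (k.+2 * n.-1)%N; split=> //; apply/inj.
    have -> : (k.+2 * n.-1).+2 = (2 * n + k * n.-1)%N by lia.
    by rewrite modnMDl.
  have -> : (k.+2 * n.-1).+1 = (1 * n + k.+1 * n.-1)%N by lia.
  by rewrite modnMDl.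
have triple' j : exists k, f (k * n.-1)%N = f j.+1 /\ f (k.+1 * n.-1)%N = f j.
  exists (j.+1 * n.-1)%N; split; apply/inj.
    have -> : (j.+1 * n.-1 * n.-1)%N = (j.+1 * (n - 2) * n + j.+1)%N by nia.
    by rewrite modnMDl.
  have -> : ((j.+1 * n.-1).+1 * n.-1)%N = ((j.+1 * (n - 2) + 1) * n + j)%N by nia.
  by rewrite modnMDl.
split; [split=> //|split=> //].
- move=> i j; rewrite inj; split=> h.
    have: (i * n.-1 * n.-1 = j * n.-1 * n.-1 %[mod n])%N.
      by rewrite -[LHS]modnMml h modnMml.
    have e i' : (i' * n.-1 * n.-1)%N = (i' * (n - 2) * n + i')%N by nia.
    by rewrite !e !modnMDl.
  by rewrite -modnMml h modnMml.
- move=> k; have [j [-> -> ->]] := triple k.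
  by rewrite orient_cyc orient_swap oppr_eq0 -orient_cyc.
- move=> i j; have [i1 [e1 e2 _]] := triple i; have [j1 [e3 e4 _]] := triple j.
  move=> /=; rewrite e1 e2 e3 e4 => ne.
  rewrite (segmentC (f i1.+2)) (segmentC (f j1.+2)).
  rewrite (setUC [set f i1.+2]) (setUC [set f j1.+2]).
  by apply: nc => h; apply: ne; exact: (cyc_succ n f fn _ _).1 h.
- apply/seteqP; split=> z [k].
    have [j [-> -> _]] := triple k; rewrite segmentC => h; by exists j.+1.
  have [j [e1 e2]] := triple' k; rewrite segmentC => h; exists j.
  by rewrite e1 e2.
Qed.

Lemma ccw_or_reverse n f P : polygon n f P ->
  ccw_polygon n f P \/ ccw_polygon n (fun k => f (k * n.-1)%N) P.
Proof.
move=> [fn Pf]; have [fn' [sE tr]] := cyclic_path_rev n f fn.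
have Pf' : bounded_by (fun k => f (k * n.-1)%N) P.
  by have [c r b] := Pf; split=> //; rewrite sE.
have [h|h] := on_left_or_right n f P fn Pf; first by left.
right; split=> // k t t01; have [j [e1 e2 _]] := tr k.
rewrite /left_at e1 e2 lerpC.
have t01' : 0 < 1 - t < 1 by lra.
apply: filterS (h j.+1 _ t01') => z.
by rewrite (orient_swap (f j.+1) (f j.+2)) oppr_gt0 oppr_lt0.
Qed.

End Turning.

(** * Every simple closed polygonal line bounds a region *)

Section JordanRegion.
Context {R : realType}.
Implicit Types (a b c d u v w x y z : (R * R)%type) (s t e m : R)
  (C U P : set (R * R)).

Lemma seq_ub (L : seq R) : exists m, forall r, r \in L -> r < m.
Proof.
elim: L => [|r L [m hm]]; first by exists 0.
exists (Num.max m (r + 1)) => s; rewrite inE lt_max => /predU1P[->|/hm -> //].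
by rewrite ltrDl ltr01 orbT.
Qed.

Lemma avoid_seq (L : seq R) s t : s < t ->
  exists2 r : R, s < r < t & r \notin L.
Proof.
elim: L s t => [|x L IHL] s t st; first by exists ((s + t) / 2) => //; lra.
have [xs|sx] := leP x s.
  have [r /andP[sr rt] rL] := IHL s t st; exists r; rewrite ?sr//.
  by rewrite inE negb_or rL andbT gt_eqF// (le_lt_trans xs).
have [tx|xt] := leP t x.
  have [r /andP[sr rt] rL] := IHL s t st; exists r; rewrite ?sr//.
  by rewrite inE negb_or rL andbT lt_eqF// (lt_le_trans rt).
have [r /andP[sr rx] rL] := IHL s x sx; exists r.
  by rewrite sr (lt_trans rx).
by rewrite inE negb_or rL andbT lt_eqF.
Qed.

(** A linear coordinate; its fibres play the role of vertical lines. *)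
Definition absc m z : R := z.1 + m * z.2.

Lemma affine_absc m : affine (absc m).
Proof. by exists 1, m, 0 => z; rewrite /absc; ring. Qed.

(** The vertical ray below z crosses the segment ab. The comparisons are such that
    a ray through a vertex sees it as slightly displaced to one side. *)
Definition crosses m a b z :=
  ((absc m a < absc m z) (+) (absc m b < absc m z)) &&
  (0 < orient a b z * (absc m b - absc m a)).

Lemma absc_orient_l m a b z : absc m z = absc m a ->
  orient a b z * (absc m b - absc m a) =
    (z.2 - a.2) * (absc m b - absc m a) ^+ 2.
Proof.
rewrite /absc => e.
have e' : z.1 = a.1 + m * a.2 - m * z.2 by rewrite -e; ring.
by move: e' {e}; coords => ->; ring.
Qed.

Lemma absc_orient_r m a b z : absc m z = absc m b ->
  orient a b z * (absc m b - absc m a) =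
    (z.2 - b.2) * (absc m b - absc m a) ^+ 2.
Proof.
rewrite /absc => e.
have e' : z.1 = b.1 + m * b.2 - m * z.2 by rewrite -e; ring.
by move: e' {e}; coords => ->; ring.
Qed.

Lemma near_lt (g : R * R -> R) (c : R) z : affine g -> g z != c ->
  \forall z' \near z, (c < g z') = (c < g z).
Proof.
move=> ag gz.
have a1 : affine (fun y => g y + - c).
  by apply: affineD => //; exists 0, 0, (- c) => y; ring.
have [h|h] := ltP c (g z).
  have := near_pos _ z (affine_continuous _ a1).
  by rewrite subr_gt0 => /(_ h); apply: filterS => y; rewrite subr_gt0.
have {}h : g z < c by rewrite lt_neqAle gz.
have := near_neg _ z (affine_continuous _ a1).
rewrite subr_lt0 => /(_ h); apply: filterS => y; rewrite subr_lt0 => yc.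
by rewrite ltNge (ltW yc).
Qed.

Lemma between_segment m a b z :
  (absc m a < absc m z) (+) (absc m b < absc m z) ->
  absc m z != absc m a -> absc m z != absc m b ->
  orient a b z = 0 -> segment a b z.
Proof.
move=> zab za zb oz; pose h := absc m b - absc m a.
have bt : absc m a < absc m z < absc m b \/ absc m b < absc m z < absc m a.
  move: zab; have [az|az] := ltP (absc m a) (absc m z);
  have [bz|bz] := ltP (absc m b) (absc m z) => // _; [left|right].
    by rewrite lt_neqAle zb.
  by rewrite lt_neqAle za.
have h0 : h != 0.
  by rewrite /h subr_eq0; case: bt => /andP[h1 h2]; [rewrite gt_eqF | rewrite lt_eqF]; rewrite // (lt_trans h1).
pose t := (absc m z - absc m a) / h.
have t01 : 0 <= t <= 1.
  have e : t * h = absc m z - absc m a by rewrite /t mulfVK.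
  by case: bt => bt; have := e; rewrite /h; nra.
apply/segmentP; exists t => //.
have ht : t * h = absc m z - absc m a by rewrite /t mulfVK.
suff : h *: z = h *: lerp a b t by move=> /(scalerI h0).
rewrite lerpE scalerDr scalerA (mulrC h) ht {t t01 ht h0} /h; move: oz {zab za zb bt}.
rewrite /absc; move=> oz; apply: pt_ext; move: oz; coords => oz.
  apply/eqP; rewrite -subr_eq0; apply/eqP; transitivity (- m * 0 : R); last by ring.
  by rewrite -oz; ring.
apply/eqP; rewrite -subr_eq0; apply/eqP; rewrite -oz; ring.
Qed.

Section Path.
Variables (n : nat) (f : nat -> R * R).
Hypothesis fn : cyclic_path n f.
Variable m : R.
Hypothesis inj_absc : forall i j, f i <> f j -> absc m (f i) != absc m (f j).

Definition parity z := \big[addb/false]_(k < n) crosses m (f k) (f k.+1) z.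

Lemma near_crosses k z : absc m z != absc m (f k) ->
  absc m z != absc m (f k.+1) -> ~ segment (f k) (f k.+1) z ->
  \forall z' \near z, crosses m (f k) (f k.+1) z' = crosses m (f k) (f k.+1) z.
Proof.
move=> z1 z2 sz.
have l1 := near_lt _ _ _ (affine_absc m) z1.
have l2 := near_lt _ _ _ (affine_absc m) z2.
have [zab|zab] := boolP ((absc m (f k) < absc m z) (+) (absc m (f k.+1) < absc m z));
  last first.
  by apply: filterS (filterI l1 l2) => y [e1 e2]; rewrite /crosses e1 e2 (negbTE zab).
have oz : orient (f k) (f k.+1) z != 0.
  by apply/eqP => oz; apply: sz; exact: (between_segment m).
have ao : affine (fun y => orient (f k) (f k.+1) y * (absc m (f k.+1) - absc m (f k))).
  have [p [q [r E]]] := affine_orient (f k) (f k.+1).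
  set h := _ - _; exists (p * h), (q * h), (r * h) => y; rewrite E; ring.
have l3 : \forall y \near z, _ := near_lt _ 0 z ao _.
have := l3 _; rewrite mulf_neq0//; last first.
  by rewrite subr_eq0 eq_sym; apply: inj_absc; exact: (cyc_neqS n f fn).
move=> /(_ isT) {}l3.
apply: filterS (filterI (filterI l1 l2) l3) => y [[e1 e2] e3].
by rewrite /crosses e1 e2 e3.
Qed.

(** Off the sides, parity is locally constant.  The only vertex that may
    matter is the one in the vertical line of z, and it contributes to the
    terms of its two sides equally. *)
Lemma near_parity z : ~ sides f z -> \forall z' \near z, parity z' = parity z.
Proof.
move=> sz.
pose D k y := (absc m (f k) < absc m y) (+) (absc m (f k) < absc m z).
pose K := `[< exists2 j, absc m z = absc m (f j) & (f j).2 < z.2 >].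
have KE j : absc m z = absc m (f j) -> K = ((f j).2 < z.2).
  move=> zj; apply/asboolP/idP => [[i zi iz]|jz]; last by exists j.
  have [<-//|/inj_absc/eqP[]] := pselect (f i = f j).
  by rewrite -zi -zj.
have z2 j : absc m z = absc m (f j) -> z.2 != (f j).2.
  move=> zj; apply/eqP => z2; apply: sz; exists j.
  suff -> : z = f j by exact: segment_l.
  apply: pt_ext => //; apply/eqP; rewrite -subr_eq0; apply/eqP.
  by move: zj; rewrite /absc z2 => /addIr ->; rewrite subrr.
have Dfalse k : absc m z != absc m (f k) -> \forall y \near z, D k y = false.
  move=> zk; apply: filterS (near_lt _ _ _ (affine_absc m) zk) => y e.
  by rewrite /D e addbb.
have step k : \forall y \near z,
    crosses m (f k) (f k.+1) y (+) crosses m (f k) (f k.+1) z =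
    (D k y (+) D k.+1 y) && K.
  have ne := inj_absc _ _ (cyc_neqS n f fn k).
  have h2 : 0 < (absc m (f k.+1) - absc m (f k)) ^+ 2.
    by rewrite lt_neqAle sqr_ge0 eq_sym sqrf_eq0 subr_eq0 eq_sym ne.
  have ao : affine (fun y => orient (f k) (f k.+1) y * (absc m (f k.+1) - absc m (f k))).
    have [p [q [r E]]] := affine_orient (f k) (f k.+1).
    set h := _ - _; exists (p * h), (q * h), (r * h) => y; rewrite E; ring.
  have [zk|zk] := eqVneq (absc m z) (absc m (f k)).
    have zk1 : absc m z != absc m (f k.+1) by rewrite zk.
    have o0 := absc_orient_l m _ (f k.+1) z zk.
    have Kz : K = (0 < orient (f k) (f k.+1) z * (absc m (f k.+1) - absc m (f k))).
      by rewrite (KE k)// o0 pmulr_lgt0// subr_gt0.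
    have on0 : orient (f k) (f k.+1) z * (absc m (f k.+1) - absc m (f k)) != 0.
      rewrite o0; apply: mulf_neq0; last exact: lt0r_neq0.
      by rewrite subr_eq0; exact: z2.
    apply: filterS (filterI (filterI (Dfalse _ zk1) (near_lt _ 0 z ao on0))
      (near_lt _ _ _ (affine_absc m) zk1)) => y [[d l] e].
    rewrite d /crosses l -Kz e /D; clear -K.
    by case: K; do !case: (_ < _).
  have [zk1|zk1] := eqVneq (absc m z) (absc m (f k.+1)).
    have o0 := absc_orient_r m (f k) _ z zk1.
    have Kz : K = (0 < orient (f k) (f k.+1) z * (absc m (f k.+1) - absc m (f k))).
      by rewrite (KE k.+1)// o0 pmulr_lgt0// subr_gt0.
    have on0 : orient (f k) (f k.+1) z * (absc m (f k.+1) - absc m (f k)) != 0.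
      rewrite o0; apply: mulf_neq0; last exact: lt0r_neq0.
      by rewrite subr_eq0; exact: z2.
    apply: filterS (filterI (filterI (Dfalse _ zk) (near_lt _ 0 z ao on0))
      (near_lt _ _ _ (affine_absc m) zk)) => y [[d l] e].
    rewrite d /crosses l -Kz e /D; clear -K.
    by case: K; do !case: (_ < _).
  have sk : ~ segment (f k) (f k.+1) z by move=> h; apply: sz; exists k.
  apply: filterS (filterI (filterI (Dfalse _ zk) (Dfalse _ zk1))
    (near_crosses k z zk zk1 sk)) => y [[d1 d2] ->].
  by rewrite d1 d2 addbb.
apply: filterS (near_ltn n (fun k y => crosses m (f k) (f k.+1) y (+)
  crosses m (f k) (f k.+1) z = (D k y (+) D k.+1 y) && K) z (fun k _ => step k)).
move=> y h; suff : parity y (+) parity z = false.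
  by case: (parity y); case: (parity z).
have -> : parity y (+) parity z =
    \big[addb/false]_(k < n) ((D k y (+) D k.+1 y) && K).
  rewrite /parity -big_split; apply: eq_bigr => k _; exact: h.
rewrite -big_distrl /= big_split /=.
have -> : \big[addb/false]_(k < n) D k.+1 y = \big[addb/false]_(k < n) D k y.
  have [n2 _ _ _] := fn; case: (n) n2 fn => // n' _ fn'.
  rewrite big_ord_recr [RHS]big_ord_recl /= addbC; congr (_ (+) _).
  rewrite /D; have -> // : f n'.+1 = f 0%N.
  by apply/(cyc_eq _ _ fn'); rewrite modnn mod0n.
by rewrite addbb.
Qed.

(** Both parities occur near every point of a side: near an interior point
    in no vertical line of a vertex, crossing the side changes one term. *)
Lemma parity_near_side w U : sides f w -> nbhs w U ->
  (exists z, [/\ U z, ~ sides f z & parity z]) /\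
  (exists z, [/\ U z, ~ sides f z & ~~ parity z]).
Proof.
move=> /(sides_lt n f fn)[k kn /segmentP[t t01 ->]] /nbhs_interior/near_lerp[e e0 he].
have ne := cyc_neqS n f fn k; have ane := inj_absc _ _ ne.
pose h := absc m (f k.+1) - absc m (f k).
have h0 : h != 0 by rewrite subr_eq0 eq_sym.
pose L := [seq (absc m (f j) - absc m (f k)) / h | j <- iota 0 n].
have [s [s01 st sL]] : exists s, [/\ 0 < s < 1, `|s - t| < e & s \notin L].
  have [|s /andP[s1 s2] sL] := avoid_seq L (Num.max 0 (t - e)) (Num.min 1 (t + e)).
    by rewrite lt_min !gt_max; lra.
  move: s1 s2; rewrite lt_min gt_max => /andP[s1 s2] /andP[s3 s4].
  by exists s; split=> //; [lra | rewrite ltr_norml; lra].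
set w' := lerp (f k) (f k.+1) s.
have Uw' : nbhs w' U by exact: he.
have w'E : absc m w' = absc m (f k) + s * h.
  by rewrite (affine_lerp (affine_absc m)) /h; ring.
have off j : absc m w' != absc m (f j).
  rewrite -(cyc_mod n f fn j); apply: contraNneq sL => e1.
  apply/mapP; exists (j %% n)%N.
    by rewrite mem_iota ltn_mod; case: (n) kn.
  by rewrite -e1 w'E addrAC subrr add0r mulfK.
have nears j : (j < n)%N -> \forall z \near w', j <> k ->
    crosses m (f j) (f j.+1) z = crosses m (f j) (f j.+1) w'.
  move=> jn; have [->|/eqP jk] := eqVneq j k; first by near=> z.
  have nj : ~ segment (f j) (f j.+1) w'.
    move=> /(open_side_only n f fn k s j s01)/(cyc_eq n f fn).
    by rewrite !modn_small.
  by apply: filterS (near_crosses _ _ (off j) (off j.+1) nj) => z ->.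
have {}nears := near_ltn n _ _ nears.
have xk : (absc m (f k) < absc m w') (+) (absc m (f k.+1) < absc m w').
  have e2 : absc m w' = absc m (f k.+1) - (1 - s) * h by rewrite w'E /h; ring.
  rewrite {1}w'E e2 !ltrDl.
  move: h0; rewrite neq_lt => /orP[h1|h1].
    have -> : (0 < s * h) = false by apply/negbTE; rewrite -leNgt; nra.
    have -> // : 0 < - ((1 - s) * h) by nra.
  have -> : 0 < s * h by nra.
  have -> // : (0 < - ((1 - s) * h)) = false by apply/negbTE; rewrite -leNgt; nra.
have l1 := near_lt _ _ _ (affine_absc m) (off k).
have l2 := near_lt _ _ _ (affine_absc m) (off k.+1).
have nk : \forall z \near w', crosses m (f k) (f k.+1) z = (0 < orient (f k) (f k.+1) z * h).
  by apply: filterS (filterI l1 l2) => z [e1 e2]; rewrite /crosses e1 e2 xk.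
have ns := near_open_side n f fn k s s01.
pose c0 := \big[addb/false]_(j < n | j != Ordinal kn) crosses m (f j) (f j.+1) w'.
have pE : \forall z \near w', parity z = (0 < orient (f k) (f k.+1) z * h) (+) c0.
  apply: filterS (filterI nears nk) => z [e1 e2].
  rewrite /parity (bigD1 (Ordinal kn))//= e2; congr (_ (+) _).
  by apply: eq_bigr => j jk; apply: e1 => // e3; case/eqP: jk; exact: val_inj.
have [z1 [z2 [[[Uz1 p1] s1] [[Uz2 p2] s2]]]] :=
  orient_perturb _ _ _ _ ne (filterI (filterI Uw' pE) ns).
rewrite (segment_orient0 _ _ w') => [lt1 lt2|]; last first.
  by apply/segmentP; exists s => //; lra.
have ns1 : ~ sides f z1 by move=> /s1/segment_orient0 e1; rewrite e1 ltxx in lt1.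
have ns2 : ~ sides f z2 by move=> /s2/segment_orient0 e1; rewrite e1 ltxx in lt2.
have p12 : parity z1 = ~~ parity z2.
  rewrite p1 p2 -addNb; congr (_ (+) _).
  move: h0; rewrite neq_lt => /orP[h1|h1].
    have -> : 0 < orient (f k) (f k.+1) z1 * h by nra.
    by apply/esym; rewrite -leNgt; nra.
  have -> : 0 < orient (f k) (f k.+1) z2 * h by nra.
  by apply/negbTE; rewrite -leNgt; nra.
have [pz|pz] := boolP (parity z2).
  by split; [exists z2 | exists z1; rewrite p12 pz].
by split; [exists z1; rewrite p12 pz | exists z2].
Unshelve. all: by end_near. Qed.

Definition odd_region : set (R * R) := [set z | parity z \/ sides f z].

Lemma sides_closed : closed (sides f).
Proof.
rewrite -[sides f]setCK; apply: open_closedC; rewrite openE => z sz.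
have := near_sides n f fn z (fun=> False) (fun k kz => sz (ex_intro _ k kz)).
by apply: filterS => y h /h[].
Qed.

Lemma odd_region_interior : odd_region° = [set z | parity z /\ ~ sides f z].
Proof.
apply/seteqP; split=> z.
  move=> Pz; have sz : ~ sides f z.
    move=> /parity_near_side/(_ Pz)[_ [y [+ nsy npy]]].
    by case=> // py; rewrite py in npy.
  by split=> //; have /nbhs_singleton[] := Pz.
move=> [pz sz]; apply: filterS (near_parity z sz) => y e.
by left; rewrite e.
Qed.

Lemma odd_region_closed : closed odd_region.
Proof.
rewrite -[odd_region]setCK; apply: open_closedC; rewrite openE => z /= h.
have sz : ~ sides f z by move=> sz; apply: h; right.
have nz : nbhs z (~` sides f).
  by apply: open_nbhs_nbhs; split=> //; exact/closed_openC/sides_closed.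
apply: filterS (filterI nz (near_parity z sz)) => y [sy e] [|//].
by rewrite e => pz; apply: h; left.
Qed.

Lemma odd_region_half_plane g (M N : R) d : affine g ->
  (forall k, g (f k) <= M) -> (forall k, absc m (f k) < N) ->
  (forall k, - N < absc m (f k)) ->
  M < g d -> N <= absc m d \/ absc m d <= - N ->
  forall z, M < g z -> ~ odd_region z.
Proof.
move=> ag gM fN1 fN2 gd dN z gz.
have sg y : sides f y -> g y <= M.
  move=> [k /segmentP[t t01 ->]]; rewrite (affine_lerp ag).
  have := gM k; have := gM k.+1; nra.
have nsz y : M < g y -> ~ sides f y by move=> gy /sg; rewrite leNgt gy.
case=> [pz|]; last exact: nsz.
have ag' : affine (fun y => g y + - M).
  by apply: affineD => //; exists 0, 0, (- M) => y; ring.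
suff pd : parity d.
  move: pd; rewrite /parity big1// => k _; rewrite /crosses.
  case: dN => dN.
    by rewrite !(lt_le_trans (fN1 _) dN).
  by rewrite !ltNge !(ltW (le_lt_trans dN (fN2 _))).
apply: (cvx_const _ (fun y => parity y : Prop) (cvx_pos _ ag') _ z d) => //=;
  rewrite ?subr_gt0// => y; rewrite subr_gt0 => gy.
by apply: filterS (near_parity y (nsz y gy)) => z' ->.
Qed.

Lemma odd_region_compact : compact odd_region.
Proof.
have [M hM] := seq_ub ([seq `|(f k).1| | k <- iota 0 n] ++ [seq `|(f k).2| | k <- iota 0 n]).
have [N0 hN] := seq_ub [seq `|absc m (f k)| | k <- iota 0 n].
have n0 : (0 < n)%N by have [n2 _ _ _] := fn; exact: leq_trans n2.
have M1 k : `|(f k).1| < M.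
  rewrite -(cyc_mod n f fn k); apply: hM; rewrite mem_cat; apply/orP; left.
  by apply/mapP; exists (k %% n)%N => //; rewrite mem_iota ltn_mod.
have M2 k : `|(f k).2| < M.
  rewrite -(cyc_mod n f fn k); apply: hM; rewrite mem_cat; apply/orP; right.
  by apply/mapP; exists (k %% n)%N => //; rewrite mem_iota ltn_mod.
have N1 k : `|absc m (f k)| < N0.
  rewrite -(cyc_mod n f fn k); apply: hN.
  by apply/mapP; exists (k %% n)%N => //; rewrite mem_iota ltn_mod.
pose N := Num.max (M + 1) N0.
have MN : M < N by rewrite lt_max ltrDl ltr01.
have {}N1 k : - N < absc m (f k) < N.
  by rewrite -ltr_norml lt_max N1 orbT.
have f1 k := let: conj a b := andP (N1 k) in a.
have f2 k := let: conj a b := andP (N1 k) in b.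
have box z : odd_region z -> - M <= z.1 <= M /\ - M <= z.2 <= M.
  move=> Pz; have M1' k : - M < (f k).1 < M by rewrite -ltr_norml.
  have M2' k : - M < (f k).2 < M by rewrite -ltr_norml.
  have half g d : affine g -> (forall k, g (f k) <= M) ->
      M < g d -> N <= absc m d \/ absc m d <= - N -> g z <= M.
    move=> ag gM gd dN; rewrite leNgt; apply/negP => gz.
    exact: (odd_region_half_plane g M N d ag gM f2 f1 gd dN z gz).
  split; apply/andP; split.
  - rewrite lerNl; apply: (half (fun z => - z.1) (- N, 0)) => /=; rewrite ?opprK//.
    + by exists (- 1), 0, 0 => y; ring.
    + by move=> k; have := M1' k; lra.
    + by right; rewrite /absc/= mulr0 addr0.
  - apply: (half (fun z => z.1) (N, 0)) => //=.
    + by exists 1, 0, 0 => y; ring.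
    + by move=> k; have := M1' k; lra.
    + by left; rewrite /absc/= mulr0 addr0.
  - rewrite lerNl; apply: (half (fun z => - z.2) (N + m * (M + 1), - (M + 1))) => /=.
    + by exists 0, (- 1), 0 => y; ring.
    + by move=> k; have := M2' k; lra.
    + by lra.
    + by left; rewrite /absc/=; lra.
  - apply: (half (fun z => z.2) (N - m * (M + 1), M + 1)) => /=.
    + by exists 0, 1, 0 => y; ring.
    + by move=> k; have := M2' k; lra.
    + by lra.
    + by left; rewrite /absc/=; lra.
have cc := compact_setX (@segment_compact R (- M) M) (@segment_compact R (- M) M).
have ss := subclosed_compact odd_region_closed cc.
apply: ss.
by move=> z /box[b1 b2]; split; rewrite /= in_itv.
Qed.

Lemma odd_regionP : bounded_by f odd_region.
Proof.
split; first exact: odd_region_compact.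
  rewrite /regclosed odd_region_interior; apply/seteqP; split.
    rewrite [X in _ `<=` X](closure_id odd_region).1; last exact: odd_region_closed.
    by apply: closure_subset => z [? _]; left.
  move=> z [pz|sz] U Uz; last first.
    by have [[y [Uy nsy py]] _] := parity_near_side _ _ sz Uz; exists y.
  have [sz|sz] := pselect (sides f z).
    by have [[y [Uy nsy py]] _] := parity_near_side _ _ sz Uz; exists y.
  by exists z; split=> //; exact: nbhs_singleton.
rewrite odd_region_interior -(closure_id odd_region).1; last exact: odd_region_closed.
apply/seteqP; split=> z.
  by move=> [[pz|//] h]; apply: contrapT => sz; exact: h.
by move=> sz; split; [right | move=> []].
Qed.

End Path.

(** The direction of the vertical lines is chosen so that none of them contains
    two vertices. *)
Theorem cyclic_path_bounds n (f : nat -> R * R) : cyclic_path n f ->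
  exists P, bounded_by f P.
Proof.
move=> fn; have n0 : (0 < n)%N by have [n2 _ _ _] := fn; exact: leq_trans n2.
have [m hm] := seq_ub [seq - ((f i).1 - (f j).1) / ((f i).2 - (f j).2)
  | i <- iota 0 n, j <- iota 0 n].
exists (odd_region n f m); apply: odd_regionP => // i j ij.
apply/negP => /eqP; rewrite /absc => e; apply: ij.
have [e2|e2] := eqVneq ((f i).2 - (f j).2) 0.
  apply: pt_ext; last by apply/eqP; rewrite -subr_eq0 e2.
  by move: e; rewrite (subr0_eq e2) => /addIr.
have /hm : - ((f i).1 - (f j).1) / ((f i).2 - (f j).2) \in
    [seq - ((f i).1 - (f j).1) / ((f i).2 - (f j).2) | i <- iota 0 n, j <- iota 0 n].
  apply/allpairsP; exists (i %% n, j %% n)%N; rewrite /= !mem_iota !ltn_mod n0.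
  by rewrite !(cyc_mod n f fn).
suff -> : - ((f i).1 - (f j).1) / ((f i).2 - (f j).2) = m by rewrite ltxx.
by rewrite -[RHS](mulfK e2); congr (_ / _); rewrite -[LHS]addr0 -(subrr (m * (f i).2)); lra.
Qed.

End JordanRegion.

(** * Independence of the choice of the boundary path *)

Section Bridge.
Context {R : realType}.
Implicit Types (a b c d u v w x y z : (R * R)%type) (s t e : R)
  (C U P Q A : set (R * R)) (f g : nat -> R * R).

Section Periodic.
Variables (n : nat) (f : nat -> R * R).
Hypotheses (n0 : (0 < n)%N) (fn : forall k, f (k %% n)%N = f k).

Lemma periodic_eq i j : i = j %[mod n] -> f i = f j.
Proof. by move=> e; rewrite -fn e fn. Qed.

Lemma periodic_ordS (i : 'I_n) : f (ordS i) = f i.+1.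
Proof. by rewrite /= fn. Qed.

Lemma periodic_ord_pred (i : 'I_n) : f (ord_pred i) = f (i + n.-1)%N.
Proof. by rewrite /= fn; congr f; lia. Qed.

Lemma periodic_addn k : f (k + n)%N = f k.
Proof. by apply: periodic_eq; rewrite modnDr. Qed.

Lemma periodic_predS k : f (k + n.-1).+1 = f k.
Proof. by rewrite -addnS prednK// periodic_addn. Qed.

Lemma periodic_predSS k : f (k + n.-1).+2 = f k.+1.
Proof. by rewrite -addSn -addnS prednK// periodic_addn. Qed.

Lemma simple_polygonP P :
  simple_polygon (fun i : 'I_n => f i) P <-> polygon n f P.
Proof.
have mk k : (k %% n < n)%N by rewrite ltn_mod.
have modS k : f (k %% n).+1 = f k.+1.
  by apply: periodic_eq; rewrite -addn1 modnDml addn1.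
have sidesE : (\bigcup_(i in [set: 'I_n]) segment (f i) (f (ordS i))) = sides f.
  apply/seteqP; split=> z.
    by move=> [i _]; rewrite periodic_ordS => h; exists i.
  move=> [k h]; exists (Ordinal (mk k)) => //.
  by rewrite periodic_ordS /= fn modS.
split=> [[n2 inj tn nc [c r b]]|[[n2 inj tn nc] [c r b]]].
  split; last by split=> //; rewrite b sidesE.
  split=> //.
  - move=> i j; split; last exact: periodic_eq.
    rewrite -(fn i) -(fn j) => /(inj (Ordinal (mk i)) (Ordinal (mk j))).
    by move=> /(congr1 val).
  - move=> k; have := tn (Ordinal (mk k.+1)).
    rewrite periodic_ord_pred periodic_ordS /= !fn modS.
    suff -> : f (k.+1 %% n + n.-1)%N = f k by [].
    apply: periodic_eq; rewrite modnDml.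
    rewrite (_ : (k.+1 + n.-1)%N = (k + n)%N); last by lia.
    exact: modnDr.
  - move=> i j ij; have := nc (Ordinal (mk i)) (Ordinal (mk j)).
    rewrite !periodic_ordS /= !fn !modS; apply.
    by apply/eqP => /(congr1 val)/= e; apply: ij; exact: periodic_eq.
split=> //.
- move=> i j /inj; rewrite !modn_small// => e; exact: val_inj.
- move=> i; rewrite periodic_ord_pred periodic_ordS.
  by have := tn (i + n.-1)%N; rewrite periodic_predS periodic_predSS.
- move=> i j ij; rewrite !periodic_ordS; apply: nc => /inj.
  by rewrite !modn_small// => e; case/eqP: ij; exact: val_inj.
- by split=> //; rewrite b sidesE.
Qed.

Lemma convex_vertexP P (i : 'I_n) :
  convex_vertex (fun i : 'I_n => f i) P i <-> convex_at f P (i + n.-1)%N.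
Proof.
rewrite /convex_vertex /convex_at /corner periodic_ord_pred periodic_ordS.
rewrite periodic_predS periodic_predSS.
by split=> -[e e0 h]; exists e.
Qed.

End Periodic.

Lemma periodic_extension n (s : 'I_n -> R * R) : (0 < n)%N ->
  exists2 f, (forall k, f (k %% n)%N = f k) & s = (fun i => f i).
Proof.
move=> n0; have mk k : (k %% n < n)%N by rewrite ltn_mod.
exists (fun k => s (Ordinal (mk k))).
  by move=> k; congr s; apply: val_inj; rewrite /= modn_mod.
by apply/funext => i; congr s; apply: val_inj; rewrite /= modn_small.
Qed.

Lemma polygon_mod n f P : polygon n f P -> forall k, f (k %% n)%N = f k.
Proof. by move=> [fn _]; exact: (cyc_mod n f fn). Qed.

Lemma polygon_gt0 n f P : polygon n f P -> (0 < n)%N.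
Proof. by move=> [[n2 _ _ _] _]; exact: leq_trans n2. Qed.

Lemma simple_polygon_path n (s : 'I_n -> R * R) P : simple_polygon s P ->
  exists2 f, polygon n f P & s = (fun i => f i).
Proof.
move=> sP; have n0 : (0 < n)%N by case: sP => n2 *; exact: leq_trans n2.
have [f fn e] := periodic_extension n s n0; exists f => //.
by apply/(simple_polygonP n f n0 fn); rewrite -e.
Qed.

Lemma polygon_simple n f P : polygon n f P ->
  simple_polygon (fun i : 'I_n => f i) P.
Proof.
move=> h; apply/simple_polygonP => //; first exact: polygon_gt0 h.
exact: polygon_mod h.
Qed.

Lemma verticesP P x : vertices P x <->
  exists n f, polygon n f P /\ exists k, f k = x.
Proof.
split=> [[n [s [/simple_polygon_path[f fP ->] [i _ <-]]]]|[n [f [fP [k <-]]]]].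
  by exists n, f; split=> //; exists i.
exists n, (fun i : 'I_n => f i); split; first exact: polygon_simple.
have kn : (k %% n < n)%N by rewrite ltn_mod; exact: polygon_gt0 fP.
by exists (Ordinal kn) => //=; rewrite (polygon_mod n f P fP).
Qed.

Lemma sideP P x y : side P x y <->
  exists n f, polygon n f P /\ exists k, [set x; y] = [set f k; f k.+1].
Proof.
split=> [[n [s [/simple_polygon_path[f fP ->] [i]]]]|[n [f [fP [k e]]]]].
  have fm := polygon_mod n f P fP; rewrite (periodic_ordS n f fm) => e.
  by exists n, f; split=> //; exists i.
exists n, (fun i : 'I_n => f i); split; first exact: polygon_simple.
have kn : (k %% n < n)%N by rewrite ltn_mod; exact: polygon_gt0 fP.
exists (Ordinal kn); rewrite e; have fm := polygon_mod n f P fP.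
rewrite (periodic_ordS n f fm) /= fm.
by rewrite (periodic_eq n f fm (k %% n).+1 k.+1)// -addn1 modnDml addn1.
Qed.

Lemma pseudo_triangleP P : pseudo_triangle P <->
  exists n f, polygon n f P /\
    [set i : 'I_n | convex_at f P (i + n.-1)%N] #= `I_3.
Proof.
have cE n f : polygon n f P ->
    [set i : 'I_n | convex_vertex (fun i : 'I_n => f i) P i] =
    [set i : 'I_n | convex_at f P (i + n.-1)%N].
  move=> fP; apply/seteqP; split=> i /=.
    exact: (convex_vertexP n f (polygon_gt0 _ _ _ fP) (polygon_mod _ _ _ fP) P i).1.
  exact: (convex_vertexP n f (polygon_gt0 _ _ _ fP) (polygon_mod _ _ _ fP) P i).2.
split=> [[n [s [sP c3]]]|[n [f [fP c3]]]].
  have [f fP e] := simple_polygon_path n s P sP; exists n, f; split=> //.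
  by rewrite -cE// -e.
exists n, (fun i : 'I_n => f i); split; first exact: polygon_simple.
by rewrite cE.
Qed.

Lemma collinear_trans a b x y z : a <> b ->
  orient a b x = 0 -> orient a b y = 0 -> orient a b z = 0 -> orient x y z = 0.
Proof.
move=> ab ox oy oz.
have [_ [c [_ _ _]]] := orient_perturb a b a setT ab filterT.
rewrite orient_aba => oc; have := orient_bary x y z a b c.
rewrite ox oy oz !mulr0 !addr0 => /eqP; rewrite mulf_eq0 => /orP[/eqP//|/eqP h].
by move: oc; rewrite h ltxx.
Qed.

(** The frontier turns at a vertex, and is straight elsewhere. *)
Lemma vertex_unique n f m g P : polygon n f P -> polygon m g P ->
  forall j, exists k, f k = g j.
Proof.
move=> [fn Pf] [gm Pg].
have e : sides f = sides g.
  by have [_ _ <-] := Pf; have [_ _ <-] := Pg.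
suff succ j : exists k, f k = g j.+1.
  move=> j; have [k h] := succ (j + m.-1)%N; exists k; rewrite h.
  have gP : polygon m g P by [].
  exact: periodic_predS m g (polygon_gt0 _ _ _ gP) (polygon_mod _ _ _ gP) j.
apply: contrapT => nk.
have [k /segmentP[t t01 we]] : sides f (g j.+1).
  by rewrite e; exists j; exact: segment_r.
have ne := cyc_neqS n f fn k.
have {}t01 : 0 < t < 1.
  rewrite !lt_neqAle; case/andP: t01 => -> ->; rewrite !andbT.
  apply/andP; split; apply/eqP => te; apply: nk.
    by exists k; rewrite we -te lerp0.
  by exists k.+1; rewrite we te lerp1.
have := near_open_side n f fn k t t01; rewrite -we => near_k.
have [q q0 hq] := near_affine2 _ (g j - g j.+1) (g j.+2 - g j.+1) _ near_k.
have [r [r0 rq r1]] := ex_smaller q 1 q0 ltr01.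
have rq' : `|r| < q by rewrite gtr0_norm.
have z0 : `|0 : R| < q by rewrite normr0.
have ow : orient (f k) (f k.+1) (g j.+1) = 0.
  by rewrite we orient_lerp orient_aba orient_abb; ring.
have h1 : orient (f k) (f k.+1) (g j) = 0.
  have : orient (f k) (f k.+1) (corner g j r 0) = 0.
    apply: segment_orient0; apply: hq => //; rewrite e; exists j.
    by rewrite -/(corner g j r 0) corner_l; apply/segmentP; exists (1 - r) => //; lra.
  rewrite corner_l orient_lerp ow mulr0 addr0 => /eqP; rewrite mulf_eq0.
  by move=> /orP[/eqP h|/eqP//]; lra.
have h2 : orient (f k) (f k.+1) (g j.+2) = 0.
  have : orient (f k) (f k.+1) (corner g j 0 r) = 0.
    apply: segment_orient0; apply: hq => //; rewrite e; exists j.+1.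
    by rewrite -/(corner g j 0 r) corner_r; apply/segmentP; exists r => //; lra.
  rewrite corner_r orient_lerp ow mulr0 add0r => /eqP; rewrite mulf_eq0.
  by move=> /orP[/eqP h|/eqP//]; lra.
have := cyc_turn m g gm j.
by rewrite (collinear_trans _ _ _ _ _ ne h1 ow h2) eqxx.
Qed.

Lemma on_line A a b c : general_position A -> A a -> A b -> A c ->
  a <> b -> orient a b c = 0 -> c = a \/ c = b.
Proof.
move=> gp Aa Ab Ac ab h.
have [|ca] := pselect (c = a); first by left.
have [|cb] := pselect (c = b); first by right.
by have := gp a b c Aa Ab Ac ab (nesym ca) (nesym cb); rewrite h eqxx.
Qed.

Lemma open_segment_off A a b c t : general_position A -> A a -> A b -> A c ->
  a <> b -> 0 < t < 1 -> lerp a b t <> c.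
Proof.
move=> gp Aa Ab Ac ab t01 e.
have : orient a b c = 0.
  by rewrite -e orient_lerp orient_aba orient_abb; ring.
move=> /(on_line _ _ _ _ gp Aa Ab Ac ab) [h|h]; rewrite h in e.
  exact: lerp_neq e.
exact: lerp_neqr e.
Qed.

(** If the segment crosses the side, it enters the polygon. Otherwise both are on
    one line, and general position identifies their ends. *)
Lemma edge_side_or_enters A n f P k a b t : general_position A ->
  (forall k, A (f k)) -> A a -> A b -> a <> b -> polygon n f P ->
  0 < t < 1 -> segment (f k) (f k.+1) (lerp a b t) ->
  [set a; b] = [set f k; f k.+1] \/ exists2 z, segment a b z & P° z.
Proof.
move=> gp Af Aa Ab ab [fn Pf] t01 /segmentP[s s01 e].
have ne := cyc_neqS n f fn k.
have {}s01 : 0 < s < 1.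
  rewrite !lt_neqAle; case/andP: s01 => -> ->; rewrite !andbT.
  apply/andP; split; apply/eqP => se.
    by apply: (open_segment_off A a b (f k) t) => //; rewrite e -se lerp0.
  by apply: (open_segment_off A a b (f k.+1) t) => //; rewrite e se lerp1.
have [oa|oa] := eqVneq (orient (f k) (f k.+1) a) 0; last first.
  by right; apply: (crossing_interior n f fn P Pf k a b s t).
left; have ob : orient (f k) (f k.+1) b = 0.
  have : orient (f k) (f k.+1) (lerp a b t) = 0.
    by rewrite e orient_lerp orient_aba orient_abb; ring.
  rewrite orient_lerp oa mulr0 add0r => /eqP; rewrite mulf_eq0.
  by move=> /orP[/eqP h|/eqP//]; lra.
have [ea|ea] := on_line A _ _ _ gp (Af k) (Af k.+1) Aa ne oa;
have [eb|eb] := on_line A _ _ _ gp (Af k) (Af k.+1) Ab ne ob; rewrite ea eb.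
- by case: ab; rewrite ea eb.
- by [].
- exact: setUC.
- by case: ab; rewrite ea eb.
Qed.

(** The middle of a side of one path is on the frontier, hence on a side of the
    other path; a side never enters the interior. *)
Lemma side_unique A n f m g P : general_position A ->
  (forall k, A (f k)) -> polygon n f P -> polygon m g P ->
  forall j, exists k, [set g j; g j.+1] = [set f k; f k.+1].
Proof.
move=> gp Af fP gP j.
have Ag i : A (g i) by have [k <-] := vertex_unique n f m g P fP gP i.
have [gm Pg] := gP; have [fn Pf] := fP.
have h01 : 0 < (2^-1 : R) < 1 by lra.
have [k kw] : sides f (lerp (g j) (g j.+1) 2^-1).
  have -> : sides f = sides g by have [_ _ <-] := Pf; have [_ _ <-] := Pg.
  by exists j; apply/segmentP; exists 2^-1 => //; lra.
exists k; have [//|[z jz iz]] := edge_side_or_enters A n f P k _ _ _ gp Af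
  (Ag j) (Ag j.+1) (cyc_neqS m g gm j) fP h01 kw.
have [] := side_region g P Pg z; last by [].
by exists j.
Qed.

Lemma side_vertices A n f P x y : general_position A ->
  (forall k, A (f k)) -> polygon n f P -> side P x y ->
  exists k, [set x; y] = [set f k; f k.+1].
Proof.
move=> gp Af fP /sideP[m [g [gP [j ->]]]].
exact: (side_unique A n f m g P).
Qed.

Definition disjoint_interiors (T : set (set (R * R))) :=
  trivIset T (fun P => P°).

Lemma interior_meet (T : set (set (R * R))) P Q z : disjoint_interiors T ->
  T P -> T Q -> P° z -> Q° z -> P = Q.
Proof. by move=> tI TP TQ Pz Qz; apply: tI => //; exists z. Qed.

(** Near a side of Q there are interior points of Q. *)
Lemma side_off_interior (T : set (set (R * R))) P Q n f z :
  disjoint_interiors T -> T P -> T Q -> polygon n f Q -> sides f z -> ~ P° z.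
Proof.
move=> tI TP TQ [fn Qf] sz Pz.
have [Qz nQz] := side_region f Q Qf z sz.
have [y Py Qy] := region_interior f Q Qf z _ Qz (nbhs_interior Pz).
have e : P = Q by apply: (interior_meet T P Q y) => //; exact: nbhs_singleton.
by apply: nQz; rewrite -e.
Qed.

(** Each line is left by a small displacement, which does not come back to the
    previous ones. *)
Lemma generic_point (L : seq ((R * R) * (R * R))) U z :
  (forall l, l \in L -> l.1 <> l.2) -> nbhs z U ->
  exists2 y, nbhs y U & forall l, l \in L -> orient l.1 l.2 y != 0.
Proof.
elim: L U z => [|l L IHL] U z hL zU; first by exists z.
have [y yU hy] := IHL U z (fun l' h => hL l' (@mem_behead _ (l :: L) _ h)) zU.
have [ol|ol] := eqVneq (orient l.1 l.2 y) 0; last first.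
  by exists y => // l'; rewrite inE => /predU1P[->//|]; exact: hy.
have nL : \forall z' \near y, forall l', l' \in L -> orient l'.1 l'.2 z' != 0.
  elim: L {IHL hL} hy => [|k L IHL] hy; first by near=> z'.
  have {IHL}h1 := IHL (fun l' h => hy l' (@mem_behead _ (k :: L) _ h)).
  have h2 : \forall z' \near y, orient k.1 k.2 z' != 0.
    have := hy k (mem_head _ _); rewrite neq_lt => /orP[h|h].
      by apply: filterS (near_neg _ _ (continuous_orient _ _) h) => z'; rewrite lt_neqAle => /andP[].
    by apply: filterS (near_pos _ _ (continuous_orient _ _) h) => z' /lt0r_neq0.
  apply: filterS (filterI h1 h2) => z' [h3 h4] l'.
  by rewrite inE => /predU1P[->//|]; exact: h3.
have [_ [z' [_ [U' L'] _]]] := orient_perturb l.1 l.2 y _ (hL l (mem_head _ _))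
  (filterI (nbhs_interior yU) nL).
rewrite ol => oz'; exists z' => // l'; rewrite inE => /predU1P[->|/L' //].
exact: lt0r_neq0.
Unshelve. all: by end_near. Qed.

End Bridge.

(** * The points of a single chain *)

Section Hull.
Context {R : realType}.
Implicit Types (a b c d x y z : (R * R)%type) (A C : set (R * R)) (t : R).

Lemma convex_setP C : @convex_set R (R * R)%type C <-> cvx C.
Proof.
split=> h.
  move=> x y t Cx Cy /andP[t0 t1].
  have k0 : 0 <= 1 - t by lra.
  have k1 : 1 - t <= 1 by lra.
  have := h x y (Itv01 k0 k1); rewrite !inE => /(_ Cx Cy).
  by rewrite /conv /= /lerp /unstable.onem subKr.
move=> x y k; rewrite !inE => Cx Cy.
have := h y x k%:num Cy Cx; rewrite ge0 le1 => /(_ isT).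
by rewrite /conv /= /lerp /unstable.onem addrC.
Qed.

Lemma hull_cvx A : cvx (hull A).
Proof.
by move=> x y t hx hy t01 D [cD AD]; apply: (convex_setP D).1 => //;
  [exact: hx | exact: hy].
Qed.

Lemma hull_sub A z : A z -> hull A z.
Proof. by move=> Az D [_]; apply. Qed.

Lemma hull_min A C z : cvx C -> A `<=` C -> hull A z -> C z.
Proof. by move=> cC AC; apply; split=> //; exact/convex_setP. Qed.

Lemma cvx3 C a b c (k l m : R) : cvx C -> C a -> C b -> C c ->
  0 <= k -> 0 <= l -> 0 <= m -> k + l + m = 1 ->
  C (k *: a + l *: b + m *: c).
Proof.
move=> cC Ca Cb Cc k0 l0 m0 s1.
have [e|ne] := eqVneq (k + l) 0.
  have -> : k = 0 by lra.
  have -> : l = 0 by lra.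
  have -> : m = 1 by lra.
  by rewrite !scale0r !add0r scale1r.
have kl : 0 < k + l by rewrite lt_neqAle eq_sym ne addr_ge0.
have -> : k *: a + l *: b + m *: c = lerp (lerp a b (l / (k + l))) c m.
  rewrite /lerp scalerDr !scalerA; congr (_ *: _ + _ *: _ + _).
    by rewrite (_ : 1 - m = k + l); [field | lra].
  by rewrite (_ : 1 - m = k + l); [field | lra].
apply: (cC) => //; last lra.
apply: (cC) => //; apply/andP; split; first by apply: divr_ge0 => //; exact: ltW.
by rewrite ler_pdivrMr// mul1r lerDr.
Qed.

Lemma in_triangle C a b c z : cvx C -> C a -> C b -> C c ->
  0 < orient a b c -> 0 <= orient a b z -> 0 <= orient b c z ->
  0 <= orient c a z -> C z.
Proof.
move=> cC Ca Cb Cc o0 oab obc oca; have ne := lt0r_neq0 o0.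
have e1 : orient a b c * z.1 =
    orient b c z * a.1 + orient c a z * b.1 + orient a b z * c.1.
  by clear; coords; ring.
have e2 : orient a b c * z.2 =
    orient b c z * a.2 + orient c a z * b.2 + orient a b z * c.2.
  by clear; coords; ring.
have sum : orient b c z + orient c a z + orient a b z = orient a b c.
  by clear; coords; ring.
have -> : z = (orient b c z / orient a b c) *: a + (orient c a z / orient a b c) *: b
    + (orient a b z / orient a b c) *: c.
  move: (orient a b c) (orient b c z) (orient c a z) (orient a b z) ne e1 e2.
  clear; move=> o k l m ne e1 e2.
  apply: pt_ext; apply: (mulfI ne); rewrite ?e1 ?e2.
    by clear -ne; coords; field.
  by clear -ne; coords; field.
apply: cvx3 => //; try by apply: divr_ge0 => //; exact: ltW.
by rewrite -!mulrDl sum divff.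
Qed.

End Hull.

Section Chain.
Context {R : realType}.
Implicit Types (a b c d x y z p : (R * R)%type) (A C H : set (R * R))
  (q : nat -> R * R) (s t : R).

(** What geometry retains of a single chain: the chain turns clockwise and
    the tip sees it counterclockwise, from q 0 to q n. *)
Definition chain n q p := [/\ (0 < n)%N,
  (forall i j k, (i < j < k)%N -> (k <= n)%N -> orient (q i) (q j) (q k) < 0) &
  (forall i j, (i < j)%N -> (j <= n)%N -> 0 < orient p (q i) (q j))].

Definition chain_set n q p : set (R * R) := p |` (q @` `I_n.+1).

Let chain_body l A q p := let Q := q @` `I_l.+2 in
    [/\ A = p |` Q,
        general_position A,
        (forall i j, (i <= l.+1)%N -> (j <= l.+1)%N -> q i = q j -> i = j),
        convex_cycle l.+1 q
      & [/\ ~ hull Q p,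
            (forall i, (i <= l)%N -> sees (hull Q) p (q i) (q i.+1))
          & (0 < l)%N -> ~ sees (hull Q) p (q 0%N) (q l.+1)]].

Lemma chain_body_rev l A q p : chain_body l A q p ->
  chain_body l A (fun i => q (l.+1 - i)%N) p.
Proof.
have QE : (fun i => q (l.+1 - i)%N) @` `I_l.+2 = q @` `I_l.+2.
  apply/seteqP; split=> z [i /= il <-].
    by exists (l.+1 - i)%N => //=; lia.
  by exists (l.+1 - i)%N => /=; [lia | rewrite subKn].
have seesC K a b : sees K p a b <-> sees K p b a.
  by rewrite /sees segmentC.
rewrite /chain_body QE => -[AE gp inj cc [np s ns]]; split=> //.
- move=> i j il jl /inj; lia.
- move=> i j k i' j' k' ijk kl ijk' kl'.
  rewrite (orient_rev (q (l.+1 - k)%N)) (orient_rev (q (l.+1 - k')%N)).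
  rewrite mulrNN; apply: cc; lia.
- split=> // [i il|l0].
    rewrite seesC; have -> : (l.+1 - i)%N = (l.+1 - i.+1).+1 by lia.
    by apply: s; lia.
  by rewrite subn0 subnn seesC; exact: ns.
Qed.

(** If p is to the left of the rays ab and ad, it is to the left of every
    ray ac in between. *)
Lemma wedge a b c d p : orient a b c < 0 -> orient a b d < 0 ->
  orient a c d < 0 -> 0 < orient a b p -> 0 < orient a d p ->
  0 < orient a c p.
Proof.
move=> bc bd cd bp dp.
have e : orient a c d * orient a b p =
    - orient a d p * orient a b c + orient a c p * orient a b d.
  by clear; coords; ring.
nra.
Qed.

Lemma wedge_opp a b c d p : 0 < orient a b c -> 0 < orient a b d ->
  0 < orient a c d -> orient a b p < 0 -> orient a d p < 0 ->
  orient a c p < 0.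
Proof.
move=> bc bd cd bp dp.
have e : orient a c d * orient a b p =
    - orient a d p * orient a b c + orient a c p * orient a b d.
  by clear; coords; ring.
nra.
Qed.

Lemma sees_side H a b c p : cvx H -> H a -> H b -> H c ->
  orient a b c < 0 -> orient a b p < 0 -> ~ sees H p a b.
Proof.
move=> cH Ha Hb Hc oc op se.
pose x := lerp a b 2^-1.
have sx : segment a b x by apply/segmentP; exists 2^-1 => //; lra.
have h1 : 0 < orient a c x.
  by rewrite /x orient_lerp orient_aba (orient_flip a b c); lra.
have h2 : 0 < orient c b x.
  by rewrite /x orient_lerp orient_abb (orient_rev a b c); lra.
have nx : \forall z \near x, 0 < orient a c z /\ 0 < orient c b z.
  exact: filterI (near_pos _ x (continuous_orient a c) h1)
    (near_pos _ x (continuous_orient c b) h2).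
have := nx; rewrite -[x](lerp0 x p) => /near_lerp[e e0 he].
have [r [r0 re r1]] := ex_smaller e 1 e0 ltr01.
have [|z1 z2] := he r; first by rewrite subr0 gtr0_norm.
have ox : orient a b x = 0 by rewrite (segment_orient0 _ _ x).
have oz : orient a b (lerp x p r) < 0 by rewrite orient_lerp ox; nra.
have Hz : H (lerp x p r).
  apply: (in_triangle H a c b) => //; rewrite ?(ltW z1) ?(ltW z2)//.
    by rewrite (orient_flip a b c); lra.
  by rewrite orient_swap; lra.
have /seteqP[sub _] := se x sx.
have e1 : lerp x p r = x.
  apply: sub; split=> //.
  by rewrite segmentC; apply/segmentP; exists r => //; lra.
by move: oz; rewrite e1 ox ltxx.
Qed.

Lemma chain_of_body l A q p : chain_body l A q p ->
  (forall i j k, (i < j < k)%N -> (k <= l.+1)%N -> orient (q i) (q j) (q k) < 0) ->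
  (l = 0%N -> 0 < orient p (q 0%N) (q 1%N)) -> chain l.+1 q p.
Proof.
move=> [AE gp inj cc [np s ns]] C1 C2.
set Q := q @` `I_l.+2 in AE np s ns.
have HQ i : (i <= l.+1)%N -> hull Q (q i).
  by move=> il; apply: hull_sub; exists i.
have Aq i : (i <= l.+1)%N -> A (q i) by move=> il; rewrite AE; right; exists i.
have Ap : A p by rewrite AE; left.
have pq i : (i <= l.+1)%N -> p <> q i by move=> il e; apply: np; rewrite e; exact: HQ.
have on0 i j : (i < j)%N -> (j <= l.+1)%N -> orient (q i) (q j) p != 0.
  move=> ij jl; have il : (i <= l.+1)%N by exact: leq_trans (ltnW ij) jl.
  apply: (gp _ _ _ (Aq i il) (Aq j jl) Ap); [|exact/nesym/pq|exact/nesym/pq].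
  by move=> e; have := inj i j il jl e; lia.
suff all i j : (i < j)%N -> (j <= l.+1)%N -> 0 < orient (q i) (q j) p.
  by split=> // i j ij jl; rewrite -orient_cyc; exact: all.
have [l0|l0] := posnP l.
  move=> ij jl; have -> : i = 0%N by lia.
  have -> : j = 1%N by lia.
  by rewrite orient_cyc; exact: C2.
have adj k : (k <= l)%N -> 0 < orient (q k) (q k.+1) p.
  move=> kl; rewrite lt_neqAle eq_sym on0//= leNgt; apply/negP => op.
  have /= [m [ml om]] : exists m, (m <= l.+1)%N /\ orient (q k) (q k.+1) (q m) < 0.
    have [k0|k0] := posnP k.
      by exists 2%N; split; [lia | apply: C1; lia].
    by exists 0%N; split=> //; rewrite orient_cyc; apply: C1; lia.
  apply: (sees_side (hull Q) (q k) (q k.+1) (q m) p) => //; last exact: s;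
    by [exact: hull_cvx | apply: HQ; lia].
have base : 0 < orient (q 0%N) (q l.+1) p.
  rewrite lt_neqAle eq_sym on0//= leNgt; apply/negP => op.
  apply: (ns l0) => x xs; apply/seteqP; split=> y; last first.
    move=> ->; split; first exact: segment_r.
    have [t t01 ->] := xs; apply: hull_cvx => //; exact: HQ.
  move=> [/segmentP[t t01 ->] Hy].
  have ox : orient (q 0%N) (q l.+1) x = 0 by exact: segment_orient0.
  have : 0 <= orient (q 0%N) (q l.+1) (lerp p x t).
    apply: (hull_min _ _ _ (cvx_ge0 _ (affine_orient (q 0%N) (q l.+1))) _ Hy).
    move=> _ [r /= rl <-].
    have [->|r0] := posnP r; first by rewrite orient_aba.
    have [->|rl'] := eqVneq r l.+1; first by rewrite orient_abb.
    by rewrite orient_flip oppr_ge0 ltW//; apply: C1; lia.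
  rewrite orient_lerp ox => h.
  have -> : t = 1 by nra.
  by rewrite lerp1.
have from0 r : (0 < r)%N -> (r <= l.+1)%N -> 0 < orient (q 0%N) (q r) p.
  move=> r0 rl; have [->|r1] := eqVneq r 1%N; first exact: adj.
  have [->//|rl'] := eqVneq r l.+1.
  apply: (wedge _ (q 1%N) _ (q l.+1)); rewrite ?base ?(adj 0%N)//; apply: C1; lia.
have to_end r : (r <= l)%N -> 0 < orient (q r) (q l.+1) p.
  move=> rl; have [->//|r0] := posnP r.
  have [->|rl'] := eqVneq r l; first exact: adj.
  rewrite orient_swap oppr_gt0.
  apply: (wedge_opp _ (q l) _ (q 0%N)).
  - by rewrite orient_rev oppr_gt0; apply: C1; lia.
  - by rewrite orient_rev oppr_gt0; apply: C1; lia.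
  - by rewrite orient_rev oppr_gt0; apply: C1; lia.
  - by rewrite orient_swap oppr_lt0; exact: adj.
  - by rewrite orient_swap oppr_lt0.
move=> ij jl; have [->|ij'] := eqVneq j i.+1; first by apply: adj; lia.
have [->|jl'] := eqVneq j l.+1; first by apply: to_end; lia.
apply: (wedge _ (q i.+1) _ (q l.+1)); try by [apply: C1; lia | apply: adj; lia | apply: to_end; lia].
Qed.

Lemma single_chainP l A : single_chain l A ->
  exists q p, [/\ chain l.+1 q p, A = chain_set l.+1 q p & general_position A].
Proof.
move=> [q [p h]]; have {}h : chain_body l A q p by [].
have [AE gp inj cc [np s ns]] := h.
have AE' : A = chain_set l.+1 (fun i => q (l.+1 - i)%N) p.
  by have [-> _ _ _ _] := chain_body_rev l A q p h.
have Aq i : (i <= l.+1)%N -> A (q i) by move=> il; rewrite AE; right; exists i.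
have [l0|l0] := posnP l.
  subst l; have C1 q' i j k : (i < j < k)%N -> (k <= 1)%N -> orient (q' i) (q' j) (q' k) < 0.
    by move=> ijk kl; exfalso; lia.
  have [op|op] := leP (orient p (q 0%N) (q 1%N)) 0; last first.
    exists q, p; split=> //; apply: (chain_of_body 0 A) => //; exact: C1.
  exists (fun i => q (1 - i)%N), p; split=> //.
  apply: (chain_of_body 0 A); [exact: chain_body_rev | exact: C1 | move=> _].
  rewrite subn0 subnn lt_neqAle eq_sym; apply/andP; split; last first.
    by rewrite orient_flip oppr_ge0.
  have pq i : (i <= 1)%N -> p <> q i.
    by move=> il e; apply: np; rewrite e; apply: hull_sub; exists i.
  have Ap : A p by rewrite AE; left.
  apply: (gp _ _ _ Ap (Aq 1%N isT) (Aq 0%N isT)); [exact: pq|exact: pq|].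
  by move=> e; have := inj 1%N 0%N isT isT e.
have [h012|h012|h012] := ltgtP (orient (q 0%N) (q 1%N) (q 2%N)) 0; last first.
- have := cc 0%N 1%N 2%N 0%N 1%N 2%N isT; rewrite h012 mulr0 ltxx => H.
  by have := H l0 isT l0.
- exists (fun i => q (l.+1 - i)%N), p; split=> //.
  apply: (chain_of_body l A) => [|i j k ijk kl|e]; last by lia.
    exact: chain_body_rev.
  rewrite orient_rev oppr_lt0.
  have := cc (l.+1 - k)%N (l.+1 - j)%N (l.+1 - i)%N 0%N 1%N 2%N.
  by rewrite pmulr_lgt0//; apply; lia.
- exists q, p; split=> //.
  apply: (chain_of_body l A) => // [i j k ijk kl|e]; last by lia.
  have := cc i j k 0%N 1%N 2%N.
  by rewrite nmulr_lgt0//; apply; lia.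
Qed.

End Chain.

(** * Edge sets of pointed pseudo-triangulations of a chain *)

Section Edges.
Variables (n : nat) (D : nat -> nat -> bool) (S : nat -> bool).
Implicit Types u v i j k g h a b x y : nat.

(** D is the set of edges inside the convex polygon, written from left to
    right, and S the set of interior points joined to the tip.  The last
    condition describes the face above an edge: a triangle, or a face that
    reaches the tip through the gap between a and a + 1. *)
Record edge_set : Prop := EdgeSet {
  edge_lt : forall u v, D u v -> (u < v <= n)%N;
  tip_lt : forall j, S j -> (0 < j < n)%N;
  edge_nocross : forall u v u' v', D u v -> D u' v' -> ~ [&& u < u', u' < v & v < v']%N;
  edge_pointed : forall i j k, S j -> D i j -> D j k -> False;
  edge_base : D 0 n;
  edge_above : forall u v, D u v ->
    (exists i, D u i /\ D i v) \/
    (exists a, [/\ (u <= a < v)%N, a = u \/ D u a /\ S a &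
                   a.+1 = v \/ D a.+1 v /\ S a.+1]) }.

(** The edge uv is the lowest edge that the tip sees through the gap
    between g and g + 1. *)
Definition gap_edge g u v := [/\ D u v, (u <= g < v)%N,
  g = u \/ D u g /\ S g & g.+1 = v \/ D g.+1 v /\ S g.+1].

(** A face is a triangle, or it has the tip as a corner. In the second case
    its other corners are x and y, and a and b are the neighbours of the
    tip; if x < a, then a is a reflex vertex between the tip and x. *)
Inductive cell := Tri of nat & nat & nat | Fan of nat & nat & nat & nat.

Definition fan_left x a g := if g == a then x else g.
Definition fan_right b y g := if g.+1 == b then y else g.+1.

Definition is_face c := match c with
  | Tri i j k => [/\ D i j, D j k & D i k]
  | Fan x a b y => [/\ (a < b)%N, (a == 0%N) || S a, (b == n) || S b,
      (x = a \/ D x a) /\ (y = b \/ D b y) &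
      forall g, (a <= g < b)%N -> D (fan_left x a g) (fan_right b y g)]
  end.

Definition lower_side c u v := match c with
  | Tri i j k => u = i /\ v = k
  | Fan x a b y => exists2 g, (a <= g < b)%N &
      u = fan_left x a g /\ v = fan_right b y g
  end.

Hypothesis E : edge_set.
Let edge_lt' := edge_lt E.
Let tip_lt' := tip_lt E.
Let nocross := edge_nocross E.
Let pointed := edge_pointed E.

Lemma gap_edge_min g u v u' v' : gap_edge g u v -> D u' v' ->
  (u' <= g < v')%N -> (u' <= u)%N /\ (v <= v')%N.
Proof.
move=> [Duv guv gl gr] D' g'.
have c1 := nocross _ _ _ _ D' Duv; have c2 := nocross _ _ _ _ Duv D'.
have [u'u|uu'] := leqP u' u; have [vv'|v'v] := leqP v v'; first by [].
-   have e : u' = u by lia.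
  case: gr => [?|[Dv Sv]]; first lia.
  have c3 := nocross _ _ _ _ D' Dv.
  have [e2|?] := eqVneq v' g.+1; last lia.
  by rewrite e2 in D'; case: (pointed _ _ _ Sv D' Dv).
- case: gl => [?|[Du Su]]; first lia.
  have c3 := nocross _ _ _ _ Du D'.
  have [e2|?] := eqVneq u' g; last lia.
  by rewrite e2 in D'; case: (pointed _ _ _ Su Du D').
- case: gl => [?|[Du Su]]; first lia.
  have c3 := nocross _ _ _ _ Du D'.
  have [e2|?] := eqVneq u' g; last lia.
  by rewrite e2 in D'; case: (pointed _ _ _ Su Du D').
Qed.

Lemma gap_edge_unique g u v u' v' : gap_edge g u v -> gap_edge g u' v' ->
  u = u' /\ v = v'.
Proof.
move=> h h'; have [D1 g1 _ _] := h; have [D2 g2 _ _] := h'.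
have := gap_edge_min _ _ _ _ _ h D2 g2; have := gap_edge_min _ _ _ _ _ h' D1 g1.
lia.
Qed.

Lemma gap_edge_ex_above u v g : D u v -> (u <= g < v)%N ->
  exists u' v', gap_edge g u' v'.
Proof.
have [m] := ubnP (v - u)%N; elim: m u v => // m IHm u v vum Duv guv.
have [[i [Dui Div]]|[a [ua al ar]]] := edge_above E u v Duv.
  have := edge_lt' _ _ Dui; have := edge_lt' _ _ Div => l1 l2.
  have [gi|ig] := ltnP g i; first by apply: (IHm u i) => //; lia.
  by apply: (IHm i v) => //; lia.
have [ga|ag|ea] := ltngtP g a.
- case: al => [?|[Dua _]]; first lia.
  by apply: (IHm u a) => //; lia.
- case: ar => [?|[Dav _]]; first lia.
  by apply: (IHm a.+1 v) => //; lia.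
- by exists u, v; subst a; split.
Qed.

Lemma gap_edge_ex g : (g < n)%N -> exists u v, gap_edge g u v.
Proof. by move=> gn; apply: (gap_edge_ex_above 0 n) => //; exact: edge_base. Qed.

Lemma fan_gap_edge x a b y g : is_face (Fan x a b y) -> (a <= g < b)%N ->
  gap_edge g (fan_left x a g) (fan_right b y g).
Proof.
move=> [ab Sa Sb [xa yb] lo] gab; have Dg := lo g gab; split=> //.
- rewrite /fan_left /fan_right; case: eqP => ga; case: eqP => gb;
    case: xa => [?|/edge_lt' ?]; case: yb => [?|/edge_lt' ?]; lia.
- rewrite /fan_left; case: eqP => [ga|]; last by left.
  rewrite ga; case: xa => [->|Dx]; [by left|right; split=> //].
  by move: Sa; have /andP[? _] := edge_lt' _ _ Dx; rewrite (gtn_eqF (n := a))//; lia.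
- rewrite /fan_right; case: eqP => [gb|]; last by left.
  rewrite gb; case: yb => [->|Dy]; [by left|right; split=> //].
  by move: Sb; have ? := edge_lt' _ _ Dy; rewrite (ltn_eqF (m := b))//; lia.
Qed.

(** Two consecutive lower sides of the fan meet at j, so that j would not be
    pointed if it were a neighbour of the tip. *)
Lemma fan_mid x a b y j : is_face (Fan x a b y) -> (a < j < b)%N ->
  ~~ S j /\ exists i k, D i j /\ D j k.
Proof.
move=> F jab; have [_ _ _ _ lo] := F.
have D1 := lo j.-1 ltac:(lia); have D2 := lo j ltac:(lia).
have e1 : fan_right b y j.-1 = j by rewrite /fan_right; case: eqP; lia.
have e2 : fan_left x a j = j by rewrite /fan_left; case: eqP; lia.
rewrite e1 in D1; rewrite e2 in D2; split; last by eexists; eexists; split; eassumption.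
by apply/negP => Sj; exact: (pointed _ _ _ Sj D1 D2).
Qed.

Lemma fan_ex g : (g < n)%N ->
  exists x a b y, is_face (Fan x a b y) /\ (a <= g < b)%N.
Proof.
move=> gn.
have exa : exists a, (a <= g)%N && ((a == 0%N) || S a) by exists 0%N.
have exb : exists b, (g < b)%N && ((b == n) || S b) by exists n; rewrite gn eqxx.
have uba a : (a <= g)%N && ((a == 0%N) || S a) -> (a <= g)%N by case/andP.
case: (ex_maxnP exa uba) => a /andP[ag Sa] amax.
case: (ex_minnP exb) => b /andP[gb Sb] bmin.
have bn : (b <= n)%N by apply: bmin; rewrite gn eqxx.
have nS j : (a < j < b)%N -> ~~ S j.
  move=> jab; apply/negP => Sj; have [jg|gj] := leqP j g.
    by have := amax j; rewrite jg Sj orbT => /(_ isT); lia.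
  by have := bmin j; rewrite gj Sj orbT => /(_ isT); lia.
have [x [v [D1 g1 l1 r1]]] := gap_edge_ex a (leq_ltn_trans ag gn).
have [u [y [D2 g2 l2 r2]]] := gap_edge_ex b.-1 ltac:(lia).
exists x, a, b, y; split; last by rewrite ag.
split=> //; first lia.
  split; first by case: l1 => [->|[? _]]; [left|right].
  by move: r2; rewrite prednK; [case=> [->|[? _]]; [left|right] | lia].
move=> h hab; have [uh [vh Gh]] := gap_edge_ex h ltac:(clear -bn hab; lia).
have [Dh gh lh rh] := Gh.
suff [<- <-] : uh = fan_left x a h /\ vh = fan_right b y h by [].
rewrite /fan_left /fan_right; split.
  case: eqP => ha; first by subst h; have [-> _] := gap_edge_unique _ _ _ x v Gh ltac:(by split).
  case: lh => [->//|[_ Sh]].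
  by have := nS h ltac:(clear -ha hab; lia); rewrite Sh.
case: eqP => hb.
  have e : h = b.-1 by clear -hb hab; lia.
  by subst h; have [_ ->] := gap_edge_unique _ _ _ u y Gh ltac:(by split).
case: rh => [->//|[_ Sh]].
by have := nS h.+1 ltac:(clear -hb hab; lia); rewrite Sh.
Qed.

(** If the tip sees the edge through a gap, the face is the fan over this gap. *)
Lemma face_above u v : D u v -> exists c, is_face c /\ lower_side c u v.
Proof.
move=> Duv; have [[i [Dui Div]]|[g [ug gl gr]]] := edge_above E u v Duv.
  by exists (Tri u i v).
have /edge_lt' uvn := Duv.
have [x [a [b [y [F gab]]]]] := fan_ex g ltac:(lia).
exists (Fan x a b y); split=> //; exists g => //.
by apply: (gap_edge_unique g); [split | exact: fan_gap_edge].
Qed.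

Lemma face_unique u v c c' : is_face c -> is_face c' ->
  lower_side c u v -> lower_side c' u v -> c = c'.
Proof.
have tri_fan i j k x a b y : is_face (Tri i j k) -> is_face (Fan x a b y) ->
    lower_side (Fan x a b y) i k -> False.
  move=> [D1 D2 D3] F [g gab [ei ek]].
  have G := fan_gap_edge _ _ _ _ _ F gab; rewrite -ei -ek in G.
  have [_ gik _ _] := G.
  have := edge_lt' _ _ D1; have := edge_lt' _ _ D2 => l1 l2.
  have [gj|jg] := ltnP g j.
    by have := gap_edge_min _ _ _ _ _ G D1; lia.
  by have := gap_edge_min _ _ _ _ _ G D2; lia.
case: c c' => [i j k|x a b y] [i' j' k'|x' a' b' y'] F F' //.
- move=> [-> ->] [ei ek]; subst i' k'.
  have [D1 D2 _] := F; have [D1' D2' _] := F'.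
  have l1 := edge_lt' _ _ D1; have l2 := edge_lt' _ _ D2.
  have l1' := edge_lt' _ _ D1'; have l2' := edge_lt' _ _ D2'.
  have := nocross _ _ _ _ D1 D2'; have := nocross _ _ _ _ D1' D2 => c1 c2.
  suff -> : j = j' by []. lia.
- by move=> [-> ->] /(tri_fan _ _ _ _ _ _ _ F F').
- by move=> h [ei ek]; subst; case: (tri_fan _ _ _ _ _ _ _ F' F h).
move=> [g gab [eu ev]] [g' gab' [eu' ev']].
have G := fan_gap_edge _ _ _ _ _ F gab; rewrite -eu -ev in G.
have G' := fan_gap_edge _ _ _ _ _ F' gab'; rewrite -eu' -ev' in G'.
have one g1 g2 : gap_edge g1 u v -> gap_edge g2 u v -> (g1 < g2)%N -> False.
  move=> [_ h1 _ [?|[D1 _]]] G2 g12; have [_ h2 _ _] := G2; first lia.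
  by have := gap_edge_min _ _ _ _ _ G2 D1; lia.
have eg : g = g' by case: (ltngtP g g') => // /(one _ _) []; rewrite /=.
subst g'.
have [ab Sa Sb _ _] := F; have [ab' Sa' Sb' _ _] := F'.
have bn x0 a0 b0 y0 : is_face (Fan x0 a0 b0 y0) -> (b0 <= n)%N.
  move=> F0; have [l0 _ Sb0 [_ _] _] := F0.
  by case/orP: Sb0 => [/eqP->//|/tip_lt']; lia.
have b1 := bn _ _ _ _ F; have b2 := bn _ _ _ _ F'.
have eqa : a = a'.
  case: (ltngtP a a') => // h.
    have [nS _] := fan_mid _ _ _ _ a' F ltac:(lia).
    by move: Sa'; rewrite (negbTE nS) orbF => /eqP; lia.
  have [nS _] := fan_mid _ _ _ _ a F' ltac:(lia).
  by move: Sa; rewrite (negbTE nS) orbF => /eqP; lia.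
have eqb : b = b'.
  case: (ltngtP b b') => // h.
    have [nS _] := fan_mid _ _ _ _ b F' ltac:(lia).
    by move: Sb; rewrite (negbTE nS) orbF => /eqP; lia.
  have [nS _] := fan_mid _ _ _ _ b' F ltac:(lia).
  by move: Sb'; rewrite (negbTE nS) orbF => /eqP; lia.
subst a' b'.
have Ga := fan_gap_edge _ _ _ _ a F ltac:(lia).
have Ga' := fan_gap_edge _ _ _ _ a F' ltac:(lia).
have [+ _] := gap_edge_unique _ _ _ _ _ Ga Ga'; rewrite /fan_left eqxx => ->.
have Gb := fan_gap_edge _ _ _ _ b.-1 F ltac:(lia).
have Gb' := fan_gap_edge _ _ _ _ b.-1 F' ltac:(lia).
have [_ +] := gap_edge_unique _ _ _ _ _ Gb Gb'; rewrite /fan_right.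
rewrite prednK; last by clear -ab; lia.
by rewrite eqxx => ->.
Qed.

(** The side of a face that lies above the point g + 1/2 of its lower side
    uv, if there is one. *)
Definition upper_side c u v g u' v' := match c with
  | Tri i j k => if (g < j)%N then u' = i /\ v' = j else u' = j /\ v' = k
  | Fan x a b y => if (g < a)%N then u' = x /\ v' = a
                   else if (b <= g)%N then u' = b /\ v' = y else False
  end.

(** An edge over g inside the lower side of the face crosses no other side of it,
    and the face reaches the tip only through gaps that no such edge covers. *)
Lemma upper_side_max c u v g u' v' : is_face c -> lower_side c u v ->
  D u' v' -> (u <= u')%N -> (u' <= g < v')%N -> (v' <= v)%N ->
  (u, v) <> (u', v') ->
  exists u'' v'', [/\ upper_side c u v g u'' v'', D u'' v'',
    (u'' <= u')%N & (v' <= v'')%N].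
Proof.
case: c => [i j k|x a b y] F.
  move=> [-> ->] D' iu gu vk ne; have [D1 D2 D3] := F.
  have l1 := edge_lt' _ _ D1; have l2 := edge_lt' _ _ D2.
  have c1 := nocross _ _ _ _ D1 D'; have c2 := nocross _ _ _ _ D' D2.
  rewrite /upper_side; have [gj|jg] := ltnP g j.
    exists i, j; split=> //; have [|] := leqP v' j => // jv'.
    have ei : u' = i by lia.
    have [ek|nk] := eqVneq v' k; last lia.
    by case: ne; rewrite ei ek.
  exists j, k; split=> //; have [|] := leqP j u' => // u'j.
  have ek : v' = k by lia.
  have [ei|ni] := eqVneq u' i; last lia.
  by case: ne; rewrite ei ek.
move=> [h hab [eu ev]] D' uu' gu v'v ne.
have G := fan_gap_edge _ _ _ _ _ F hab; rewrite -eu -ev in G.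
have [Duv huv _ _] := G; have [ab _ _ [xa yb] _] := F.
have hin : ~ (u' <= h < v')%N.
  by move=> /(gap_edge_min _ _ _ _ _ G D')[? ?]; apply: ne; congr pair; lia.
rewrite /upper_side.
have [gh|hg] := ltnP g h.
  have ha : h = a by apply/eqP; move: eu; rewrite /fan_left; case: eqP => //; lia.
  have ux : u = x by rewrite eu /fan_left ha eqxx.
  have -> : (g < a)%N by lia.
  exists x, a; split=> //; [|lia|lia].
  case: xa => // ?; lia.
have hb : h.+1 = b by apply/eqP; move: ev; rewrite /fan_right; case: eqP => //; lia.
have vy : v = y by rewrite ev /fan_right hb eqxx.
have -> : (g < a)%N = false by lia.
have -> : (b <= g)%N by lia.
exists b, y; split=> //; [|lia|lia].
case: yb => // ?; lia.
Qed.

Lemma interior_point j : (0 < j < n)%N ->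
  (S j /\ exists k, D k j \/ D j k) \/ (exists i k, D i j /\ D j k).
Proof.
move=> jn; have [x [a [b [y [F jab]]]]] := fan_ex j ltac:(lia).
have [ja|ja] := eqVneq j a; last first.
  by right; have [_] := fan_mid _ _ _ _ j F ltac:(lia).
left; have [_ Sa _ [xa _] _] := F; split.
  by rewrite ja; move: Sa; rewrite -ja; have -> : (j == 0%N) = false by lia.
have [G1 G2 [e|[G3 _]] _] := fan_gap_edge _ _ _ _ _ F jab.
  by exists (fan_right b y j); right; rewrite {1}e.
by exists (fan_left x a j); left.
Qed.

End Edges.

(** ** Signs of the triangles of a chain *)

Section ChainGeometry.
Context {R : realType}.
Implicit Types (a b c d z : (R * R)%type) (A C H : set (R * R)) (s t : R).
Variables (n : nat) (q : nat -> R * R) (p : R * R).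
Hypothesis hc : chain n q p.
Hypothesis gp : general_position (chain_set n q p).
Local Notation A := (chain_set n q p).

Lemma chain_tip_in : A p. Proof. by left. Qed.

Lemma chain_q_in i : (i <= n)%N -> A (q i).
Proof. by move=> il; right; exists i. Qed.

Lemma tip_pos i j : (i < j <= n)%N -> 0 < orient p (q i) (q j).
Proof. by case: hc => _ _ h /andP[ij jn]; exact: h. Qed.

Lemma tip_neg i j : (j < i <= n)%N -> orient p (q i) (q j) < 0.
Proof. by move=> h; rewrite orient_flip oppr_lt0; exact: tip_pos. Qed.

Lemma tip_ltP i j : (i <= n)%N -> (j <= n)%N ->
  (0 < orient p (q i) (q j)) = (i < j)%N.
Proof.
move=> il jl; have [ij|ji|->] := ltngtP i j; last by rewrite orient_abb ltxx.
  by rewrite tip_pos// ij.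
by rewrite ltNge ltW// tip_neg// ji.
Qed.

Lemma chord_tip i j : (i < j <= n)%N -> 0 < orient (q i) (q j) p.
Proof. by move=> h; rewrite orient_cyc; exact: tip_pos. Qed.

Lemma chord_in i j k : (i < k < j)%N -> (j <= n)%N ->
  0 < orient (q i) (q j) (q k).
Proof. by case: hc => _ h _ ijk jn; rewrite orient_flip oppr_gt0; exact: h. Qed.

Lemma chord_out i j k : (k < i)%N || (j < k)%N -> (i < j <= n)%N -> (k <= n)%N ->
  orient (q i) (q j) (q k) < 0.
Proof.
case: hc => _ h _ /orP[ki|jk] ij kn; last by apply: h; lia.
by rewrite orient_cyc; apply: h; lia.
Qed.

Lemma chord_ge0 i j k : (i <= k <= j)%N -> (j <= n)%N ->
  0 <= orient (q i) (q j) (q k).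
Proof.
move=> ikj jn; have [->|ki] := eqVneq k i; first by rewrite orient_aba.
have [->|kj] := eqVneq k j; first by rewrite orient_abb.
by apply/ltW/chord_in => //; lia.
Qed.

Lemma chord_le0 i j k : (k <= i)%N || (j <= k)%N -> (i < j <= n)%N ->
  (k <= n)%N -> orient (q i) (q j) (q k) <= 0.
Proof.
move=> h ij kn; have [->|ki] := eqVneq k i; first by rewrite orient_aba.
have [->|kj] := eqVneq k j; first by rewrite orient_abb.
by apply/ltW/chord_out => //; lia.
Qed.

Lemma chain_inj i j : (i <= n)%N -> (j <= n)%N -> q i = q j -> i = j.
Proof.
move=> il jl e; case: (ltngtP i j) => // h.
  by have := tip_pos i j; rewrite h jl e orient_abb ltxx => /(_ isT).
by have := tip_pos j i; rewrite h il e orient_abb ltxx => /(_ isT).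
Qed.

Lemma chord_neq i j : (i < j <= n)%N -> q i <> q j.
Proof.
move=> ij e; have il : (i <= n)%N by lia.
have jl : (j <= n)%N by lia.
have := chain_inj i j il jl e; lia.
Qed.

Lemma tip_neq i : (i <= n)%N -> q i <> p.
Proof.
have [n0 _ _] := hc; move=> il e; have [i0|i0] := posnP i.
  by have := tip_pos i n; rewrite e orient_aab ltxx i0 n0 leqnn => /(_ isT).
by have := tip_pos 0 i; rewrite e orient_aba ltxx i0 il => /(_ isT).
Qed.

(** Vertices are indexed by option nat, the tip being None. *)
Definition pos (v : option nat) := if v is Some i then q i else p.
Definition on_chain (v : option nat) := if v is Some i then (i <= n)%N else true.

Lemma pos_in v : on_chain v -> A (pos v).
Proof.
by case: v => [i|] /= h; [exact: chain_q_in | exact: chain_tip_in].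
Qed.

Lemma pos_inj v w : on_chain v -> on_chain w -> pos v = pos w -> v = w.
Proof.
case: v w => [i|] [j|] //= hi hj; first by move/(chain_inj _ _ hi hj) ->.
  by move/(tip_neq _ hi).
by move/esym/(tip_neq _ hj).
Qed.

Lemma pos_onto z : A z -> exists2 v, on_chain v & z = pos v.
Proof.
by case=> [->|[i /= il <-]]; [exists None | exists (Some i)].
Qed.

(** ** Extreme points *)

(** The witnesses below are sums of two orientations, each of which vanishes on a
    line that supports the points of V at v. *)
Definition extreme (V : option nat -> bool) v :=
  exists g : R * R -> R, affine g /\
    forall w, V w -> w != v -> g (pos w) < g (pos v).

Lemma extreme_tip : extreme on_chain None.
Proof.
exists (fun z => - orient p (q 0%N) z + orient p (q n) z).
split; first by apply: affineD; [apply: affineN|]; exact: affine_orient.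
case=> [i|] //= il _; have [n0 _ _] := hc; rewrite !orient_aba.
have h1 : 0 <= orient p (q 0%N) (q i).
  by rewrite leNgt; apply/negP; rewrite orient_flip oppr_lt0 tip_ltP.
have h2 : orient p (q n) (q i) <= 0.
  by rewrite leNgt tip_ltP// -leqNgt.
have [i0|i0] := posnP i; first by subst i; have := tip_neg n 0; rewrite n0 leqnn => /(_ isT); lra.
by have := tip_pos 0 i; rewrite i0 il => /(_ isT); lra.
Qed.

Definition tip_and x y (v : option nat) := if v is Some i then (x <= i <= y)%N else true.

Lemma extreme_left x y : (x < y <= n)%N -> extreme (tip_and x y) (Some x).
Proof.
move=> xy; exists (fun z => - orient p (q x) z - orient (q x) (q y) z).
split; first by apply: affineD; apply: affineN; exact: affine_orient.
case=> [i|] /= => [xiy|_ _].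
  move=> /eqP ix; have {}ix : i <> x by move=> e; apply: ix; rewrite e.
  rewrite orient_abb orient_aba.
  have := tip_pos x i; have := chord_ge0 x y i xiy.
  have -> : (y <= n)%N by lia.
  have -> : (x < i <= n)%N by lia.
  by move=> /(_ isT) h1 /(_ isT) h2; lra.
by rewrite orient_aba orient_abb orient_aba; have := chord_tip x y xy; lra.
Qed.

Lemma extreme_right x y : (x < y <= n)%N -> extreme (tip_and x y) (Some y).
Proof.
move=> xy; exists (fun z => orient p (q y) z - orient (q x) (q y) z).
split; first by apply: affineD; [|apply: affineN]; exact: affine_orient.
case=> [i|] /= => [xiy|_ _].
  move=> /eqP iy; have {}iy : i <> y by move=> e; apply: iy; rewrite e.
  rewrite !orient_abb.
  have := tip_neg y i; have := chord_ge0 x y i xiy.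
  have -> : (y <= n)%N by lia.
  have -> : (i < y)%N by lia.
  by move=> /(_ isT) h1 /(_ isT) h2; lra.
by rewrite orient_aba !orient_abb; have := chord_tip x y xy; lra.
Qed.

Definition in_chain (v : option nat) := if v is Some i then (i <= n)%N else false.

Lemma extreme_mid j : (0 < j < n)%N -> extreme in_chain (Some j).
Proof.
move=> jn; exists (fun z => orient (q j.-1) (q j) z + orient (q j) (q j.+1) z).
split; first by apply: affineD; exact: affine_orient.
case=> [i|] //= il /eqP ij; have {}ij : i <> j by move=> e; apply: ij; rewrite e.
rewrite orient_abb orient_aba.
have [h|h] : (i < j)%N \/ (j < i)%N by lia.
  have := chord_le0 j.-1 j i; have := chord_out j j.+1 i.
  rewrite h il; have -> : (j < j.+1 <= n)%N by lia.
  have -> : (j.-1 < j <= n)%N by lia.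
  have -> : (i <= j.-1)%N by lia.
  by move=> /(_ isT isT isT) h1 /(_ isT isT isT) h2; lra.
have := chord_out j.-1 j i; have := chord_le0 j j.+1 i.
rewrite h il orbT; have -> : (j < j.+1 <= n)%N by lia.
have -> : (j.-1 < j <= n)%N by lia.
rewrite orbT => /(_ isT isT isT) h1 /(_ isT isT isT) h2; lra.
Qed.

(** ** Segments of the chain that do not cross *)

Definition meet_ends a b c d :=
  segment a b `&` segment c d `<=` [set a; b] `&` [set c; d].

Lemma meet_endsl a b c d : meet_ends a b c d -> meet_ends b a c d.
Proof. by rewrite /meet_ends segmentC (setUC [set b]). Qed.

Lemma meet_endsr a b c d : meet_ends a b c d -> meet_ends a b d c.
Proof. by rewrite /meet_ends (segmentC d c) (setUC [set d]). Qed.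

Lemma meet_endsC a b c d : meet_ends a b c d -> meet_ends c d a b.
Proof. by rewrite /meet_ends setIC (setIC [set a; b]). Qed.

Lemma meet_ends_side a b c d : A a -> A b -> A c -> A d -> a <> b ->
  0 <= orient a b c -> 0 <= orient a b d ->
  orient a b c != 0 \/ orient a b d != 0 -> meet_ends a b c d.
Proof.
move=> Aa Ab Ac Ad ab oc od ocd z [/segment_orient0 oz /segmentP[t t01 ez]].
move: oz; rewrite ez orient_lerp => oz.
have [c0|c0] := eqVneq (orient a b c) 0.
  have {ocd} d0 : orient a b d != 0 by case: ocd; rewrite ?c0 ?eqxx.
  have -> : t = 0.
    by apply/eqP; move: oz; rewrite c0 mulr0 add0r => /eqP; rewrite mulf_eq0 (negbTE d0) orbF.
  rewrite lerp0; split; last by left.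
  by have [->|->] := on_line _ _ _ _ gp Aa Ab Ac ab c0; [left|right].
have t1 : t = 1.
  have c1 : 0 < orient a b c by rewrite lt_neqAle eq_sym c0.
  have h1 : 0 <= (1 - t) * orient a b c by apply: mulr_ge0; lra.
  have h2 : 0 <= t * orient a b d by apply: mulr_ge0; lra.
  have /eqP : (1 - t) * orient a b c = 0 by lra.
  by rewrite mulf_eq0 (negbTE c0) orbF => /eqP; lra.
rewrite t1 lerp1; split; last by right.
have d0 : orient a b d = 0 by rewrite t1 in oz; lra.
by have [->|->] := on_line _ _ _ _ gp Aa Ab Ad ab d0; [left|right].
Qed.

Lemma meet_ends_chords i j i' j' : (i < j <= n)%N -> (i' < j' <= n)%N ->
  ~ [&& i < i', i' < j & j < j']%N -> ~ [&& i' < i, i < j' & j' < j]%N -> (i, j) <> (i', j') ->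
  meet_ends (q i) (q j) (q i') (q j').
Proof.
have nest u v u' v' : (u < v <= n)%N -> (u' < v' <= n)%N ->
    (u <= u')%N -> (v' <= v)%N -> (u, v) <> (u', v') ->
    meet_ends (q u) (q v) (q u') (q v').
  move=> uv uv' h1 h2 ne; apply: meet_ends_side; try (apply: chain_q_in; lia).
  - exact: chord_neq.
  - by apply: chord_ge0; lia.
  - by apply: chord_ge0; lia.
  - have [e|ne'] := eqVneq u u'.
      right; apply/lt0r_neq0/chord_in; last lia.
      have ne' : v <> v' by move=> e2; apply: ne; rewrite e e2.
      lia.
    by left; apply/lt0r_neq0/chord_in; lia.
have disj u v u' v' : (u < v <= n)%N -> (u' < v' <= n)%N -> (v <= u')%N ->
    meet_ends (q u) (q v) (q u') (q v').
  move=> uv uv' h; apply/meet_endsl/meet_ends_side; try (apply: chain_q_in; lia).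
  - exact/nesym/chord_neq.
  - by rewrite orient_swap oppr_ge0; apply: chord_le0; lia.
  - by rewrite orient_swap oppr_ge0; apply: chord_le0; lia.
  - right; rewrite orient_swap oppr_eq0; apply/ltr0_neq0/chord_out; lia.
move=> ij ij' n1 n2 ne.
have [h|[h|[h|h]]] : ((i <= i')%N /\ (j' <= j)%N) \/ ((i' <= i)%N /\ (j <= j')%N) \/
    (j <= i')%N \/ (j' <= i)%N by lia.
- by case: h => h1 h2; exact: nest.
- by case: h => h1 h2; apply/meet_endsC/nest => //; apply/nesym.
- exact: disj.
- exact/meet_endsC/disj.
Qed.

Lemma meet_ends_tips i j : (i <= n)%N -> (j <= n)%N -> i <> j ->
  meet_ends p (q i) p (q j).
Proof.
move=> il jl ij; have [h|h] : (i < j)%N \/ (j < i)%N by lia.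
  apply: meet_ends_side; rewrite ?orient_aba//; try exact: chain_tip_in;
    try exact: chain_q_in.
  - exact/nesym/tip_neq.
  - by apply/ltW/tip_pos; lia.
  - by right; apply/lt0r_neq0/tip_pos; lia.
apply: meet_endsl; apply: meet_ends_side; rewrite ?orient_abb//; try exact: chain_tip_in;
    try exact: chain_q_in.
- exact/tip_neq.
- by rewrite orient_swap oppr_ge0; apply/ltW/tip_neg; lia.
- by right; rewrite orient_swap oppr_eq0; apply/ltr0_neq0/tip_neg; lia.
Qed.

Lemma meet_ends_chord_tip i j k : (i < j <= n)%N -> (k <= n)%N ->
  meet_ends (q i) (q j) p (q k).
Proof.
move=> ij kn; have [h|[h|h]] : (i <= k <= j)%N \/ (k < i)%N \/ (j < k)%N by lia.
- apply: meet_ends_side; try exact: chain_tip_in; try (apply: chain_q_in; lia).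
  + exact: chord_neq.
  + exact/ltW/chord_tip.
  + by apply: chord_ge0; lia.
  + by left; apply/lt0r_neq0/chord_tip.
- apply/meet_endsC/meet_ends_side; try exact: chain_tip_in; try (apply: chain_q_in; lia).
  + exact/nesym/tip_neq.
  + by apply/ltW/tip_pos; lia.
  + by apply/ltW/tip_pos; lia.
  + by left; apply/lt0r_neq0/tip_pos; lia.
- apply/meet_endsC/meet_endsl/meet_ends_side; try exact: chain_tip_in; try (apply: chain_q_in; lia).
  + exact/tip_neq.
  + by rewrite orient_swap oppr_ge0; apply/ltW/tip_neg; lia.
  + by rewrite orient_swap oppr_ge0; apply/ltW/tip_neg; lia.
  + by left; rewrite orient_swap oppr_eq0; apply/ltr0_neq0/tip_neg; lia.
Qed.

Lemma segments_cross a b c d : 0 < orient a b c -> orient a b d < 0 ->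
  orient c d a < 0 -> 0 < orient c d b ->
  exists s t, [/\ 0 < s < 1, 0 < t < 1 & lerp a b s = lerp c d t].
Proof.
move=> oc od oa ob.
pose k := orient a b c - orient a b d.
have k0 : 0 < k by rewrite /k; lra.
have kE : k = orient c d b - orient c d a by rewrite /k; clear; coords; ring.
exists (- orient c d a / k), (orient a b c / k).
have bt (x : R) : 0 < x -> x < k -> 0 < x / k < 1.
  by move=> x0 xk; rewrite divr_gt0//= ltr_pdivrMr// mul1r.
split; [apply: bt; lra | apply: bt; rewrite /k; lra | ].
have kn : k != 0 by exact: lt0r_neq0.
rewrite !lerpE; apply: pt_ext; apply: (mulfI kn).
  transitivity (k * a.1 - orient c d a * (b.1 - a.1)).
    by clear -kn; move: (orient c d a) k kn => o k kn; coords; field.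
  transitivity (k * c.1 + orient a b c * (d.1 - c.1)).
    by rewrite /k; clear; coords; ring.
  by clear -kn; move: (orient a b c) k kn => o k kn; coords; field.
transitivity (k * a.2 - orient c d a * (b.2 - a.2)).
  by clear -kn; move: (orient c d a) k kn => o k kn; coords; field.
transitivity (k * c.2 + orient a b c * (d.2 - c.2)).
  by rewrite /k; clear; coords; ring.
by clear -kn; move: (orient a b c) k kn => o k kn; coords; field.
Qed.

Lemma chords_cross i j k l : (i < j < k)%N -> (k < l <= n)%N ->
  exists s t, [/\ 0 < s < 1, 0 < t < 1 & lerp (q i) (q k) s = lerp (q j) (q l) t].
Proof.
move=> ijk kl; apply: segments_cross.
- by apply: chord_in; lia.
- by apply: chord_out; lia.
- by apply: chord_out; lia.
- by apply: chord_in; lia.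
Qed.

(** ** The convex hull *)

Definition in_hull z :=
  [/\ 0 <= orient p (q 0%N) z, orient p (q n) z <= 0 & 0 <= orient (q 0%N) (q n) z].

Let n0 : (0 < n)%N. Proof. by case: hc. Qed.

Lemma chain_in_hull v : on_chain v -> in_hull (pos v).
Proof.
case: v => [i|] /= il; split; rewrite ?orient_aba//.
- by rewrite leNgt; apply/negP; rewrite orient_flip oppr_lt0 tip_ltP.
- by rewrite leNgt tip_ltP// -leqNgt.
- by apply: chord_ge0.
- by apply/ltW/chord_tip; rewrite n0 leqnn.
Qed.

Lemma hullP z : hull A z <-> in_hull z.
Proof.
split=> [h|[h1 h2 h3]].
  have half g : affine g -> (forall v, on_chain v -> 0 <= g (pos v)) -> 0 <= g z.
    move=> ag hg; apply: (hull_min A [set z | 0 <= g z] z (cvx_ge0 _ ag)) h.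
    by move=> y /pos_onto[v vn ->]; exact: hg.
  split.
  - apply: (half (orient p (q 0%N))); first exact: affine_orient.
    by move=> v /chain_in_hull[].
  - rewrite -oppr_ge0; apply: (half (fun z => - orient p (q n) z)).
      by apply: affineN; exact: affine_orient.
    by move=> v /chain_in_hull[_ + _]; rewrite oppr_ge0.
  - apply: (half (orient (q 0%N) (q n))); first exact: affine_orient.
    by move=> v /chain_in_hull[].
apply: (in_triangle (hull A) p (q 0%N) (q n)) => //.
- exact: hull_cvx.
- by apply: hull_sub; exact: chain_tip_in.
- by apply: hull_sub; exact: chain_q_in.
- by apply: hull_sub; exact: chain_q_in.
- by apply: tip_pos; rewrite n0 leqnn.
- by rewrite orient_swap oppr_ge0.
Qed.

End ChainGeometry.

(** * The faces of a pseudo-triangulation of a chain *)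

(** The tip is vertex 0 of a path with m vertices, and the others are the
    points mu 1, ..., mu (m - 1) of the chain. The path turns left at the tip
    and at the extreme points mu kx and mu ky only. *)
Section FanShape.
Variables (m : nat) (mu : nat -> nat) (kx ky : nat).
Hypotheses (m2 : (2 < m)%N)
  (mu_inj : forall i j, (0 < i < m)%N -> (0 < j < m)%N -> mu i = mu j -> i = j)
  (nocross : forall k l, (0 < k < m.-1)%N -> (0 < l < m.-1)%N ->
     ~ [&& minn (mu k) (mu k.+1) < minn (mu l) (mu l.+1),
          minn (mu l) (mu l.+1) < maxn (mu k) (mu k.+1) &
          maxn (mu k) (mu k.+1) < maxn (mu l) (mu l.+1)]%N)
  (ab : (mu 1 < mu m.-1)%N)
  (kxm : (0 < kx < m)%N) (kym : (0 < ky < m)%N)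
  (xmin : forall k, (0 < k < m)%N -> (mu kx <= mu k)%N)
  (ymax : forall k, (0 < k < m)%N -> (mu k <= mu ky)%N)
  (right_first : forall k, k = 1%N -> k <> kx -> k <> ky -> (mu k.+1 < mu k)%N)
  (right_last : forall k, k = m.-1 -> k <> kx -> k <> ky -> (mu k < mu k.-1)%N)
  (right_up : forall k, (1 < k < m.-1)%N -> k <> kx -> k <> ky ->
     (mu k.-1 < mu k)%N -> ~ (mu k.-1 < mu k.+1 < mu k)%N)
  (right_down : forall k, (1 < k < m.-1)%N -> k <> kx -> k <> ky ->
     (mu k < mu k.-1)%N -> (mu k < mu k.+1 < mu k.-1)%N)
  (hit : forall j, (mu 1 < j < mu m.-1)%N -> exists2 k, (0 < k < m)%N & mu k = j).

Let ky1 : ky <> 1%N.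
Proof. by move=> e; have := ymax m.-1 ltac:(lia); rewrite e; lia. Qed.

Let kxl : kx <> m.-1.
Proof. by move=> e; have := xmin 1 ltac:(lia); rewrite e; lia. Qed.

Let neq i j : (0 < i < m)%N -> (0 < j < m)%N -> i <> j -> mu i <> mu j.
Proof. by move=> hi hj ij e; apply: ij; exact: mu_inj. Qed.

(** A path that turns right twice after leaving the tip is trapped. *)
Lemma left_corner : kx = 1%N \/ kx = 2%N.
Proof.
have [->|k1] := eqVneq kx 1%N; first by left.
have [->|k2] := eqVneq kx 2%N; first by right.
exfalso; have h21 := right_first 1 erefl ltac:(lia) ltac:(lia).
have h3 : (2 < m.-1)%N by lia.
have ky2 : ky <> 2%N.
  by move=> e; have := ymax m.-1 ltac:(lia); rewrite e; lia.
have := right_down 2 ltac:(lia) ltac:(lia) ltac:(lia) h21 => /= h321.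
suff trap k : (3 <= k < m)%N -> (mu 2 < mu k < mu 1)%N.
  by have := trap kx ltac:(lia); have := xmin 2 ltac:(lia); lia.
elim: k => // k IHk km; have [->//|k3] := eqVneq k 2%N.
have {}IHk := IHk ltac:(lia).
have n1 := neq k.+1 1 ltac:(lia) ltac:(lia) ltac:(lia).
have n2 := neq k.+1 2 ltac:(lia) ltac:(lia) ltac:(lia).
have c1 := nocross 1 k ltac:(lia) ltac:(lia).
have c2 := nocross k 1 ltac:(lia) ltac:(lia).
clear -c1 c2 n1 n2 IHk; lia.
Qed.

Lemma right_corner : ky = m.-1 \/ ky = m.-2.
Proof.
have [->|k1] := eqVneq ky m.-1; first by left.
have [->|k2] := eqVneq ky m.-2; first by right.
exfalso; have h21 := right_last m.-1 erefl ltac:(lia) ltac:(lia).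
have h3 : (2 < m.-1)%N by lia.
have kx2 : kx <> m.-2.
  by move=> e; have := xmin 1 ltac:(lia); rewrite e; lia.
have e1 : m.-2.+1 = m.-1 by lia.
have e2 : m.-2.-1.+1 = m.-2 by lia.
have h321 : (mu m.-1 < mu m.-2.-1 < mu m.-2)%N.
  have [h|h] : (mu m.-2.-1 < mu m.-2)%N \/ (mu m.-2 < mu m.-2.-1)%N.
    by have := neq m.-2 m.-2.-1 ltac:(lia) ltac:(lia) ltac:(lia); lia.
  have := right_up m.-2 ltac:(lia) ltac:(lia) ltac:(lia) h.
    have := neq m.-1 m.-2.-1 ltac:(lia) ltac:(lia) ltac:(lia).
    by rewrite e1; lia.
  by have := right_down m.-2 ltac:(lia) ltac:(lia) ltac:(lia) h; rewrite e1; lia.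
suff trap d k : m = (k + d + 3)%N -> (0 < k)%N -> (mu m.-1 < mu k < mu m.-2)%N.
  have := trap (m - 3 - ky)%N ky ltac:(clear -k1 k2 kym m2; lia) ltac:(clear -kym; lia).
  by have := ymax m.-2 ltac:(clear -m2; lia); clear; lia.
elim: d k => [|d IHd] k mk k0.
  by have -> : k = m.-2.-1 by clear -mk; lia.
have {}IHd := IHd k.+1 ltac:(clear -mk; lia) isT.
have km : (0 < k < m)%N by clear -mk k0; lia.
have km' : (0 < k < m.-1)%N by clear -mk k0; lia.
have n1 := neq k m.-1 km ltac:(clear -m2; lia) ltac:(clear -mk; lia).
have n2 := neq k m.-2 km ltac:(clear -m2; lia) ltac:(clear -mk; lia).
have c1 := nocross m.-2 k ltac:(clear -m2; lia) km'.
have c2 := nocross k m.-2 km' ltac:(clear -m2; lia).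
rewrite e1 in c1 c2.
by clear -c1 c2 n1 n2 IHd; lia.
Qed.

Lemma corner_order : (kx < ky)%N.
Proof.
have h1 := left_corner; have h2 := right_corner.
have ne : kx <> ky.
  move=> e; have := xmin 1 ltac:(lia); have := ymax m.-1 ltac:(lia).
  by rewrite e; have := xmin m.-1 ltac:(lia); have := ymax 1 ltac:(lia); rewrite e; lia.
move: h1 h2 ne ky1; clear -m2 kxm kym; lia.
Qed.

Lemma first_above (h : nat -> nat) lo d t : (h lo < t)%N -> (t < h (lo + d))%N ->
  (forall i, (i <= d)%N -> h (lo + i) <> t) ->
  exists2 i, (i < d)%N & (h (lo + i) < t < h (lo + i).+1)%N.
Proof.
move=> lot thi ne; elim: d thi ne => [|d IHd] thi ne; first by rewrite addn0 in thi; lia.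
have [h1|h1] := ltnP t (h (lo + d)).
  have [i id hi] := IHd h1 (fun i id => ne i (leqW id)).
  by exists i => //; exact: ltnW.
exists d => //; rewrite -addnS thi andbT ltn_neqAle h1 andbT.
by apply/eqP; exact: ne.
Qed.

(** From mu kx to mu ky the path goes up, since going back would cross it. *)
Lemma lower_increasing k : (kx <= k < ky)%N -> (mu k < mu k.+1)%N.
Proof.
have [r] := ubnP k; elim: r k => // r IHr k kr kk.
have mono d u : (kx <= u)%N -> (u + d <= k)%N -> (mu u <= mu (u + d))%N.
  elim: d => [|d IHd] ku ud; first by rewrite addn0.
  have h1 := IHd ku ltac:(lia); rewrite addnS; apply: (leq_trans h1).
  by apply/ltnW/IHr; lia.
have ne := neq k k.+1 ltac:(lia) ltac:(lia) ltac:(lia).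
have [e|kx'] := eqVneq k kx.
  by have := xmin k.+1 ltac:(lia); rewrite -e; clear -ne; lia.
have km : (1 < k < m.-1)%N by lia.
have prev := IHr k.-1 ltac:(lia) ltac:(lia).
rewrite prednK in prev; last by clear -km; lia.
have nb := right_up k km ltac:(lia) ltac:(lia) prev.
have ne' := neq k.-1 k.+1 ltac:(lia) ltac:(lia) ltac:(lia).
rewrite ltnNge; apply/negP => back.
have {nb} back' : (mu k.+1 < mu k.-1)%N by clear -nb back ne ne' prev; lia.
have [] := first_above mu kx (k.-1 - kx) (mu k.+1).
- have := xmin k.+1 ltac:(lia); have := neq kx k.+1 ltac:(lia) ltac:(lia) ltac:(lia).
  by clear; lia.
- by rewrite subnKC//; clear -kx' kk km; lia.
- by move=> i ik; apply: neq; lia.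
move=> i ik hi; have c1 := nocross (kx + i) k ltac:(lia) ltac:(lia).
have := mono (k - (kx + i).+1)%N (kx + i).+1 ltac:(lia) ltac:(lia).
rewrite subnKC => [h1|]; last by clear -ik kk; lia.
have := mono (k.-1 - (kx + i).+1)%N (kx + i).+1 ltac:(lia) ltac:(lia).
rewrite subnKC => [h2|]; last by clear -ik kk kx'; lia.
by clear -c1 h1 h2 hi prev back' back; lia.
Qed.

Lemma lower_mono i j : (kx <= i <= j)%N -> (j <= ky)%N -> (mu i <= mu j)%N.
Proof.
move=> ij jk; have [d e] : exists d, j = (i + d)%N.
  by exists (j - i)%N; clear -ij; lia.
subst j; elim: d ij jk => [|d IHd] ij jk; first by rewrite addn0.
rewrite addnS; apply: (leq_trans (IHd ltac:(lia) ltac:(lia))).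
by apply/ltnW/lower_increasing; lia.
Qed.

Lemma lower_after k : (kx < k <= ky)%N -> (mu 1 < mu k)%N.
Proof.
move=> kk; have h := lower_mono kx.+1 k ltac:(lia) ltac:(lia).
suff {h} h1 : (mu 1 < mu kx.+1)%N by apply: leq_trans h.
case: left_corner => e.
  by have := lower_increasing kx ltac:(lia); rewrite e.
rewrite ltnNge; apply/negP => back.
have ne := neq kx.+1 1 ltac:(lia) ltac:(lia) ltac:(lia).
have yb := ymax m.-1 ltac:(lia).
have [] := first_above mu kx.+1 (ky - kx.+1) (mu 1).
- by clear -back ne; lia.
- by rewrite subnKC; [clear -yb ab; lia | clear -kk; lia].
- by move=> i ik; apply: neq; lia.
move=> i ik hi; have c1 := nocross 1 (kx.+1 + i) ltac:(lia) ltac:(lia).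
have := lower_increasing kx ltac:(lia) => h1.
have := lower_mono kx.+1 (kx.+1 + i) ltac:(lia) ltac:(lia) => h2.
move: c1; rewrite -e; clear -h1 h2 hi; lia.
Qed.

Lemma lower_before k : (kx <= k < ky)%N -> (mu k < mu m.-1)%N.
Proof.
move=> kk; have h := lower_mono k ky.-1 ltac:(lia) ltac:(lia).
suff {h} h1 : (mu ky.-1 < mu m.-1)%N by apply: leq_ltn_trans h1.
have last : (mu ky.-1 < mu ky)%N.
  by have := lower_increasing ky.-1 ltac:(lia); rewrite prednK//; lia.
case: right_corner => e; first by rewrite [X in (_ < mu X)%N](esym e).
rewrite ltnNge; apply/negP => back.
have ne := neq ky.-1 m.-1 ltac:(lia) ltac:(lia) ltac:(lia).
have xa := xmin 1 ltac:(lia).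
have [] := first_above mu kx (ky.-1 - kx) (mu m.-1).
- by clear -xa ab; lia.
- by rewrite subnKC; [clear -back ne; lia | clear -kk; lia].
- by move=> i ik; apply: neq; lia.
move=> i ik hi; have c1 := nocross (kx + i) ky ltac:(lia) ltac:(lia).
have := lower_mono (kx + i).+1 ky.-1 ltac:(lia) ltac:(lia) => h2.
have e1 : ky.+1 = m.-1 by clear -e m2; lia.
move: c1; rewrite e1; clear -last h2 hi back; lia.
Qed.

Lemma hit_lower j : (mu 1 < j < mu m.-1)%N -> exists2 k, (kx < k < ky)%N & mu k = j.
Proof.
move=> jab; have [k km e] := hit j jab; exists k => //.
have n1 : k <> 1%N by move=> e1; rewrite e1 in e; clear -e jab; lia.
have n2 : k <> m.-1 by move=> e1; rewrite e1 in e; clear -e jab; lia.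
have n3 : k <> kx.
  by move=> e1; have := xmin 1 ltac:(lia); rewrite -e1 e; clear -jab; lia.
have n4 : k <> ky.
  by move=> e1; have := ymax m.-1 ltac:(lia); rewrite -e1 e; clear -jab; lia.
have := left_corner; have := right_corner; clear -n1 n2 n3 n4 km; lia.
Qed.

Lemma lower_eq i : (0 < i < ky - kx)%N -> mu (kx + i) = (mu 1 + i)%N.
Proof.
have [r] := ubnP i; elim: r i => // r IHr i ir ii.
have h1 : (mu 1 + i <= mu (kx + i))%N.
  have [e|i1] := eqVneq i 1%N.
    by rewrite e addn1; apply: lower_after; lia.
  have h2 := IHr i.-1 ltac:(lia) ltac:(lia).
  have := lower_increasing (kx + i.-1) ltac:(lia); rewrite h2.
  have -> : (kx + i.-1).+1 = (kx + i)%N by clear -ii; lia.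
  by clear -ii; lia.
apply/eqP; rewrite eqn_leq h1 andbT leqNgt; apply/negP => h2.
have h3 := lower_before (kx + i) ltac:(lia).
have [k kk ek] := hit_lower (mu 1 + i) ltac:(clear -ii h2 h3; lia).
have [ki|ik] := ltnP k (kx + i).
  have := IHr (k - kx)%N ltac:(lia) ltac:(lia).
  rewrite subnKC; last by clear -kk; lia.
  by rewrite ek; clear -ki kk; lia.
by have := lower_mono (kx + i) k ltac:(lia) ltac:(lia); rewrite ek; clear -h2; lia.
Qed.

Lemma lower_length : (ky - kx = mu m.-1 - mu 1)%N.
Proof.
have order := corner_order.
have le : (ky - kx <= mu m.-1 - mu 1)%N.
  have [e|r1] := eqVneq (ky - kx)%N 1%N; first by rewrite e; lia.
  have := lower_eq (ky - kx).-1 ltac:(lia).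
  have -> : (kx + (ky - kx).-1)%N = ky.-1 by clear -order; lia.
  by have := lower_before ky.-1 ltac:(lia); clear -order; lia.
apply/eqP; rewrite eqn_leq le /= leqNgt; apply/negP => gt.
have [k kk ek] := hit_lower (mu 1 + (ky - kx)) ltac:(clear -order gt; lia).
have := lower_eq (k - kx)%N ltac:(lia); rewrite subnKC; last by clear -kk; lia.
by rewrite ek; clear -kk; lia.
Qed.

Lemma fan_shape g : (mu 1 <= g < mu m.-1)%N ->
  mu (kx + (g - mu 1)) = fan_left (mu kx) (mu 1) g /\
  mu (kx + (g - mu 1)).+1 = fan_right (mu m.-1) (mu ky) g.
Proof.
move=> gab; have len := lower_length; rewrite /fan_left /fan_right; split.
  have [->|ga] := eqVneq g (mu 1); first by rewrite subnn addn0.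
  by rewrite lower_eq; [clear -gab; lia | rewrite len; clear -gab ga; lia].
have order := corner_order.
have [gb|gb] := eqVneq g.+1 (mu m.-1).
  by congr mu; clear -gb len gab order; lia.
rewrite -addnS lower_eq; last by rewrite len; clear -gab gb; lia.
by clear -gab; lia.
Qed.

End FanShape.

(** ** Counting convex vertices *)

Section ConvexPoints.
Context {R : realType}.
Implicit Types (a b c d z : (R * R)%type) (P B : set (R * R)) (f : nat -> R * R).

Lemma card_seq (T : choiceType) (s : seq T) : uniq s ->
  [set x | x \in s] #= `I_(size s).
Proof.
case: s => [|x0 s] us.
  suff -> : [set x : T | x \in [::]] = set0.
    by rewrite II0; exact: card_eq00.
  by apply/seteqP; split.
have -> : [set x | x \in x0 :: s] = nth x0 (x0 :: s) @` `I_(size (x0 :: s)).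
  apply/seteqP; split=> x /=.
    move=> xs; exists (index x (x0 :: s)); last exact: nth_index.
    by move: xs; rewrite -index_mem.
  by move=> [i il <-]; exact: mem_nth.
apply: inj_card_eq => i j; rewrite !inE => il jl e.
by apply/eqP; rewrite -(nth_uniq x0 il jl us) e.
Qed.

Lemma card3_sub (T : choiceType) (B : set T) (a b c z : T) : B #= `I_3 ->
  B a -> B b -> B c -> a != b -> a != c -> b != c -> B z ->
  [\/ z = a, z = b | z = c].
Proof.
move=> B3 Ba Bb Bc ab ac bc Bz.
have [->|za] := eqVneq z a; first exact: Or31.
have [->|zb] := eqVneq z b; first exact: Or32.
have [->|zc] := eqVneq z c; first exact: Or33.
exfalso; have us : uniq [:: a; b; c; z].
  by rewrite /= !inE !negb_or ab ac bc !(eq_sym _ z) za zb zc.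
have c4 := card_seq T _ us.
have sub : [set x | x \in [:: a; b; c; z]] `<=` B.
  by move=> x /=; rewrite !inE => /or4P[] /eqP ->.
have := subset_card_le sub; rewrite (card_le_eql c4) (card_le_eqr B3).
by rewrite card_le_II.
Qed.

Lemma card3_eq (T : choiceType) (B : set T) (a b c : T) :
  B a -> B b -> B c -> a != b -> a != c -> b != c ->
  (forall z : T, B z -> [\/ z = a, z = b | z = c]) -> B #= `I_3.
Proof.
move=> Ba Bb Bc ab ac bc hB.
have -> : B = [set x | x \in [:: a; b; c]].
  apply/seteqP; split=> x /=; rewrite !inE.
    by case/hB => ->; rewrite eqxx ?orbT.
  by case/or3P => /eqP ->.
by apply: card_seq; rewrite /= !inE negb_or ab ac bc.
Qed.

Definition convex_points f P : set (R * R) :=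
  [set z | exists2 k, convex_at f P k & z = f k.+1].

Lemma convex_points_card m f P : polygon m f P ->
  [set i : 'I_m | convex_at f P (i + m.-1)%N] #= convex_points f P.
Proof.
move=> fP; have [fm _] := fP; have m0 := polygon_gt0 _ _ _ fP.
have per := polygon_mod _ _ _ fP.
have -> : convex_points f P =
    (fun i : 'I_m => f i) @` [set i : 'I_m | convex_at f P (i + m.-1)%N].
  apply/seteqP; split=> z.
    move=> [k ck ->]; have im : (k.+1 %% m < m)%N by rewrite ltn_mod.
    exists (Ordinal im) => /=; last exact: per.
    have e : f (k.+1 %% m + m.-1)%N = f k.
      apply: (periodic_eq m f per); rewrite modnDml.
      by rewrite (_ : (k.+1 + m.-1)%N = (k + m)%N) ?modnDr//; lia.
    have e' := (cyc_succ m f fm _ _).1 e; have e'' := (cyc_succ m f fm _ _).1 e'.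
    by move: ck; rewrite /convex_at /corner e e' e''.
  move=> [i ci <-]; exists (i + m.-1)%N => //.
  by rewrite (periodic_predS m f m0 per).
apply: card_esym; apply: inj_card_eq => i j _ _ /(cyc_eq m f fm).
by rewrite !modn_small// => e; exact: val_inj.
Qed.


Lemma pseudo_triangle_ccw P : pseudo_triangle P ->
  exists m f, ccw_polygon m f P /\ convex_points f P #= `I_3.
Proof.
move=> /pseudo_triangleP[m [f [fP c3]]].
have {}c3 : convex_points f P #= `I_3.
  by rewrite (card_eq_trans (card_esym (convex_points_card m f P fP)) c3).
have [h|h] := ccw_or_reverse m f P fP; first by exists m, f.
exists m, (fun k => f (k * m.-1)%N); split=> //.
have [fm _] := fP; have [_ [_ tr]] := cyclic_path_rev m f fm.
have fP' : polygon m (fun k => f (k * m.-1)%N) P by case: h.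
suff -> : convex_points (fun k => f (k * m.-1)%N) P = convex_points f P by [].
have m2 : (2 < m)%N by case: fm.
apply/seteqP; split=> z [k [e e0 he] ->].
  have [j [e1 e2 e3]] := tr k; exists j; last by rewrite e2.
  exists e => // s t s0 t0 st; have := he t s t0 s0 ltac:(by rewrite addrC).
  by rewrite /corner e1 e2 e3 addrAC.
(* the vertex k + 1 of the path is the vertex j + 1 of its reverse *)
have [j ej] : exists j, f (j * m.-1)%N = f k.+2.
  exists (k.+2 * m.-1)%N; apply/(cyc_eq m f fm).
  have -> : (k.+2 * m.-1 * m.-1)%N = (k.+2 * (m - 2) * m + k.+2)%N by nia.
  by rewrite modnMDl.
have [i [e1 e2 e3]] := tr j; rewrite e1 in ej.
have ei1 := (cyc_succ m f fm _ _).2 ej; have ei0 := (cyc_succ m f fm _ _).2 ei1.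
exists j; last by rewrite e2 ei1.
exists e => // s t s0 t0 st; have := he t s t0 s0 ltac:(by rewrite addrC).
by rewrite /corner e1 e2 e3 ej ei1 ei0 addrAC.
Qed.

Lemma ccw_pseudo_triangle m f P : ccw_polygon m f P ->
  convex_points f P #= `I_3 -> pseudo_triangle P.
Proof.
move=> [fP _] c3; apply/pseudo_triangleP; exists m, f; split=> //.
by rewrite (card_eq_trans (convex_points_card m f P fP) c3).
Qed.

Lemma ccw_shift m f P k0 : ccw_polygon m f P ->
  ccw_polygon m (fun k => f (k + k0)%N) P /\
  convex_points (fun k => f (k + k0)%N) P = convex_points f P.
Proof.
move=> [[fm [cP rP fr]] fl]; have [m2 inj tn nc] := fm.
have back k : exists j, [/\ f (j + k0)%N = f k, f (j.+1 + k0)%N = f k.+1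
    & f (j.+2 + k0)%N = f k.+2].
  exists (k + m.-1 * k0)%N; have h i : f (i + m.-1 * k0 + k0)%N = f i.
    apply/inj; rewrite -addnA (_ : (m.-1 * k0 + k0)%N = (k0 * m)%N) ?modnDml; last nia.
    by rewrite addnC modnMDl.
  by split; [exact: h | exact: (h k.+1) | exact: (h k.+2)].
split.
  split; last by move=> k t t01; exact: (fl (k + k0)%N t t01).
  split.
    split=> //.
    - by move=> i j; rewrite inj; split=> /eqP h; apply/eqP; move: h; rewrite eqn_modDr.
    - by move=> i j; exact: (nc (i + k0)%N (j + k0)%N).
  split=> //; rewrite fr; apply/seteqP; split=> z [k h].
    by have [j [e1 e2 _]] := back k; exists j; rewrite e1 e2.
  by exists (k + k0)%N.
apply/seteqP; split=> z [k ck ->].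
  by exists (k + k0)%N.
have [j [e1 e2 e3]] := back k; exists j; last by rewrite e2.
by move: ck; rewrite /convex_at /corner e1 e2 e3.
Qed.

End ConvexPoints.

(** ** Classification of the faces *)

(** Sides are directed so that the face is on their left. *)
Definition side_of (c : cell) (v w : option nat) := match c with
  | Tri i j k => [\/ v = Some i /\ w = Some k, v = Some k /\ w = Some j
                   | v = Some j /\ w = Some i]
  | Fan x a b y => [\/ [\/ v = None /\ w = Some a | v = Some b /\ w = None],
      [\/ [/\ (x < a)%N, v = Some a & w = Some x] |
          [/\ (b < y)%N, v = Some y & w = Some b]] |
      exists2 g, (a <= g < b)%N &
        v = Some (fan_left x a g) /\ w = Some (fan_right b y g)]
  end.

Definition valid_cell n (c : cell) := match c with
  | Tri i j k => (i < j < k)%N /\ (k <= n)%N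
  | Fan x a b y => [/\ (x <= a)%N, (a < b)%N, (b <= y)%N & (y <= n)%N]
  end.

Section Classification.
Context {R : realType}.
Implicit Types (z : (R * R)%type) (P : set (R * R)) (f : nat -> R * R) (c : cell).
Variables (n : nat) (q : nat -> R * R) (p : R * R).
Hypothesis hc : chain n q p.
Hypothesis gp : general_position (chain_set n q p).
Local Notation A := (chain_set n q p).
Local Notation pos := (pos q p).

Definition traces f c :=
  (forall k, exists v w, [/\ side_of c v w, f k = pos v & f k.+1 = pos w]) /\
  (forall v w, side_of c v w -> exists k, f k = pos v /\ f k.+1 = pos w).

Lemma tri_traces m f i j k r : m = 3%N -> cyclic_path m f ->
  f r = q i -> f r.+1 = q k -> f r.+2 = q j -> traces f (Tri i j k).
Proof.
move=> m3 fm e0 e1 e2; subst m.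
have e3 : f r.+3 = f r.
  by apply/(cyc_eq 3 f fm); rewrite -addn3 modnDr.
split.
  move=> l; have [d [d3 ed]] : exists d, (d < 3)%N /\ f l = f (r + d)%N.
    exists ((l + 2 * r) %% 3)%N; split; first by rewrite ltn_mod.
    apply/(cyc_eq 3 f fm); rewrite modnDmr.
    by rewrite (_ : (r + (l + 2 * r))%N = (r * 3 + l)%N) ?modnMDl//; lia.
  have ed' := (cyc_succ 3 f fm _ _).1 ed.
  case: d d3 ed ed' => [|[|[|//]]] _; rewrite ?addn0 ?addn1 ?addn2 => -> ->.
  - by exists (Some i), (Some k); split=> //; apply: Or31.
  - by exists (Some k), (Some j); split=> //; apply: Or32.
  - by exists (Some j), (Some i); rewrite e3; split=> //; apply: Or33.
move=> v w [] [-> ->].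
- by exists r.
- by exists r.+1.
- by exists r.+2; rewrite e3.
Qed.

(** Without the tip, all vertices are extreme, hence convex, and a
    pseudo-triangle with three vertices is a triangle. *)
Lemma tri_case m f P : ccw_polygon m f P ->
  (forall k, exists2 i, (i <= n)%N & f k = q i) ->
  convex_points f P #= `I_3 ->
  exists2 c, valid_cell n c & traces f c.
Proof.
move=> [[fm Pf] fl] fq c3; have [n0 _ _] := hc.
have [mu hmu] := choice (fun k => let: ex_intro2 i il e := fq k in
  ex_intro (fun i => (i <= n)%N /\ f k = q i) i (conj il e)).
have mun k : (mu k <= n)%N by case: (hmu k).
have fmu k : f k = q (mu k) by case: (hmu k).
have left_turn k : 0 < turn f k.
  have ext (V : option nat -> bool) : (forall i, (i <= n)%N -> V (Some i)) ->
      extreme q p V (Some (mu k.+1)) -> 0 < turn f k.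
    move=> hV [g [ag hg]]; apply: (extreme_turn m f P fm Pf fl g) => // j.
    rewrite !fmu => ne; apply: (hg (Some (mu j))); first exact: hV.
    by apply/eqP => -[e]; apply: ne; rewrite e.
  have [e0|e0] := posnP (mu k.+1).
    apply: (ext (tip_and 0 n)) => [i il|]; first by rewrite /tip_and il.
    by rewrite e0; apply: (extreme_left n q p hc); rewrite n0 leqnn.
  have [en|en] := eqVneq (mu k.+1) n.
    apply: (ext (tip_and 0 n)) => [i il|]; first by rewrite /tip_and il.
    by rewrite en; apply: (extreme_right n q p hc); rewrite n0 leqnn.
  apply: (ext (in_chain n)) => [//|].
  by apply: (extreme_mid n q p hc); rewrite e0 ltn_neqAle en mun.
have conv k : convex_points f P (f k.+1).
  by exists k => //; apply/(convex_atP m f P fm Pf fl).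
have neS := cyc_neqS m f fm; have neSS := cyc_neqSS m f fm.
have m3 : m = 3%N.
  have m2 : (2 < m)%N by case: fm.
  have := card3_sub _ _ (f 1%N) (f 2%N) (f 3%N) (f 4%N) c3 (conv 0%N) (conv 1%N)
    (conv 2%N) ltac:(exact/eqP/neS) ltac:(exact/eqP/neSS) ltac:(exact/eqP/neS) (conv 3%N).
  case=> /(cyc_eq m f fm)/eqP; last 2 first.
  - by rewrite -[4%N]/(2 + 2)%N -[X in _ == X %[mod _]]/(0 + 2)%N eqn_modDr mod0n modn_small//; lia.
  - by rewrite -[4%N]/(1 + 3)%N -[X in _ == X %[mod _]]/(0 + 3)%N eqn_modDr mod0n modn_small//; lia.
  rewrite -[4%N]/(3 + 1)%N -[X in _ == X %[mod _]]/(0 + 1)%N eqn_modDr mod0n.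
  have [//|m4] := eqVneq m 3%N; rewrite modn_small//; lia.
have := left_turn 0%N; rewrite /turn !fmu => pos012.
have ne01 : mu 0%N <> mu 1%N by move=> e; apply: (neS 0%N); rewrite !fmu e.
have ne12 : mu 1%N <> mu 2%N by move=> e; apply: (neS 1%N); rewrite !fmu e.
have ne02 : mu 0%N <> mu 2%N by move=> e; apply: (neSS 0%N); rewrite !fmu e.
have m0 := mun 0%N; have m1 := mun 1%N; have m2 := mun 2%N.
have notout i j k : 0 < orient (q i) (q j) (q k) -> (i < j <= n)%N -> (k <= n)%N ->
    ~~ ((k < i)%N || (j < k)%N).
  move=> o3 ij kn; apply/negP => h.
  by have := chord_out n q p hc i j k h ij kn; rewrite ltNge (ltW o3).
have notin i j k : orient (q i) (q j) (q k) < 0 -> (j <= n)%N -> ~~ (i < k < j)%N.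
  move=> o3 jn; apply/negP => h.
  by have := chord_in n q p hc i j k h jn; rewrite ltNge (ltW o3).
have [lt01|lt10] : (mu 0 < mu 1)%N \/ (mu 1 < mu 0)%N by clear -ne01; lia.
  have h := notout _ _ _ pos012 ltac:(by rewrite lt01) m2.
  exists (Tri (mu 0%N) (mu 2%N) (mu 1%N)).
    by split=> //; clear -h ne12 ne02; lia.
  by apply: (tri_traces m f _ _ _ 0).
rewrite orient_swap oppr_gt0 in pos012.
have h := notin _ _ _ pos012 m0.
have [lt21|lt02] : (mu 2 < mu 1)%N \/ (mu 0 < mu 2)%N by clear -h ne12 ne02; lia.
  exists (Tri (mu 2%N) (mu 1%N) (mu 0%N)).
    by split=> //; rewrite lt21.
  apply: (tri_traces m f _ _ _ 2) => //; subst m.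
    by rewrite -fmu; apply/(cyc_eq 3 f fm).
  by rewrite -fmu; apply/(cyc_eq 3 f fm).
exists (Tri (mu 1%N) (mu 0%N) (mu 2%N)).
  by split=> //; rewrite lt10.
apply: (tri_traces m f _ _ _ 1) => //; subst m.
by rewrite -fmu; apply/(cyc_eq 3 f fm).
Qed.

End Classification.

Lemma corner_coordinates (R : realType) (p a b c : R * R) (s : R) :
  orient p a b != 0 ->
  p + (s * (orient p a c / orient p a b)) *: (b - p)
    + (s * (orient p c b / orient p a b)) *: (a - p) = lerp p c s.
Proof.
move=> o0; apply: pt_ext.
  have e : orient p a b * (c.1 - p.1) =
      orient p a c * (b.1 - p.1) + orient p c b * (a.1 - p.1).
    by clear o0; coords; ring.
  move: (orient p a b) (orient p a c) (orient p c b) o0 e => o x y o0 e.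
  transitivity (p.1 + s * ((x * (b.1 - p.1) + y * (a.1 - p.1)) / o)).
    by clear e; coords; field.
  by rewrite -e; clear e; rewrite /lerp; coords; field.
have e : orient p a b * (c.2 - p.2) =
    orient p a c * (b.2 - p.2) + orient p c b * (a.2 - p.2).
  by clear o0; coords; ring.
move: (orient p a b) (orient p a c) (orient p c b) o0 e => o x y o0 e.
transitivity (p.2 + s * ((x * (b.2 - p.2) + y * (a.2 - p.2)) / o)).
  by clear e; coords; field.
by rewrite -e; clear e; rewrite /lerp; coords; field.
Qed.

Section FanCase.
Context {R : realType}.
Implicit Types (z : (R * R)%type) (P : set (R * R)) (f : nat -> R * R) (c : cell).
Variables (n : nat) (q : nat -> R * R) (p : R * R).
Hypothesis hc : chain n q p.
Hypothesis gp : general_position (chain_set n q p).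
Local Notation A := (chain_set n q p).
Local Notation pos := (pos q p).

Variables (m : nat) (f : nat -> R * R) (P : set (R * R)).
Hypotheses (fm : cyclic_path m f) (Pf : bounded_by f P) (fl : on_left f P)
  (f0 : f 0%N = p) (empty : forall z, A z -> ~ P° z).

Variable mu : nat -> nat.
Hypothesis fmu : forall k, (0 < k < m)%N -> (mu k <= n)%N /\ f k = q (mu k).

Let m2 : (2 < m)%N. Proof. by case: fm. Qed.
Let mun k : (0 < k < m)%N -> (mu k <= n)%N. Proof. by move=> /fmu[]. Qed.
Let fq k : (0 < k < m)%N -> f k = q (mu k). Proof. by move=> /fmu[]. Qed.
Let fm0 : f m = p.
Proof. by rewrite -f0; apply/(cyc_eq m f fm); rewrite modnn mod0n. Qed.
Let fm1 : f m.-1.+1 = p. Proof. by rewrite prednK// (ltn_trans _ m2). Qed.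
Let fm2 : f m.-1.+2 = f 1%N.
Proof. by apply: (cyc_succ m f fm _ _).1; rewrite fm1 f0. Qed.

Let mu_inj i j : (0 < i < m)%N -> (0 < j < m)%N -> mu i = mu j -> i = j.
Proof.
move=> hi hj e; have : f i = f j by rewrite !fq// e.
by move/(cyc_eq m f fm); rewrite !modn_small//; lia.
Qed.

Let vertex k : exists2 i, (i < m)%N & f k = f i.
Proof.
exists (k %% m)%N; first by rewrite ltn_mod (ltn_trans _ m2).
by apply/(cyc_eq m f fm); rewrite modn_mod.
Qed.

Let nocross k l : (0 < k < m.-1)%N -> (0 < l < m.-1)%N ->
  ~ [&& minn (mu k) (mu k.+1) < minn (mu l) (mu l.+1),
       minn (mu l) (mu l.+1) < maxn (mu k) (mu k.+1) &
       maxn (mu k) (mu k.+1) < maxn (mu l) (mu l.+1)]%N.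
Proof.
move=> hk hl h; have [_ _ _ nc] := fm.
have hk0 : (0 < k < m)%N by clear -hk; lia.
have hk1 : (0 < k.+1 < m)%N by clear -hk; lia.
have hl0 : (0 < l < m)%N by clear -hl; lia.
have hl1 : (0 < l.+1 < m)%N by clear -hl; lia.
have kl : f k <> f l.
  move=> /(cyc_eq m f fm); rewrite !modn_small; try by [clear -hl; lia|clear -hk; lia].
  by move=> e; move: h; rewrite e ltnn.
have mx : (maxn (mu l) (mu l.+1) <= n)%N by rewrite geq_max !mun.
have [s [t [s01 t01 e]]] := chords_cross n q p hc (minn (mu k) (mu k.+1))
  (minn (mu l) (mu l.+1)) (maxn (mu k) (mu k.+1)) (maxn (mu l) (mu l.+1))
  ltac:(clear -h; lia) ltac:(clear -h mx; lia).
have seg r j : 0 < r < 1 -> (0 < j < m.-1)%N ->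
    segment (f j) (f j.+1) (lerp (q (minn (mu j) (mu j.+1))) (q (maxn (mu j) (mu j.+1))) r).
  move=> /andP[r0 r1] hj; have hj1 : (0 < j < m)%N by clear -hj; lia.
  have hj2 : (0 < j.+1 < m)%N by clear -hj; lia.
  rewrite (fq j hj1) (fq j.+1 hj2); have h01 : 0 <= r <= 1 by rewrite !ltW.
  have [le|lt] := leqP (mu j) (mu j.+1); first by apply/segmentP; exists r.
  by rewrite segmentC; apply/segmentP; exists r.
have [] := nc k l kl (lerp (q (minn (mu k) (mu k.+1))) (q (maxn (mu k) (mu k.+1))) s).
  by split; [exact: seg | rewrite e; exact: seg].
have ne : q (minn (mu k) (mu k.+1)) <> q (maxn (mu k) (mu k.+1)).
  apply: (chord_neq n q p hc); clear -h mx; lia.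
have /= n1 := lerp_neq _ _ _ ne s01; have n2 := lerp_neqr _ _ _ ne s01.
rewrite (fq k hk0) (fq k.+1 hk1) => /= -[e1|e1] _; move: n1 n2; rewrite e1;
  by have [le|lt] := leqP (mu k) (mu k.+1).
Qed.

Let ab : (mu 1 < mu m.-1)%N.
Proof.
have h1 : (0 < 1 < m)%N by clear -m2; lia.
have h2 : (0 < m.-1 < m)%N by clear -m2; lia.
have [g [ag hg]] := extreme_tip n q p hc.
have tp : 0 < turn f m.-1.
  apply: (extreme_turn m f P fm Pf fl g) => // j; rewrite fm1 => ne.
  have [i im e] := vertex j; rewrite e; have [i0|i0] := posnP i.
    by case: ne; rewrite e i0.
  rewrite fq ?i0//; apply: (hg (Some (mu i))) => //=.
  by apply: mun; rewrite i0.
move: tp; rewrite /turn fm1 fm2 (fq 1%N h1) (fq m.-1 h2).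
by rewrite -orient_cyc (tip_ltP n q p hc)// mun.
Qed.

(** The segment from the tip to q j starts inside the region, since it is inside
    the convex corner at the tip, and it meets no side. If q j were not a vertex,
    it would be in the interior of the region. *)
Lemma fan_gap_vertex j : (mu 1 < j < mu m.-1)%N ->
  exists2 k, (0 < k < m)%N & mu k = j.
Proof.
move=> jab; apply: contrapT => nk.
have h1 : (0 < 1 < m)%N by clear -m2; lia.
have h2 : (0 < m.-1 < m)%N by clear -m2; lia.
have jn : (j <= n)%N by have := mun m.-1 h2; clear -jab; lia.
have Aj := chain_q_in n q p j jn.
have c1 := tip_pos n q p hc (mu 1%N) j ltac:(clear -jab jn; lia).
have c2 := tip_pos n q p hc j (mu m.-1) ltac:(have := mun m.-1 h2; clear -jab jn; lia).
have c3 := tip_pos n q p hc (mu 1%N) (mu m.-1) ltac:(have := mun m.-1 h2; clear -jab jn; lia).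
have conv : convex_at f P m.-1.
  apply/(convex_atP m f P fm Pf fl); rewrite /turn fm1 fm2 (fq 1%N h1) (fq m.-1 h2).
  by rewrite -orient_cyc.
pose C := [set z | exists2 r : R, 0 < r <= 1 & z = lerp p (q j) r].
have cC : cvx C.
  move=> _ _ t [r1 r1h ->] [r2 r2h ->] t01; exists ((1 - t) * r1 + t * r2).
    by have := mix_gt0 r1 r2 t; nra.
  exact: lerp_lerp.
have dC z : C z -> ~ sides f z.
  move=> [r r01 ez] /(sides_lt m f fm)[k km sk].
  have sz : segment p (q j) z by apply/segmentP; exists r => //; lra.
  have zp : z <> p.
    move=> e; have := c1; rewrite -[X in orient _ _ X](lerp1 p (q j)).
    have : orient p (q (mu 1%N)) z = 0 by rewrite e orient_aba.
    by rewrite ez !orient_lerp orient_aba; nra.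
  have [k0|k0] := posnP k.
    move: sk; rewrite k0 f0 (fq 1%N h1) => sk.
    have [] := meet_ends_tips n q p hc gp (mu 1%N) j (mun 1%N h1) jn
      ltac:(clear -jab; lia) z (conj sk sz).
    case=> //= e _; have := segment_orient0 p (q j) z sz.
    by rewrite e orient_flip; lra.
  have [k1|k1] := eqVneq k m.-1.
    move: sk; rewrite k1 fm1 (fq m.-1 h2) segmentC => sk.
    have [] := meet_ends_tips n q p hc gp (mu m.-1) j (mun m.-1 h2) jn
      ltac:(clear -jab; lia) z (conj sk sz).
    case=> //= e _; have := segment_orient0 p (q j) z sz.
    by rewrite e; lra.
  have hk : (0 < k < m)%N by rewrite k0.
  have hk' : (0 < k.+1 < m)%N by clear -km k1 k0; lia.
  rewrite (fq k hk) (fq k.+1 hk') in sk.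
  have nkj i : (0 < i < m)%N -> mu i <> j by move=> hi e; apply: nk; exists i.
  have neS : mu k <> mu k.+1 by move=> /(mu_inj _ _ hk hk'); clear; lia.
  have mt : meet_ends (q (mu k)) (q (mu k.+1)) p (q j).
    have [le|le] : (mu k < mu k.+1)%N \/ (mu k.+1 < mu k)%N by clear -neS; lia.
      by apply: (meet_ends_chord_tip n q p hc gp); rewrite // le mun.
    by apply/meet_endsl/(meet_ends_chord_tip n q p hc gp); rewrite // le mun.
  have [+ [//|e]] := mt z (conj sk sz); rewrite e => -[] /(chain_inj n q p hc).
    by move=> h; apply: (nkj k hk); apply/esym/h => //; exact: mun.
  by move=> h; apply: (nkj k.+1 hk'); apply/esym/h => //; exact: mun.
(* near the tip, the segment from the tip to q j is inside the corner *)
have [e e0 he] := conv.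
pose al := orient p (q (mu 1%N)) (q j) / orient p (q (mu 1%N)) (q (mu m.-1)).
pose be := orient p (q j) (q (mu m.-1)) / orient p (q (mu 1%N)) (q (mu m.-1)).
have al0 : 0 < al by exact: divr_gt0.
have be0 : 0 < be by exact: divr_gt0.
have dE s : corner f m.-1 (s * al) (s * be) = lerp p (q j) s.
  rewrite /corner fm1 fm2 (fq 1%N h1) (fq m.-1 h2).
  exact: (corner_coordinates _ _ _ _ _ _ (lt0r_neq0 c3)).
pose r := Num.min 1 (e / (al + be)).
have r0 : 0 < r by rewrite lt_min ltr01 divr_gt0// addr_gt0.
have r1 : r <= 1 by rewrite ge_min lexx.
have re : r * al + r * be <= e.
  rewrite -mulrDr -ler_pdivlMr ?addr_gt0//.
  by rewrite ge_min lexx orbT.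
have Pr : P (lerp p (q j) r).
  by rewrite -dE; apply: he => //; apply: mulr_ge0; exact: ltW.
have Cr : C (lerp p (q j) r) by exists r; rewrite ?r0.
have Cj : C (q j) by exists 1; rewrite ?ltr01 ?lexx ?lerp1.
have Pj : P (q j) := cvx_region f P Pf C cC dC _ _ Cr Cj Pr.
apply: (empty _ Aj); apply: contrapT => /(regionE f P Pf _ Pj).
exact: dC.
Qed.

Section Corners.
Variables (kx ky : nat).
Hypotheses (kxm : (0 < kx < m)%N) (kym : (0 < ky < m)%N)
  (xmin : forall k, (0 < k < m)%N -> (mu kx <= mu k)%N)
  (ymax : forall k, (0 < k < m)%N -> (mu k <= mu ky)%N)
  (c3 : convex_points f P #= `I_3).

Let xy : (mu kx < mu ky)%N.
Proof.
have := xmin 1 ltac:(clear -m2; lia); have := ymax m.-1 ltac:(clear -m2; lia).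
by move: ab; clear; lia.
Qed.

Let conv_of (V : option nat -> bool) k : (forall i, (0 < i < m)%N -> V (Some (mu i))) ->
  V None -> (0 < k < m)%N -> extreme q p V (Some (mu k)) -> convex_points f P (f k).
Proof.
move=> V1 V0 km [g [ag hg]]; exists k.-1; last by rewrite prednK//; case/andP: km.
apply/(convex_atP m f P fm Pf fl); apply: (extreme_turn m f P fm Pf fl g) => // j.
rewrite prednK; last by case/andP: km.
rewrite [f k]fq// => ne; have [i im e] := vertex j; rewrite e in ne *.
have [i0|i0] := posnP i; first by rewrite i0 f0; exact: (hg None).
have hi : (0 < i < m)%N by rewrite i0.
rewrite fq// in ne *; apply: (hg (Some (mu i))); first exact: V1.
by apply/eqP => -[e']; apply: ne; rewrite e'.
Qed.

(** The tip and the points that are extreme among the vertices are convex, and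
    there is no fourth convex vertex. *)
Lemma fan_right_turns k : (0 < k < m)%N -> k <> kx -> k <> ky ->
  orient (f k.-1) (f k) (f k.+1) < 0.
Proof.
move=> km kkx kky.
have xyn : (mu kx < mu ky <= n)%N by rewrite xy mun.
have Vxy i : (0 < i < m)%N -> tip_and (mu kx) (mu ky) (Some (mu i)).
  by move=> hi; rewrite /= xmin// ymax.
have cp : convex_points f P p.
  exists m.-1; last by rewrite fm1.
  have h1 : (0 < 1 < m)%N by clear -m2; lia.
  have h2 : (0 < m.-1 < m)%N by clear -m2; lia.
  apply/(convex_atP m f P fm Pf fl); rewrite /turn fm1 fm2 (fq 1%N h1) (fq m.-1 h2).
  by rewrite -orient_cyc (tip_ltP n q p hc)// mun.
have cx : convex_points f P (f kx).
  exact: (conv_of _ kx Vxy isT kxm (extreme_left n q p hc _ _ xyn)).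
have cy : convex_points f P (f ky).
  exact: (conv_of _ ky Vxy isT kym (extreme_right n q p hc _ _ xyn)).
have fneq i j : (0 < i < m)%N -> (0 < j < m)%N -> i <> j -> f i != f j.
  move=> hi hj ij; apply/eqP => /(cyc_eq m f fm).
  by rewrite !modn_small //; [case/andP: hj|case/andP: hi].
have fp i : (0 < i < m)%N -> f i != p.
  by move=> hi; rewrite fq//; apply/eqP; apply: (tip_neq n q p hc); exact: mun.
have nxy : kx <> ky by move=> e; move: xy; rewrite e ltnn.
have km' : k.-1.+1 = k by rewrite prednK//; case/andP: km.
have t0 : turn f k.-1 != 0 by exact: (cyc_turn m f fm).
have tE : turn f k.-1 = orient (f k.-1) (f k) (f k.+1) by rewrite /turn km'.
rewrite -tE lt_neqAle t0 leNgt; apply/negP => tp.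
have ck : convex_points f P (f k).
  by exists k.-1; [apply/(convex_atP m f P fm Pf fl) | rewrite km'].
have [/eqP|/eqP|/eqP] := card3_sub _ _ p (f kx) (f ky) (f k) c3 cp cx cy
  ltac:(by rewrite eq_sym fp) ltac:(by rewrite eq_sym fp) ltac:(exact: fneq) ck.
- by rewrite (negbTE (fp k km)).
- by rewrite (negbTE (fneq _ _ km kxm kkx)).
- by rewrite (negbTE (fneq _ _ km kym kky)).
Qed.

Lemma fan_traces : let c := Fan (mu kx) (mu 1%N) (mu m.-1) (mu ky) in
  valid_cell n c /\ traces q p f c.
Proof.
have h1 : (0 < 1 < m)%N by clear -m2; lia.
have h2 : (0 < m.-1 < m)%N by clear -m2; lia.
have right k : (0 < k < m)%N -> k <> kx -> k <> ky ->
    orient (f k.-1) (f k) (f k.+1) < 0 by exact: fan_right_turns.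
have flip_tip i j : orient p (q i) (q j) < 0 -> (i <= n)%N -> (j <= n)%N -> (j < i)%N.
  by rewrite orient_flip oppr_lt0 => h ii jj; rewrite -(tip_ltP n q p hc).
have right_first k : k = 1%N -> k <> kx -> k <> ky -> (mu k.+1 < mu k)%N.
  move=> -> k1 k2; have := right 1%N h1 k1 k2; rewrite f0 (fq 1%N h1) (fq 2%N); last by clear -m2; lia.
  by move/flip_tip; apply; apply: mun => //; clear -m2; lia.
have right_last k : k = m.-1 -> k <> kx -> k <> ky -> (mu k < mu k.-1)%N.
  move=> -> k1 k2; have := right m.-1 h2 k1 k2.
  rewrite fm1 (fq m.-1 h2) (fq m.-2); last by clear -m2; lia.
  by rewrite orient_cyc => /flip_tip; apply; apply: mun => //; clear -m2; lia.
have mid k : (1 < k < m.-1)%N -> [/\ (0 < k.-1 < m)%N, (0 < k < m)%N & (0 < k.+1 < m)%N].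
  by clear; split; lia.
have right_mid k : (1 < k < m.-1)%N -> k <> kx -> k <> ky ->
    orient (q (mu k.-1)) (q (mu k)) (q (mu k.+1)) < 0.
  move=> km k1 k2; have [i1 i2 i3] := mid k km.
  by have := right k i2 k1 k2; rewrite !fq.
have right_up k : (1 < k < m.-1)%N -> k <> kx -> k <> ky ->
    (mu k.-1 < mu k)%N -> ~ (mu k.-1 < mu k.+1 < mu k)%N.
  move=> km k1 k2 lt h; have [i1 i2 i3] := mid k km.
  have := right_mid k km k1 k2.
  by rewrite ltNge (ltW (chord_in n q p hc _ _ _ h (mun _ i2))).
have right_down k : (1 < k < m.-1)%N -> k <> kx -> k <> ky ->
    (mu k < mu k.-1)%N -> (mu k < mu k.+1 < mu k.-1)%N.
  move=> km k1 k2 lt; have [i1 i2 i3] := mid k km.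
  have n1 : mu k <> mu k.+1 by move/(mu_inj _ _ i2 i3); clear; lia.
  have n2 : mu k.-1 <> mu k.+1 by move/(mu_inj _ _ i1 i3); clear -km; lia.
  have := right_mid k km k1 k2; rewrite orient_swap oppr_lt0 => o0.
  have [h|h] := boolP ((mu k.+1 < mu k)%N || (mu k.-1 < mu k.+1)%N).
    have := chord_out n q p hc (mu k) (mu k.-1) (mu k.+1) h.
    rewrite lt mun// mun// => /(_ isT isT).
    by rewrite ltNge (ltW o0).
  by clear -h n1 n2; lia.
have := left_corner m mu kx ky m2 mu_inj nocross ab kxm kym xmin ymax right_first right_down.
have := right_corner m mu kx ky m2 mu_inj nocross ab kxm kym xmin ymax right_last right_up right_down.
have := lower_length m mu kx ky m2 mu_inj nocross ab kxm kym xmin ymax right_first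
  right_last right_up right_down fan_gap_vertex.
have := fan_shape m mu kx ky m2 mu_inj nocross ab kxm kym xmin ymax right_first
  right_last right_up right_down fan_gap_vertex.
have := corner_order m mu kx ky m2 mu_inj nocross ab kxm kym xmin ymax right_first
  right_last right_up right_down.
move=> order shape len kyE kxE.
have xa := xmin 1 h1; have yb := ymax m.-1 h2.
split; first by split=> //; exact: mun.
have xaP : (mu kx < mu 1)%N <-> kx = 2%N.
  case: kxE => e; first by rewrite e ltnn; split=> // /esym.
  split=> // _; rewrite ltn_neqAle xa andbT; apply/eqP => /(mu_inj _ _ kxm h1).
  by rewrite e.
have ybP : (mu m.-1 < mu ky)%N <-> ky = m.-2.
  case: kyE => e.
    by rewrite e ltnn; split=> // h; move: m2; clear -h; lia.
  split=> // _; rewrite ltn_neqAle yb andbT; apply/eqP => /(mu_inj _ _ h2 kym).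
  by rewrite e; move: m2; clear; lia.
split=> [k|v w].
  have [i im ei] := vertex k; have := (cyc_succ m f fm _ _).1 ei.
  move=> ei'; rewrite ei ei'; have [i0|i0] := posnP i.
    by exists None, (Some (mu 1%N)); rewrite i0 f0 fq//; split=> //; apply/Or31/or_introl.
  have [i1|i1] := eqVneq i m.-1.
    exists (Some (mu m.-1)), None; rewrite i1 fm1 fq//; split=> //.
    exact/Or31/or_intror.
  have hi : (0 < i < m)%N by rewrite i0.
  have hi' : (0 < i.+1 < m)%N by clear -i0 i1 im; lia.
  exists (Some (mu i)), (Some (mu i.+1)); rewrite !fq//; split=> //.
  have [ikx|kxi] := ltnP i kx.
    apply/Or32/or_introl; have e1 : i = 1%N by case: kxE ikx i0 => ->; clear; lia.
    have e2 : kx = 2%N by case: kxE ikx i0 => ->; clear; lia.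
    by split; [exact/xaP | rewrite e1 | rewrite e1 e2].
  have [iky|kyi] := ltnP i ky.
    apply: Or33; exists (mu 1%N + (i - kx))%N.
      by move: len ab; clear -kxi iky; lia.
    have [] := shape (mu 1%N + (i - kx))%N.
      by move: len ab; clear -kxi iky; lia.
    by rewrite addKn subnKC// => <- <-.
  apply/Or32/or_intror; have e1 : ky = m.-2 /\ i = m.-2.
    by case: kyE => e; move: kyi; rewrite e; clear -i1 im; lia.
  case: e1 => e1 e2; split; [exact/ybP | by rewrite e2 e1 |].
  by rewrite e2; congr (Some (mu _)); clear -m2; lia.
case=> [[[-> ->]|[-> ->]]|[[lt -> ->]|[lt -> ->]]|[g gab [-> ->]]].
- by exists 0%N; rewrite f0 fq.
- by exists m.-1; rewrite fm1 fq.
- exists 1%N; move/xaP: lt => e; rewrite e !fq//; clear -m2; lia.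
- exists ky; move/ybP: lt => e; rewrite !fq//; last by rewrite e; clear -m2; lia.
  by split=> //=; congr (q (mu _)); rewrite e; clear -m2; lia.
- have [<- <-] := shape g gab; exists (kx + (g - mu 1%N))%N.
  have h : (kx + (g - mu 1%N) < ky)%N by move: len gab; clear -order; lia.
  by rewrite !fq//; move: h; clear -kxm kym; lia.
Qed.

End Corners.
End FanCase.

Section Faces.
Context {R : realType}.
Implicit Types (z : (R * R)%type) (P : set (R * R)) (f : nat -> R * R) (c : cell).
Variables (n : nat) (q : nat -> R * R) (p : R * R).
Hypothesis hc : chain n q p.
Hypothesis gp : general_position (chain_set n q p).
Local Notation A := (chain_set n q p).

Lemma ex_argmin m (h : nat -> nat) : (1 < m)%N ->
  exists2 k, (0 < k < m)%N & forall j, (0 < j < m)%N -> (h k <= h j)%N.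
Proof.
move=> m1; have ex : exists x, has (fun k => h k == x) (iota 1 m.-1).
  by exists (h 1%N); apply/hasP; exists 1%N => //; rewrite mem_iota; lia.
case: (ex_minnP ex) => x /hasP[k]; rewrite mem_iota => km /eqP kx xmin.
exists k; first by lia.
by move=> j jm; rewrite kx; apply: xmin; apply/hasP; exists j => //; rewrite mem_iota; lia.
Qed.

Lemma ex_argmax m (h : nat -> nat) N : (1 < m)%N ->
  (forall j, (0 < j < m)%N -> (h j <= N)%N) ->
  exists2 k, (0 < k < m)%N & forall j, (0 < j < m)%N -> (h j <= h k)%N.
Proof.
move=> m1 hN; have [k km kmin] := ex_argmin m (fun j => N - h j)%N m1.
exists k => // j jm; have := kmin j jm; have := hN j jm; have := hN k km; lia.
Qed.

(** If the tip is a vertex, the path is shifted to start there; the other two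
    corners are then the first and the last point of the chain that it visits. *)
Theorem face_classification P m f : pseudo_triangle P -> polygon m f P ->
  (forall k, A (f k)) -> (forall z, A z -> ~ P° z) ->
  exists c m' f', [/\ valid_cell n c, ccw_polygon m' f' P & traces q p f' c].
Proof.
move=> /pseudo_triangle_ccw[m1 [g [gP c3]]] fP fA empty.
have gA k : A (g k).
  by have [gP' _] := gP; have [i <-] := vertex_unique m f m1 g P fP gP' k.
have [[k0 gk0]|np] := pselect (exists k, g k = p); last first.
  have gq k : exists2 i, (i <= n)%N & g k = q i.
    by case: (gA k) => [e|[i /= il e]]; [case: np; exists k | exists i].
  by have [c cv ct] := tri_case n q p hc m1 g P gP gq c3; exists c, m1, g.
have [hP hc3] := ccw_shift m1 g P k0 gP; rewrite -hc3 in c3.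
have [[hm Ph] hl] := hP; set h := (fun k => g (k + k0)%N) in hP hm Ph hl c3.
have h0 : h 0%N = p by [].
have hA k : A (h k) by exact: gA.
have m2 : (2 < m1)%N by case: hm.
have ex k : exists i, (0 < k < m1)%N -> (i <= n)%N /\ h k = q i.
  have [km|nkm] := boolP (0 < k < m1)%N; last by exists 0%N.
  have := hA k; case=> [e|[i /= il e]]; last by exists i.
  have : h k = h 0%N by rewrite e h0.
  by move/(cyc_eq m1 h hm); rewrite mod0n modn_small => [e'|]; case/andP: km; rewrite ?e'.
have [mu hmu] := choice ex.
have [kx kxm xmin] := ex_argmin m1 mu (ltnW m2).
have [ky kym ymax] := ex_argmax m1 mu n (ltnW m2) (fun k km => (hmu k km).1).
have [cv ct] := fan_traces n q p hc gp m1 h P hm Ph hl h0 empty mu hmu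
  kx ky kxm kym xmin ymax c3.
by eexists; exists m1, h; split; [exact: cv | | exact: ct].
Qed.

End Faces.

(** * Every face of an edge set bounds a pseudo-triangle *)

Section FaceRegion.
Context {R : realType}.
Implicit Types (z : (R * R)%type) (P : set (R * R)) (f : nat -> R * R) (c : cell).
Variables (n : nat) (q : nat -> R * R) (p : R * R).
Hypothesis hc : chain n q p.
Hypothesis gp : general_position (chain_set n q p).
Local Notation A := (chain_set n q p).
Local Notation pos := (pos q p).
Variables (D : nat -> nat -> bool) (S : nat -> bool).
Hypothesis E : edge_set n D S.

Definition drawn (v w : option nat) :=
  (exists i j, D i j /\ ((v = Some i /\ w = Some j) \/ (v = Some j /\ w = Some i))) \/
  (exists2 i, (i <= n)%N & (v = None /\ w = Some i) \/ (v = Some i /\ w = None)).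

Lemma drawn_meet v w v' w' : drawn v w -> drawn v' w' ->
  ~ (v = v' /\ w = w') -> ~ (v = w' /\ w = v') ->
  meet_ends (pos v) (pos w) (pos v') (pos w').
Proof.
have cc i j i' j' : D i j -> D i' j' -> (i, j) <> (i', j') ->
    meet_ends (q i) (q j) (q i') (q j').
  move=> h h' ne; have nc := edge_nocross _ _ _ E.
  apply: (meet_ends_chords n q p hc gp) => //; try exact: (edge_lt _ _ _ E).
    exact: nc.
  exact: nc.
have ct i j k : D i j -> (k <= n)%N -> meet_ends (q i) (q j) p (q k).
  by move=> h kn; apply: (meet_ends_chord_tip n q p hc gp) => //; exact: (edge_lt _ _ _ E).
have tt i j : (i <= n)%N -> (j <= n)%N -> i <> j -> meet_ends p (q i) p (q j).
  by move=> *; apply: (meet_ends_tips n q p hc gp).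
case=> [[i [j [h [[-> ->]|[-> ->]]]]]|[i h [[-> ->]|[-> ->]]]];
case=> [[i' [j' [h' [[-> ->]|[-> ->]]]]]|[i' h' [[-> ->]|[-> ->]]]] n1 n2.
- by apply: cc => // -[e1 e2]; apply: n1; rewrite e1 e2.
- by apply/meet_endsr/cc => // -[e1 e2]; apply: n2; rewrite e1 e2.
- exact: ct.
- exact/meet_endsr/ct.
- by apply/meet_endsl/cc => // -[e1 e2]; apply: n2; rewrite e1 e2.
- by apply/meet_endsl/meet_endsr/cc => // -[e1 e2]; apply: n1; rewrite e1 e2.
- exact/meet_endsl/ct.
- exact/meet_endsl/meet_endsr/ct.
- exact/meet_endsC/ct.
- exact/meet_endsC/meet_endsl/ct.
- by apply: tt => // e; apply: n1; rewrite e.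
- by apply/meet_endsr/tt => // e; apply: n2; rewrite e.
- exact/meet_endsC/meet_endsr/ct.
- exact/meet_endsC/meet_endsl/meet_endsr/ct.
- by apply/meet_endsl/tt => // e; apply: n2; rewrite e.
- by apply/meet_endsl/meet_endsr/tt => // e; apply: n1; rewrite e.
Qed.

Lemma face_valid c : is_face n D S c -> valid_cell n c.
Proof.
have l := edge_lt _ _ _ E; case: c => [i j k [/l ? /l ? _]|x a b y [ab Sa Sb [xa yb] lo]] /=.
  by split; lia.
have bn : (b <= n)%N.
  by case/orP: Sb => [/eqP->//|/(tip_lt _ _ _ E)]; clear; lia.
split=> //.
- by case: xa => [->//|/l]; clear; lia.
- by case: yb => [->//|/l]; clear; lia.
- by case: yb => [->//|/l]; clear; lia.
Qed.

Lemma face_drawn c v w : is_face n D S c -> side_of c v w -> drawn v w.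
Proof.
move=> F; have := face_valid c F; case: c F => [i j k [D1 D2 D3] _|x a b y].
  case=> [[-> ->]|[-> ->]|[-> ->]]; left.
  - by exists i, k; split=> //; left.
  - by exists j, k; split=> //; right.
  - by exists i, j; split=> //; right.
move=> [ab Sa Sb [xa yb] lo] [h1 h2 h3 h4].
case=> [[[-> ->]|[-> ->]]|[[lt -> ->]|[lt -> ->]]|[g gab [-> ->]]].
- by right; exists a; [clear -h2 h3 h4; lia | left].
- by right; exists b; [clear -h3 h4; lia | right].
- left; exists x, a; split; last by right.
  by case: xa => // e; move: lt; rewrite e ltnn.
- left; exists b, y; split; last by right.
  by case: yb => // e; move: lt; rewrite e ltnn.
- by left; exists (fan_left x a g), (fan_right b y g); split; [exact: lo | left].
Qed.

Lemma drawn_on_chain v w : drawn v w -> on_chain n v /\ on_chain n w.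
Proof.
case=> [[i [j [/(edge_lt _ _ _ E) h [[-> ->]|[-> ->]]]]]|[i h [[-> ->]|[-> ->]]]] /=;
  by split=> //; clear -h; lia.
Qed.

Lemma face_cyclic_path c m f : is_face n D S c -> (2 < m)%N ->
  (forall i j, f i = f j <-> i = j %[mod m]) ->
  (forall k, exists v w, [/\ side_of c v w, f k = pos v & f k.+1 = pos w]) ->
  cyclic_path m f.
Proof.
move=> F m2 inj tr.
have ne d k : (0 < d < m)%N -> f k <> f (k + d)%N.
  move=> dm /inj/eqP; rewrite -[X in X == _ %[mod _]]addn0 eqn_modDl.
  by rewrite mod0n modn_small; case/andP: dm => // + _ /eqP e; rewrite -e.
have fA k : A (f k).
  have [v [w [/(face_drawn c v w F)/drawn_on_chain[vn _] -> _]]] := tr k.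
  exact: (pos_in n q p).
split=> //.
  move=> k; apply: gp => //.
  - by rewrite -addn1; apply: ne; clear -m2; lia.
  - by rewrite -addn2; apply: ne; clear -m2; lia.
  - by rewrite -[k.+2]addn1; apply: ne; clear -m2; lia.
move=> i j ij; have [v [w [s1 e1 e2]]] := tr i; have [v' [w' [s2 e3 e4]]] := tr j.
rewrite e1 e2 e3 e4; apply: drawn_meet; try exact: (face_drawn c).
  by move=> [e _]; apply: ij; rewrite e1 e3 e.
move=> [e e']; have h1 : f i = f j.+1 by rewrite e1 e4 e.
have h2 : f i.+1 = f j by rewrite e2 e3 e'.
apply: (ne 2%N j); first by clear -m2; lia.
rewrite addn2 -h2; apply/inj; move/inj: h1 => h1.
by rewrite -[i.+1]addn1 -[j.+2]addn1 -modnDml h1 modnDml.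
Qed.

(** The counterclockwise path of P turns left at an extreme vertex, and one of
    the path and its reverse is counterclockwise. *)
Lemma ccw_of_extreme m f P g k : polygon m f P -> affine g ->
  (forall j, f j <> f k.+1 -> g (f j) < g (f k.+1)) -> 0 < turn f k ->
  ccw_polygon m f P.
Proof.
move=> fP ag hg tk; have [fm Pf] := fP; split=> //.
have [[_ //]|[[hm Ph] hl]] := ccw_or_reverse m f P fP.
have [_ [_ tr]] := cyclic_path_rev m f fm.
have m2 : (2 < m)%N by case: fm.
have [j ej] : exists j, f (j * m.-1)%N = f k.+2.
  exists (k.+2 * m.-1)%N; apply/(cyc_eq m f fm).
  have -> : (k.+2 * m.-1 * m.-1)%N = (k.+2 * (m - 2) * m + k.+2)%N by nia.
  by rewrite modnMDl.
have [i [e1 e2 e3]] := tr j; rewrite e1 in ej.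
have ei1 := (cyc_succ m f fm _ _).2 ej; have ei0 := (cyc_succ m f fm _ _).2 ei1.
have : 0 < turn (fun k => f (k * m.-1)%N) j.
  apply: (extreme_turn m _ P hm Ph hl g) => // l; rewrite e2 ei1; exact: hg.
rewrite /turn e1 e2 e3 ej ei1 ei0 orient_rev oppr_gt0.
by rewrite ltNge (ltW tk).
Qed.

Lemma tri_region i j k : is_face n D S (Tri i j k) ->
  exists m f P, [/\ ccw_polygon m f P, traces q p f (Tri i j k) & pseudo_triangle P].
Proof.
move=> F; have [ijk kn] := face_valid _ F.
pose v r := nth None [:: Some i; Some k; Some j] (r %% 3).
pose f r := pos (v r).
have vn r : on_chain n (v r).
  rewrite /v; have : (r %% 3 < 3)%N by rewrite ltn_mod.
  by case: (r %% 3)%N => [|[|[|//]]] _ /=; clear -ijk kn; lia.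
have inj a b : f a = f b <-> a = b %[mod 3].
  split=> [/(pos_inj n q p hc _ _ (vn a) (vn b))|e]; last by rewrite /f /v e.
  rewrite /v; have : (a %% 3 < 3)%N by rewrite ltn_mod.
  have : (b %% 3 < 3)%N by rewrite ltn_mod.
  by case: (a %% 3)%N => [|[|[|//]]]; case: (b %% 3)%N => [|[|[|//]]] //= _ _ [e];
    exfalso; clear -e ijk; lia.
have fS r : f r.+1 = pos (nth None [:: Some i; Some k; Some j] ((r %% 3).+1 %% 3)).
  by rewrite /f /v -[(r %% 3).+1]addn1 modnDml addn1.
have fm : cyclic_path 3 f.
  apply: (face_cyclic_path (Tri i j k)) => // r; rewrite fS /f /v.
  have : (r %% 3 < 3)%N by rewrite ltn_mod.
  case: (r %% 3)%N => [|[|[|//]]] _ /=.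
  - by exists (Some i), (Some k); split=> //; apply: Or31.
  - by exists (Some k), (Some j); split=> //; apply: Or32.
  - by exists (Some j), (Some i); split=> //; apply: Or33.
have tr : traces q p f (Tri i j k) by apply: (tri_traces q p 3 f i j k 0).
have [P Pf] := cyclic_path_bounds 3 f fm.
have t0 : 0 < orient (q i) (q k) (q j) by exact: (chord_in n q p hc).
have [g [ag hg]] := extreme_right n q p hc i k ltac:(clear -ijk kn; lia).
have fP : ccw_polygon 3 f P.
  apply: (ccw_of_extreme 3 f P g 0) => // r.
  rewrite /f => ne; apply: hg.
    rewrite /v; have : (r %% 3 < 3)%N by rewrite ltn_mod.
    by case: (r %% 3)%N => [|[|[|//]]] _ /=; clear -ijk kn; lia.
  by apply/eqP => e; apply: ne; rewrite e.
have [[_ _] fl] := fP.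
have conv r : (r < 3)%N -> convex_points f P (f r.+1).
  move=> r3; exists r => //; apply/(convex_atP 3 f P fm Pf fl).
  case: r r3 => [|[|[|//]]] _ //; rewrite /turn /f /v /=.
    by rewrite orient_cyc.
  by rewrite -orient_cyc.
exists 3, f, P; split=> //; apply: (ccw_pseudo_triangle 3 f) => //.
apply: (card3_eq _ _ (f 1%N) (f 2%N) (f 3%N)); try exact: conv;
  try by apply/eqP => /inj.
move=> z [r _ ->]; have : (r %% 3 < 3)%N by rewrite ltn_mod.
have e s : (r %% 3 = s %% 3)%N -> f r.+1 = f s.+1.
  by move=> e; apply: (cyc_succ 3 f fm _ _).1; exact/inj.
case er : (r %% 3)%N => [|[|[|//]]] _.
- by apply: Or31; apply: e.
- by apply: Or32; apply: e.
- by apply: Or33; apply: e.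
Qed.

Section Fan.
Variables (x a b y : nat).
Hypothesis F : is_face n D S (Fan x a b y).

Let valid : [/\ (x <= a)%N, (a < b)%N, (b <= y)%N & (y <= n)%N].
Proof. exact: (face_valid _ F). Qed.

(** The boundary path starts at the tip, reaches x at the index fan_x and y
    at the index fan_y. *)
Definition fan_x := if (x < a)%N then 2%N else 1%N.
Definition fan_y := (fan_x + (b - a))%N.
Definition fan_size := if (b < y)%N then fan_y.+2 else fan_y.+1.

Definition fan_index r :=
  if (r < fan_x)%N then a else if (fan_y < r)%N then b
  else if r == fan_x then x else if r == fan_y then y else (a + (r - fan_x))%N.

Definition fan_vertex r := let s := (r %% fan_size)%N in
  if s == 0%N then None else Some (fan_index s).

Let f r := pos (fan_vertex r).

Let size_gt2 : (2 < fan_size)%N.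
Proof.
move: valid; rewrite /fan_size /fan_y /fan_x => -[h1 h2 h3 h4].
by case: ifP => _; case: ifP => _; clear -h2; lia.
Qed.

Let fan_inj r s : (0 < r < fan_size)%N -> (0 < s < fan_size)%N ->
  fan_index r = fan_index s -> r = s.
Proof.
move: valid; rewrite /fan_index /fan_size /fan_y /fan_x => -[h1 h2 h3 h4].
case xa: (x < a)%N; case yb: (b < y)%N => hr hs;
  by repeat case: ifP; clear -h1 h2 h3 xa yb hr hs; lia.
Qed.

Let index_le r : (fan_index r <= n)%N.
Proof.
move: valid; rewrite /fan_index /fan_y => -[h1 h2 h3 h4].
by repeat case: ifP; clear -h1 h2 h3 h4; lia.
Qed.

Let vn r : on_chain n (fan_vertex r).
Proof. by rewrite /fan_vertex; case: ifP => //= _; exact: index_le. Qed.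

Let inj r s : f r = f s <-> r = s %[mod fan_size].
Proof.
split=> [/(pos_inj n q p hc _ _ (vn r) (vn s))|e]; last by rewrite /f /fan_vertex e.
have rm : (r %% fan_size < fan_size)%N by rewrite ltn_mod (ltn_trans _ size_gt2).
have sm : (s %% fan_size < fan_size)%N by rewrite ltn_mod (ltn_trans _ size_gt2).
rewrite /fan_vertex; case: eqP => r0; case: eqP => s0 //; first by rewrite r0 s0.
by case=> /fan_inj; apply; rewrite ?rm ?sm andbT lt0n; apply/eqP.
Qed.

Let f_small r : (0 < r < fan_size)%N -> f r = q (fan_index r).
Proof.
move=> /andP[r0 rm]; rewrite /f /fan_vertex modn_small//.
by rewrite eqn0Ngt r0.
Qed.

Let f0 : f 0%N = p. Proof. by rewrite /f /fan_vertex mod0n eqxx. Qed.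

Let f_size : f fan_size = p. Proof. by rewrite /f /fan_vertex modnn eqxx. Qed.

Let index_first : fan_index 1 = a.
Proof.
move: valid; rewrite /fan_index /fan_y /fan_x => -[h1 h2 h3 h4].
by case xa: (x < a)%N => /=; repeat case: ifP; clear -h1 h2 h3 xa; lia.
Qed.

Let index_last : fan_index fan_size.-1 = b.
Proof.
move: valid; rewrite /fan_index /fan_size /fan_y /fan_x => -[h1 h2 h3 h4].
by case yb: (b < y)%N; case xa: (x < a)%N; repeat case: ifP; clear -h1 h2 h3 xa yb; lia.
Qed.

Let index_lower g : (a <= g < b)%N ->
  fan_index (fan_x + (g - a)) = fan_left x a g /\
  fan_index (fan_x + (g - a)).+1 = fan_right b y g.
Proof.
move: valid; rewrite /fan_index /fan_left /fan_right /fan_y => -[h1 h2 h3 h4] gab.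
by split; repeat case: ifP; clear -h1 h2 h3 gab; lia.
Qed.

Let fan_trace : traces q p f (Fan x a b y).
Proof.
have [h1 h2 h3 h4] := valid.
have sz1 : (0 < 1 < fan_size)%N by clear -size_gt2; lia.
have sz2 : (0 < fan_size.-1 < fan_size)%N by clear -size_gt2; lia.
have last : f fan_size.-1.+1 = p by rewrite prednK//; clear -size_gt2; lia.
have xE : (x < a)%N -> fan_x = 2%N by rewrite /fan_x => ->.
have xE' : (x < a)%N = false -> fan_x = 1%N by rewrite /fan_x => ->.
have yE : (b < y)%N -> fan_size = fan_y.+2 by rewrite /fan_size => ->.
have yE' : (b < y)%N = false -> fan_size = fan_y.+1 by rewrite /fan_size => ->.
have lenE : fan_y = (fan_x + (b - a))%N by [].
have ix : fan_index fan_x = x.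
  have [e _] := index_lower a ltac:(clear -h2; lia).
  by move: e; rewrite subnn addn0 /fan_left eqxx.
have iy : fan_index fan_y = y.
  have [_ e] := index_lower b.-1 ltac:(clear -h2; lia).
  move: e; rewrite /fan_right prednK ?eqxx; last by clear -h2; lia.
  by move=> <-; congr fan_index; rewrite lenE; clear -h2; lia.
split=> [r|v w].
  have rm : (r %% fan_size < fan_size)%N by rewrite ltn_mod; clear -size_gt2; lia.
  have er : f r = f (r %% fan_size) by apply/inj; rewrite modn_mod.
  have er' : f r.+1 = f (r %% fan_size).+1.
    by apply/inj; rewrite -[(r %% _).+1]addn1 modnDml addn1.
  rewrite er er'; move: (r %% fan_size)%N rm => i im {er er'}.
  have [i0|i0] := posnP i.
    exists None, (Some a); rewrite i0 f0 f_small// index_first; split=> //.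
    exact/Or31/or_introl.
  have [i1|i1] := eqVneq i fan_size.-1.
    exists (Some b), None; rewrite i1 last f_small// index_last; split=> //.
    exact/Or31/or_intror.
  have hi : (0 < i < fan_size)%N by rewrite i0.
  have hi' : (0 < i.+1 < fan_size)%N by clear -i0 i1 im; lia.
  exists (Some (fan_index i)), (Some (fan_index i.+1)).
  rewrite !f_small//; split=> //.
  have [ikx|kxi] := ltnP i fan_x.
    apply/Or32/or_introl; case xa : (x < a)%N; last first.
      by move: ikx; rewrite (xE' xa); clear -i0; lia.
    have e2 := xE xa; have e1 : i = 1%N by move: ikx; rewrite e2; clear -i0; lia.
    by rewrite e1 index_first -[2%N]e2 ix.
  have [iky|kyi] := ltnP i fan_y.
    apply: Or33; exists (a + (i - fan_x))%N; first by clear -kxi iky lenE; lia.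
    have [] := index_lower (a + (i - fan_x)) ltac:(clear -kxi iky lenE; lia).
    by rewrite addKn subnKC// => -> ->.
  apply/Or32/or_intror; case yb : (b < y)%N; last first.
    by move: i1 im; rewrite (yE' yb) /=; clear -kyi; lia.
  have e1 := yE yb; have e2 : i = fan_y by move: i1 im; rewrite e1 /=; clear -kyi; lia.
  by rewrite e2 iy; split=> //; rewrite -index_last e1.
case=> [[[-> ->]|[-> ->]]|[[lt -> ->]|[lt -> ->]]|[g gab [-> ->]]].
- by exists 0%N; rewrite f0 f_small// index_first.
- by exists fan_size.-1; rewrite last f_small// index_last.
- exists 1%N; have e := xE lt.
  have h : (0 < 2 < fan_size)%N by rewrite size_gt2.
  by rewrite !f_small// index_first -e ix.
- exists fan_y; have e := yE lt.
  have k1 : (0 < fan_y < fan_size)%N by rewrite e lenE; clear -h2; lia.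
  have k2 : (0 < fan_y.+1 < fan_size)%N by rewrite e; clear; lia.
  by rewrite !f_small// iy -index_last e.
- have [<- <-] := index_lower g gab; exists (fan_x + (g - a))%N.
  have xpos : (0 < fan_x)%N by rewrite /fan_x; case: ifP.
  have szy : (fan_y < fan_size)%N by rewrite /fan_size; case: ifP.
  by rewrite !f_small//; clear -xpos szy lenE gab; lia.
Qed.

Lemma fan_region : exists m f P,
  [/\ ccw_polygon m f P, traces q p f (Fan x a b y) & pseudo_triangle P].
Proof.
have [h1 h2 h3 h4] := valid.
have fm : cyclic_path fan_size f.
  by apply: (face_cyclic_path (Fan x a b y)) => //; case: fan_trace.
have [P Pf] := cyclic_path_bounds fan_size f fm.
exists fan_size, f, P.
have xE : fan_x = 2%N /\ (x < a)%N \/ fan_x = 1%N /\ x = a.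
  by rewrite /fan_x; case: ifP => h; [left|right]; split=> //; clear -h h1; lia.
have yE : fan_size = fan_y.+2 /\ (b < y)%N \/ fan_size = fan_y.+1 /\ y = b.
  by rewrite /fan_size; case: ifP => h; [left|right]; split=> //; clear -h h3; lia.
have lenE : fan_y = (fan_x + (b - a))%N by [].
have sz1 : (0 < 1 < fan_size)%N by clear -size_gt2; lia.
have sz2 : (0 < fan_size.-1 < fan_size)%N by clear -size_gt2; lia.
have last : f fan_size.-1.+1 = p by rewrite prednK//; clear -size_gt2; lia.
have last2 : f fan_size.-1.+2 = q a.
  rewrite -index_first -f_small//; apply: (cyc_succ _ f fm _ _).1.
  by rewrite last f0.
have ix : fan_index fan_x = x.
  have [e _] := index_lower a ltac:(clear -h2; lia).
  by move: e; rewrite subnn addn0 /fan_left eqxx.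
have iy : fan_index fan_y = y.
  have [_ e] := index_lower b.-1 ltac:(clear -h2; lia).
  move: e; rewrite /fan_right prednK ?eqxx; last by clear -h2; lia.
  by move=> <-; congr fan_index; rewrite lenE; clear -h2; lia.
have rx : (0 < fan_x < fan_size)%N by clear -xE yE lenE h2; lia.
have ry : (0 < fan_y < fan_size)%N by clear -xE yE lenE h2; lia.
have tip_turn : 0 < turn f fan_size.-1.
  rewrite /turn last last2 f_small// index_last -orient_cyc.
  by apply: (tip_pos n q p hc); clear -h2 h3 h4; lia.
have fP : ccw_polygon fan_size f P.
  have [g [ag hg]] := extreme_tip n q p hc.
  apply: (ccw_of_extreme fan_size f P g fan_size.-1) => // r.
  rewrite last => ne; apply: (hg _ (vn r)).
  by apply/eqP => e; apply: ne; rewrite /f e.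
have [_ fl] := fP.
have cp : convex_points f P p.
  by exists fan_size.-1; rewrite ?last//; apply/(convex_atP fan_size f P fm Pf fl).
have range r : tip_and x y (fan_vertex r).
  rewrite /fan_vertex /fan_index; case: ifP => //= _.
  by repeat case: ifP; clear -h1 h2 h3 lenE; lia.
have corner_convex r i : (0 < r < fan_size)%N -> fan_index r = i ->
    extreme q p (tip_and x y) (Some i) -> convex_points f P (q i).
  move=> rm ri [g [ag hg]]; have rK : r.-1.+1 = r by rewrite prednK//; case/andP: rm.
  exists r.-1; last by rewrite rK f_small// ri.
  apply/(convex_atP fan_size f P fm Pf fl); apply: (extreme_turn fan_size f P fm Pf fl g) => // s.
  rewrite rK (f_small r rm) ri => ne; apply: (hg _ (range s)).
  by apply/eqP => e; apply: ne; rewrite /f e.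
have xyn : (x < y <= n)%N by clear -h1 h2 h3 h4; lia.
have cx := corner_convex _ _ rx ix (extreme_left n q p hc x y xyn).
have cy := corner_convex _ _ ry iy (extreme_right n q p hc x y xyn).
split=> //.
apply: (ccw_pseudo_triangle fan_size f P) => //.
have xn : (x <= n)%N by clear -xyn; lia.
apply: (card3_eq _ _ p (q x) (q y)) => //.
- by apply/eqP/nesym/(tip_neq n q p hc).
- by apply/eqP/nesym/(tip_neq n q p hc).
- by apply/eqP/(chord_neq n q p hc).
move=> z [r cr ->]; move/(convex_atP fan_size f P fm Pf fl): cr => tr.
have rm : (r.+1 %% fan_size < fan_size)%N by rewrite ltn_mod; clear -size_gt2; lia.
have er : f r.+1 = f (r.+1 %% fan_size) by apply/inj; rewrite modn_mod.
rewrite er; have [s0|s0] := posnP (r.+1 %% fan_size).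
  by rewrite s0 f0; exact: Or31.
have hs : (0 < r.+1 %% fan_size < fan_size)%N by rewrite s0.
have [sx|sx] := eqVneq (r.+1 %% fan_size)%N fan_x.
  by rewrite sx f_small// ix; exact: Or32.
have [sy|sy] := eqVneq (r.+1 %% fan_size)%N fan_y.
  by rewrite sy f_small// iy; exact: Or33.
exfalso; move: tr; rewrite /turn er.
have sK : (r.+1 %% fan_size).-1.+1 = (r.+1 %% fan_size)%N by rewrite prednK.
have er0 : f r = f (r.+1 %% fan_size).-1 by apply: (cyc_succ _ f fm _ _).2; rewrite sK.
have er2 : f r.+2 = f (r.+1 %% fan_size).+1 by apply: (cyc_succ _ f fm _ _).1.
rewrite er0 er2; move: (r.+1 %% fan_size)%N hs sx sy {rm er er0 er2 s0 sK} => s hs sx sy.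
suff : orient (f s.-1) (f s) (f s.+1) < 0 by move=> h1' h2'; have := lt_trans h1' h2'; rewrite ltxx.
have [lo|lo] := ltnP s fan_x.
  have e : s = 1%N by clear -xE lo hs; lia.
  have ex : fan_x = 2%N /\ (x < a)%N by clear -xE lo e; lia.
  case: ex => ex xa; rewrite e /= f0 f_small// index_first -[2%N]ex f_small// ix.
  by apply: (tip_neg n q p hc); clear -xa h2 h3 h4; lia.
have [hi|hi] := ltnP fan_y s.
  have ey : fan_size = fan_y.+2 /\ (b < y)%N by clear -yE hi hs; lia.
  case: ey => ey yb; have e : s = fan_size.-1 by clear -ey hi hs; lia.
  have e' : s.-1 = fan_y by clear -ey e; lia.
  rewrite e' f_small// iy e last f_small// index_last orient_cyc.
  by apply: (tip_neg n q p hc); clear -yb h4; lia.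
have hs1 : (0 < s.-1 < fan_size)%N by clear -hs lo sx xE; lia.
have hs2 : (0 < s.+1 < fan_size)%N by clear -hs hi sy yE; lia.
rewrite !f_small//; case: hc => _ C1 _; apply: C1; last exact: index_le.
have lo' : (fan_x < s)%N by clear -lo sx; lia.
have hi' : (s < fan_y)%N by clear -hi sy; lia.
have [i1 i2] := index_lower (a + (s - fan_x)) ltac:(clear -lo' hi' lenE; lia).
have [i3 i4] := index_lower (a + (s - fan_x)).-1 ltac:(clear -lo' hi' lenE; lia).
have j1 : (fan_x + (a + (s - fan_x) - a))%N = s by clear -lo'; lia.
have j2 : (fan_x + ((a + (s - fan_x)).-1 - a))%N = s.-1 by clear -lo'; lia.
rewrite j1 in i1 i2; rewrite j2 in i3; rewrite i1 i2 i3 /fan_left /fan_right.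
by repeat case: eqP; clear -lo' hi' lenE h1 h2 h3; lia.
Qed.

End Fan.

Theorem face_region c : is_face n D S c ->
  exists m f P, [/\ ccw_polygon m f P, traces q p f c & pseudo_triangle P].
Proof.
by case: c => [i j k|x a b y] F; [exact: tri_region | exact: fan_region].
Qed.

End FaceRegion.

(** * Seeing a face from the tip *)

Section Rays.
Context {R : realType}.
Implicit Types (a b d i p z w : (R * R)%type) (s t r : R).

Lemma orient_cramer p a b i z : orient p a b * orient p i z =
  - orient p b z * orient p i a + orient p a z * orient p i b.
Proof. by coords; ring. Qed.

(** Points beyond z on the ray from the tip. *)
Definition ray p z t : R * R := z + t *: (z - p).

Lemma ray_tip p z t i : orient p i (ray p z t) = (1 + t) * orient p i z.
Proof. by rewrite /ray; coords; ring. Qed.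

Lemma ray_orient p a b z t :
  orient a b (ray p z t) = (1 + t) * orient a b z - t * orient a b p.
Proof. by rewrite /ray; coords; ring. Qed.

Lemma ray_lerp p z s t r :
  lerp (ray p z s) (ray p z t) r = ray p z ((1 - r) * s + r * t).
Proof. by rewrite /lerp /ray; apply: pt_ext; coords; ring. Qed.

Lemma orient_height p a b z :
  orient a b z = orient a b p - orient p a z + orient p b z.
Proof. by coords; ring. Qed.

Lemma on_segment p a b w :
  orient a b w = 0 -> 0 < orient p a w -> orient p b w < 0 ->
  exists2 s, 0 < s < 1 & w = lerp a b s.
Proof.
move=> o0 oa ob.
have sum : orient p a b = orient p a w - orient p b w.
  have -> : orient p a b = orient a b w + orient p a w - orient p b w.
    by clear; coords; ring.
  by rewrite o0 add0r.
have d0 : 0 < orient p a b by rewrite sum; lra.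
exists (orient p a w / orient p a b).
  by rewrite divr_gt0//= ltr_pdivrMr// mul1r sum; lra.
have e1 : orient p a b * w.1 =
    orient a b w * p.1 - orient p b w * a.1 + orient p a w * b.1.
  by clear; coords; ring.
have e2 : orient p a b * w.2 =
    orient a b w * p.2 - orient p b w * a.2 + orient p a w * b.2.
  by clear; coords; ring.
have ob' : orient p b w = orient p a w - orient p a b by rewrite sum; ring.
rewrite o0 ob' in e1 e2; have d1 := lt0r_neq0 d0.
move: (orient p a b) (orient p a w) d1 e1 e2; clear; move=> d k d1 e1 e2.
apply: pt_ext; apply: (mulfI d1); rewrite ?e1 ?e2 lerpE; clear e1 e2.
  by coords; field.
by coords; field.
Qed.

Lemma ray_sign (x y s t : R) : 0 < x -> 0 <= s <= t ->
  0 < (1 + t) * x - t * y -> 0 < (1 + s) * x - s * y.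
Proof.
move=> x0 /andP[s0 st] h; have [xy|yx] := leP y x; first nra.
have : s * (y - x) <= t * (y - x) by rewrite ler_pM2r// subr_gt0.
lra.
Qed.

End Rays.

Section Columns.
Context {R : realType}.
Implicit Types (z w : (R * R)%type) (P U : set (R * R)) (f : nat -> R * R) (c : cell)
  (s t : R).
Variables (n : nat) (q : nat -> R * R) (p : R * R).
Hypothesis hc : chain n q p.
Hypothesis gp : general_position (chain_set n q p).
Local Notation A := (chain_set n q p).
Local Notation pos := (pos q p).

(** The ray from the tip to z passes strictly between q g and q (g + 1). *)
Definition column g z := 0 < orient p (q g) z /\ orient p (q g.+1) z < 0.

Definition generic z := (forall i, (i <= n)%N -> orient p (q i) z != 0) /\
  (forall i j, (i < j <= n)%N -> orient (q i) (q j) z != 0).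

Definition above i j z := 0 < orient (q i) (q j) z.

Lemma column_left g z i : (g < n)%N -> column g z -> (i <= g)%N ->
  0 < orient p (q i) z.
Proof.
move=> gn [h1 h2] ig; have [->//|ne] := eqVneq i g.
have i1 := tip_pos n q p hc i g ltac:(clear -ig ne gn; lia).
have i2 := tip_pos n q p hc i g.+1 ltac:(clear -ig gn; lia).
have i3 := tip_pos n q p hc g g.+1 ltac:(clear -gn; lia).
have e := orient_cramer p (q g) (q g.+1) (q i) z.
have : 0 < orient p (q g) (q g.+1) * orient p (q i) z.
  by rewrite e addr_gt0// mulr_gt0// oppr_gt0.
by rewrite pmulr_rgt0.
Qed.

Lemma column_right g z i : (g < i)%N -> (i <= n)%N -> column g z ->
  orient p (q i) z < 0.
Proof.
move=> gi iln [h1 h2]; have [->//|ne] := eqVneq i g.+1.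
have i1 := tip_pos n q p hc g i ltac:(clear -gi iln; lia).
have i2 := tip_pos n q p hc g.+1 i ltac:(clear -gi ne iln; lia).
have i3 := tip_pos n q p hc g g.+1 ltac:(clear -gi iln; lia).
have e := orient_cramer p (q g) (q g.+1) (q i) z.
rewrite (orient_flip p (q g) (q i)) (orient_flip p (q g.+1) (q i)) in e.
have : 0 < orient p (q g) (q g.+1) * - orient p (q i) z.
  rewrite mulrN e opprD -mulrN opprK -mulrN opprK.
  by rewrite addr_gt0// mulr_gt0// oppr_gt0.
by rewrite pmulr_rgt0// oppr_gt0.
Qed.

Lemma column_over g z i j : (g < n)%N -> column g z -> (i <= n)%N -> (j <= n)%N ->
  0 < orient p (q i) z -> orient p (q j) z < 0 -> (i <= g < j)%N.
Proof.
move=> gn cz iln jn oi oj; apply/andP; split.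
  rewrite leqNgt; apply/negP => gi.
  by have := column_right g z i gi iln cz; rewrite ltNge (ltW oi).
rewrite ltnNge; apply/negP => jg.
by have := column_left g z j gn cz jg; rewrite ltNge (ltW oj).
Qed.

Lemma ex_column z : generic z -> 0 < orient p (q 0%N) z -> orient p (q n) z < 0 ->
  exists2 g, (g < n)%N & column g z.
Proof.
move=> [gz _] o0 on.
have ex : exists g, (g <= n)%N && (0 < orient p (q g) z) by exists 0%N.
have ub g : (g <= n)%N && (0 < orient p (q g) z) -> (g <= n)%N by case/andP.
case: (ex_maxnP ex ub) => g /andP[gn og] gmax.
have gn' : (g < n)%N.
  rewrite ltn_neqAle gn andbT; apply/eqP => e.
  by move: og; rewrite e ltNge (ltW on).
exists g => //; split=> //; rewrite lt_neqAle gz//= leNgt; apply/negP => og1.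
by have := gmax g.+1; rewrite og1 gn' ltnn => /(_ isT).
Qed.

Lemma above_mono g z u v u' v' : (g < n)%N -> column g z ->
  (u <= u' <= g)%N -> (g < v' <= v)%N -> (v <= n)%N ->
  above u' v' z -> above u v z.
Proof.
move=> gn cz uu' vv' vn ab.
have t0 := tip_pos n q p hc u' v' ltac:(clear -uu' vv' vn; lia).
have t1 := chord_tip n q p hc u v ltac:(clear -uu' vv' vn; lia).
have c1 := chord_ge0 n q p hc u v u' ltac:(clear -uu' vv'; lia) vn.
have c2 := chord_ge0 n q p hc u v v' ltac:(clear -uu' vv'; lia) vn.
have o1 := column_left g z u' gn cz ltac:(clear -uu'; lia).
have o2 := column_right g z v' ltac:(clear -vv'; lia) ltac:(clear -vv' vn; lia) cz.
have e := orient_bary p (q u') (q v') (q u) (q v) z.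
have : 0 < orient p (q u') (q v') * orient (q u) (q v) z.
  rewrite e (_ : orient (q v') p z = - orient p (q v') z); last exact: orient_swap.
  have := mulr_gt0 ab t1.
  have := mulr_ge0 (ltW o1) c2.
  have : 0 <= - orient p (q v') z * orient (q u) (q v) (q u') by rewrite mulr_ge0// oppr_ge0 ltW.
  by lra.
by rewrite pmulr_rgt0.
Qed.

Local Notation ray := (ray p).

Lemma column_ray g z t : 0 <= t -> column g z -> column g (ray z t).
Proof.
by move=> t0 [h1 h2]; rewrite /column !ray_tip; split; [nra | nra].
Qed.

Lemma column_height g z i j : (g < n)%N -> column g z -> (i <= g < j)%N -> (j <= n)%N ->
  orient (q i) (q j) z < orient (q i) (q j) p.
Proof.
move=> gn cz igj jn.
have o1 := column_left g z i gn cz ltac:(clear -igj; lia).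
have o2 := column_right g z j ltac:(clear -igj; lia) jn cz.
by rewrite (orient_height p); lra.
Qed.

Lemma column_segment g z i j : (g < n)%N -> column g z -> (i < j <= n)%N ->
  segment (q i) (q j) z -> (i <= g < j)%N.
Proof.
move=> gn cz ij sz; have h := tip_pos n q p hc i j ij.
move: (sz) => /segmentP[t t01 ez].
have o1 : orient p (q i) z = t * orient p (q i) (q j).
  by rewrite ez orient_lerp orient_abb; ring.
have o2 : orient p (q j) z = - (1 - t) * orient p (q i) (q j).
  by rewrite ez orient_lerp orient_abb orient_flip; ring.
have iln : (i <= n)%N by clear -ij; lia.
apply: (column_over g z) => //; first by clear -ij; lia.
  rewrite lt_neqAle; apply/andP; split; last first.
    by rewrite o1; apply: mulr_ge0; [case/andP: t01 | exact: ltW].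
  apply/eqP => e; have [ig|gi] := leqP i g.
    by have := column_left g z i gn cz ig; rewrite -e ltxx.
  by have := column_right g z i gi iln cz; rewrite -e ltxx.
have jn : (j <= n)%N by clear -ij; lia.
rewrite lt_neqAle; apply/andP; split; last by rewrite o2; case/andP: t01 => *; nra.
apply/eqP => e; have [jg|gj] := leqP j g.
  by have := column_left g z j gn cz jg; rewrite e ltxx.
by have := column_right g z j gj jn cz; rewrite e ltxx.
Qed.

Lemma column_off_tip g z i : (g < n)%N -> column g z -> (i <= n)%N ->
  ~ segment p (q i) z.
Proof.
move=> gn cz iln /segment_orient0 e; have [ig|gi] := leqP i g.
  by have := column_left g z i gn cz ig; rewrite e ltxx.
by have := column_right g z i gi iln cz; rewrite e ltxx.
Qed.

Definition chain_side f i j := exists k,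
  (f k = q i /\ f k.+1 = q j) \/ (f k = q j /\ f k.+1 = q i).

Definition chain_path f := forall k,
  (exists i j, (i < j <= n)%N /\ ((f k = q i /\ f k.+1 = q j) \/ (f k = q j /\ f k.+1 = q i))) \/
  (exists2 i, (i <= n)%N & (f k = p /\ f k.+1 = q i) \/ (f k = q i /\ f k.+1 = p)).

Lemma column_sides f g z : chain_path f -> (g < n)%N -> column g z -> sides f z ->
  exists i j, [/\ (i <= g < j)%N, (j <= n)%N, chain_side f i j & orient (q i) (q j) z = 0].
Proof.
move=> fp gn cz [k sk].
case: (fp k) => [[i [j [ij h]]]|[i iln h]].
  have sz : segment (q i) (q j) z.
    by case: h sk => -[-> ->] //; rewrite segmentC.
  have h1 := column_segment g z i j gn cz ij sz.
  exists i, j; split=> //; first by clear -ij; lia.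
    by exists k.
  exact: segment_orient0.
case: (column_off_tip g z i gn cz iln).
by case: h sk => -[-> ->] //; rewrite segmentC.
Qed.

Section Region.
Variables (m : nat) (f : nat -> R * R) (P : set (R * R)).
Hypotheses (fm : cyclic_path m f) (Pf : bounded_by f P) (fp : chain_path f).

(** The ray that leads away from the tip meets no side, and leaves the region
    because the latter is bounded. *)
Lemma region_below g z : (g < n)%N -> column g z ->
  (forall i j, (i <= g < j)%N -> (j <= n)%N -> chain_side f i j ->
    orient (q i) (q j) z < 0) -> ~ P z.
Proof.
move=> gn cz hz Pz.
pose C := [set y | exists2 t, 0 <= t & y = ray z t].
have cC : cvx C.
  move=> _ _ r [s s0 ->] [t t0 ->] /andP[r0 r1]; exists ((1 - r) * s + r * t).
    by rewrite addr_ge0// mulr_ge0//; lra.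
  exact: ray_lerp.
have dC y : C y -> ~ sides f y.
  move=> [t t0 ->] /(column_sides f g (ray z t) fp gn (column_ray g z t t0 cz)).
  move=> [i [j [igj jn ij]]]; rewrite ray_orient.
  have := hz i j igj jn ij; have := chord_tip n q p hc i j ltac:(clear -igj jn; lia).
  by nra.
apply: (ray_leaves f P Pf z (z - p)).
  rewrite subr_eq0; apply/eqP => e; case: cz => + _.
  by rewrite e orient_aba ltxx.
move=> t t0; apply: (cvx_region f P Pf C cC dC z) => //; last by exists t.
by exists 0 => //; rewrite /ray scale0r addr0.
Qed.

(** Following the ray across the first side that it meets changes sides of
    the boundary once. *)
Lemma region_flip g z i j : (g < n)%N -> column g z -> (i <= g < j)%N -> (j <= n)%N ->
  chain_side f i j -> above i j z ->
  (forall i' j', (i' <= g < j')%N -> (j' <= n)%N -> chain_side f i' j' ->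
     (i', j') <> (i, j) ->
     orient (q i') (q j') z < 0 \/ [/\ above i' j' z, (i' <= i)%N & (j <= j')%N]) ->
  exists z', [/\ column g z', orient (q i) (q j) z' < 0,
    forall i' j', (i' <= g < j')%N -> (j' <= n)%N -> chain_side f i' j' ->
      (i', j') <> (i, j) ->
      (orient (q i') (q j') z < 0 -> orient (q i') (q j') z' < 0) /\
      (above i' j' z -> above i' j' z')
    & P z <-> ~ P z'].
Proof.
move=> gn cz igj jn [k ek] az others.
pose o := orient (q i) (q j).
have hz := column_height g z i j gn cz igj jn.
have az' : 0 < o z by [].
have d0 : 0 < o p - o z by rewrite subr_gt0.
pose t0 := o z / (o p - o z).
have t0p : 0 < t0 by exact: divr_gt0.
pose w := ray z t0.
have oray t : o (ray z t) = (t0 - t) * (o p - o z).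
  rewrite /o ray_orient -/o mulrBl /t0 mulfVK ?gt_eqF//; ring.
have ow : o w = 0 by rewrite oray subrr mul0r.
have cw : column g w by apply: column_ray => //; exact: ltW.
have [s s01 ws] : exists2 s, 0 < s < 1 & w = lerp (q i) (q j) s.
  apply: (on_segment p) => //.
    by apply: (column_left g) => //; clear -igj; lia.
  by apply: (column_right g) => //; clear -igj; lia.
have outer i' j' : (i' <= i)%N -> (j <= j')%N -> (j' <= n)%N -> (i', j') <> (i, j) ->
    above i' j' w.
  move=> h1 h2 h3 ne; rewrite /above ws orient_lerp.
  have c1 := chord_ge0 n q p hc i' j' i ltac:(clear -h1 h2 igj; lia) h3.
  have c2 := chord_ge0 n q p hc i' j' j ltac:(clear -h1 h2 igj; lia) h3.
  have [e|ne'] := eqVneq i' i.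
    have nj : j <> j' by move=> e'; apply: ne; rewrite e e'.
    have c3 := chord_in n q p hc i' j' j ltac:(clear -h1 h2 igj nj; lia) h3.
    by nra.
  have c3 := chord_in n q p hc i' j' i ltac:(clear -h1 h2 igj ne'; lia) h3.
  by nra.
(* the ray crosses the side at w and nowhere before *)
pose C := [set y | exists2 t, 0 <= t < t0 & y = ray z t].
have cC : cvx C.
  move=> _ _ r [s1 s1h ->] [s2 s2h ->] r01; exists ((1 - r) * s1 + r * s2).
    have := mix_gt0 (t0 - s1) (t0 - s2) r ltac:(lra) ltac:(lra) r01.
    have : 0 <= (1 - r) * s1 + r * s2 by rewrite addr_ge0// mulr_ge0//; lra.
    by lra.
  exact: ray_lerp.
have dC y : C y -> ~ sides f y.
  move=> [t /andP[t1 t2] ->] /(column_sides f g (ray z t) fp gn (column_ray g z t t1 cz)).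
  move=> [i' [j' [igj' jn' ij' e]]].
  have [[e1 e2]|ne] := pselect ((i', j') = (i, j)).
    move: e; rewrite e1 e2 -/o oray => /eqP; rewrite mulf_eq0 (gt_eqF d0) orbF.
    by move=> /eqP; lra.
  move: e; rewrite ray_orient.
  have tp := chord_tip n q p hc i' j' ltac:(clear -igj' jn'; lia).
  have [neg|[ab h1 h2]] := others i' j' igj' jn' ij' ne; first nra.
  have := outer i' j' h1 h2 jn' ne; rewrite /above ray_orient => W0.
  have tt0 : 0 <= t <= t0 by rewrite t1 ltW.
  by have := ray_sign _ _ _ _ ab tt0 W0; lra.
have inC t : 0 <= t < t0 -> P z <-> P (ray z t).
  move=> ht; have zE : z = ray z 0 by rewrite /ray scale0r addr0.
  have Cz : C z by exists 0; rewrite ?lexx.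
  have Ct : C (ray z t) by exists t.
  by split; apply: (cvx_region f P Pf C cC dC).
have near_out : \forall y \near w, forall i', (i' < n.+1)%N -> forall j', (j' < n.+1)%N ->
    (i' <= i)%N -> (j <= j')%N -> (i', j') <> (i, j) -> above i' j' y.
  apply: (near_ltn n.+1 (fun i' y => forall j', (j' < n.+1)%N ->
    (i' <= i)%N -> (j <= j')%N -> (i', j') <> (i, j) -> above i' j' y)) => i' _.
  apply: (near_ltn n.+1 (fun j' y =>
    (i' <= i)%N -> (j <= j')%N -> (i', j') <> (i, j) -> above i' j' y)) => j' jn'.
  have [h1|h1] := boolP (i' <= i)%N; last by near=> y.
  have [h2|h2] := boolP (j <= j')%N; last by near=> y.
  have [e|ne] := pselect ((i', j') = (i, j)); first by near=> y.
  have := near_pos _ w (continuous_orient (q i') (q j')) (outer i' j' h1 h2 jn' ne).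
  by apply: filterS => y hy _ _ _.
have [sw sw01 swE] : exists2 s, 0 < s < 1 & w = lerp (f k) (f k.+1) s.
  case: ek => -[-> ->]; first by exists s.
  by exists (1 - s); [lra | rewrite ws lerpC].
have hand : (\forall y \near w, (0 < o y -> P y) /\ (o y < 0 -> ~ P y)) \/
    (\forall y \near w, (o y < 0 -> P y) /\ (0 < o y -> ~ P y)).
  have := half_disc m f fm P Pf k sw sw01; rewrite /left_at /right_at -swE.
  case: ek => -[-> ->]; first by [].
  case=> h; [right|left]; apply: filterS h => y; rewrite orient_swap -/o => -[h1 h2];
    split=> oy; [apply: h1|apply: h2|apply: h1|apply: h2]; lra.
have flip U : nbhs w U -> exists t1 t2, [/\ 0 <= t1 < t0, t0 < t2, U (ray z t1) & U (ray z t2)].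
  move=> /(near_affine1 _ (z - p))[e e0 he].
  have [r [r0 re rt]] := ex_smaller e t0 e0 ltac:(lra).
  have rayE t : w + t *: (z - p) = ray z (t0 + t) by rewrite /w /ray scalerDl addrA.
  exists (t0 - r), (t0 + r); split; [lra | lra | rewrite -rayE | rewrite -rayE].
    by apply: he; rewrite normrN gtr0_norm.
  by apply: he; rewrite gtr0_norm.
have opos t : t < t0 -> 0 < o (ray z t) by move=> h; rewrite oray mulr_gt0// subr_gt0.
have oneg t : t0 < t -> o (ray z t) < 0 by move=> h; rewrite oray; nra.
have keep t2 : t0 < t2 -> (forall i', (i' < n.+1)%N -> forall j', (j' < n.+1)%N ->
      (i' <= i)%N -> (j <= j')%N -> (i', j') <> (i, j) -> above i' j' (ray z t2)) ->
    forall i' j', (i' <= g < j')%N -> (j' <= n)%N -> chain_side f i' j' ->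
      (i', j') <> (i, j) ->
      (orient (q i') (q j') z < 0 -> orient (q i') (q j') (ray z t2) < 0) /\
      (above i' j' z -> above i' j' (ray z t2)).
  move=> ht hout i' j' igj' jn' ij' ne; split=> [neg|pos'].
    have tp := chord_tip n q p hc i' j' ltac:(clear -igj' jn'; lia).
    by rewrite ray_orient; nra.
  have [neg|[_ h1 h2]] := others i' j' igj' jn' ij' ne.
    by move: pos'; rewrite /above ltNge (ltW neg).
  by apply: hout => //; clear -igj' jn'; lia.
have finish t1 t2 : 0 <= t1 < t0 -> t0 < t2 -> (P (ray z t1) <-> ~ P (ray z t2)) ->
    (forall i', (i' < n.+1)%N -> forall j', (j' < n.+1)%N ->
      (i' <= i)%N -> (j <= j')%N -> (i', j') <> (i, j) -> above i' j' (ray z t2)) ->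
    exists z', [/\ column g z', orient (q i) (q j) z' < 0,
    forall i' j', (i' <= g < j')%N -> (j' <= n)%N -> chain_side f i' j' ->
      (i', j') <> (i, j) ->
      (orient (q i') (q j') z < 0 -> orient (q i') (q j') z' < 0) /\
      (above i' j' z -> above i' j' z')
    & P z <-> ~ P z'].
  move=> t1h t2h eP hout; exists (ray z t2); split.
  - by apply: column_ray => //; lra.
  - exact: oneg.
  - exact: keep.
  - exact: (iff_trans (inC t1 t1h) eP).
case: hand => hand.
  have [t1 [t2 [t1h t2h [h1 _] [h2 out2]]]] := flip _ (filterI hand near_out).
  apply: (finish t1 t2) => //.
  have P1 : P (ray z t1) by apply: h1.1; apply: opos; case/andP: t1h.
  have P2 : ~ P (ray z t2) by apply: h2.2; exact: oneg.
  by split.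
have [t1 [t2 [t1h t2h [h1 _] [h2 out2]]]] := flip _ (filterI hand near_out).
apply: (finish t1 t2) => //.
have P1 : ~ P (ray z t1) by apply: h1.2; apply: opos; case/andP: t1h.
have P2 : P (ray z t2) by apply: h2.1; exact: oneg.
by split.
Unshelve. all: by end_near. Qed.

End Region.
End Columns.

Section FaceMember.
Context {R : realType}.
Implicit Types (z w : (R * R)%type) (P U : set (R * R)) (f : nat -> R * R) (c : cell).
Variables (n : nat) (q : nat -> R * R) (p : R * R).
Hypothesis hc : chain n q p.
Hypothesis gp : general_position (chain_set n q p).
Local Notation A := (chain_set n q p).
Local Notation pos := (pos q p).
Local Notation column := (column q p).
Local Notation generic := (generic n q p).
Local Notation above := (above q).
Variables (D : nat -> nat -> bool) (S : nat -> bool).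
Hypothesis E : edge_set n D S.
Local Notation is_face := (is_face n D S).

Lemma face_chain_path c f : is_face c -> traces q p f c -> chain_path n q p f.
Proof.
move=> F [tr _] k; have [v [w [s -> ->]]] := tr k.
have [[i [j [ij h]]]|[i iln h]] := face_drawn n D S E c v w F s.
  left; exists i, j; split; first exact: (edge_lt _ _ _ E).
  by case: h => -[-> ->]; [left | right].
by right; exists i => //; case: h => -[-> ->]; [left | right].
Qed.

Lemma chain_side_of c f i j : is_face c -> traces q p f c -> (i < j <= n)%N ->
  chain_side q f i j -> side_of c (Some i) (Some j) \/ side_of c (Some j) (Some i).
Proof.
move=> F [tr _] ij [k h]; have [v [w [s ev ew]]] := tr k.
have [vn wn] := drawn_on_chain n D S E v w (face_drawn n D S E c v w F s).
have il : on_chain n (Some i) by rewrite /=; clear -ij; lia.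
have jl : on_chain n (Some j) by rewrite /=; clear -ij; lia.
rewrite ev ew in h; case: h => -[h1 h2]; [left|right].
  by rewrite -(pos_inj n q p hc v (Some i) vn il h1) -(pos_inj n q p hc w (Some j) wn jl h2).
by rewrite -(pos_inj n q p hc v (Some j) vn jl h1) -(pos_inj n q p hc w (Some i) wn il h2).
Qed.

Lemma side_of_chain c f i j : traces q p f c ->
  side_of c (Some i) (Some j) \/ side_of c (Some j) (Some i) -> chain_side q f i j.
Proof.
by move=> [_ tr] [/tr|/tr] [k [e1 e2]]; exists k; [left | right].
Qed.

Lemma lower_unique c u v u' v' g : is_face c -> lower_side c u v ->
  lower_side c u' v' -> (u <= g < v)%N -> (u' <= g < v')%N -> u = u' /\ v = v'.
Proof.
move=> F; have := face_valid n D S E c F; case: c F => [i j k|x a b y] F /=.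
  by move=> _ [-> ->] [-> ->].
move=> [h1 h2 h3 h4] [g1 b1 [-> ->]] [g2 b2 [-> ->]]; rewrite /fan_left /fan_right.
have [->|[lt|lt]] : g1 = g2 \/ (g1 < g2)%N \/ (g2 < g1)%N by clear; lia.
- by [].
- by repeat case: eqP; clear -b1 b2 lt h1 h2 h3; lia.
- by repeat case: eqP; clear -b1 b2 lt h1 h2 h3; lia.
Qed.

Lemma side_over c i j g : is_face c ->
  side_of c (Some i) (Some j) \/ side_of c (Some j) (Some i) -> (i <= g < j)%N ->
  exists u v, [/\ lower_side c u v, (u <= g < v)%N &
    (i, j) = (u, v) \/
    [/\ upper_side c u v g i j, (u <= i)%N, (j <= v)%N & (i, j) <> (u, v)]].
Proof.
move=> F; have := face_valid n D S E c F; case: c F => [i0 j0 k0|x a b y] F /=.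
  move=> [ijk kn] h ij.
  have cases : [\/ i = i0 /\ j = k0, i = j0 /\ j = k0 | i = i0 /\ j = j0].
    case: h => -[] [[e1] [e2]]; subst i j.
    - exact: Or31.
    - by exfalso; clear -ijk ij; lia.
    - by exfalso; clear -ijk ij; lia.
    - by exfalso; clear -ijk ij; lia.
    - exact: Or32.
    - exact: Or33.
  exists i0, k0; case: cases => -[e1 e2]; subst i j; split=> //; try by clear -ijk ij; lia.
  - by left.
  - right; have -> : (g < j0)%N = false by clear -ij; lia.
    by split=> //; [clear -ijk; lia | move=> [e]; clear -e ijk; lia].
  - right; have -> : (g < j0)%N by clear -ij; lia.
    by split=> //; [clear -ijk; lia | move=> [e]; clear -e ijk; lia].
move=> [h1 h2 h3 h4] h ij.
have lowa : lower_side (Fan x a b y) x (fan_right b y a).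
  by exists a; [clear -h2; lia | rewrite /fan_left eqxx].
have lowb : lower_side (Fan x a b y) (fan_left x a b.-1) y.
  exists b.-1; first by clear -h2; lia.
  by rewrite /fan_right prednK ?eqxx//; clear -h2; lia.
have cases : [\/ [/\ (x < a)%N, i = x & j = a], [/\ (b < y)%N, i = b & j = y] |
    lower_side (Fan x a b y) i j].
  case: h => -[[[//]|[//]]|[[lt [e1] [e2]]|[lt [e1] [e2]]]|[g0 b0 [[e1] [e2]]]].
  - by exfalso; subst i j; clear -lt ij; lia.
  - by exfalso; subst i j; clear -lt ij; lia.
  - by apply: Or33; exists g0.
  - exact: Or31.
  - exact: Or32.
  - exfalso; move: ij; rewrite e1 e2 /fan_left /fan_right.
    by repeat case: eqP; clear -b0 h1 h2 h3; lia.
case: cases => [[lt e1 e2]|[lt e1 e2]|low]; last first.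
- by exists i, j; split=> //; left.
- subst i j; exists (fan_left x a b.-1), y; split=> //.
    by rewrite /fan_left; case: eqP; clear -h1 h2 ij; lia.
  right; have -> : (g < a)%N = false by clear -ij h2; lia.
  have -> : (b <= g)%N by clear -ij; lia.
  split=> //; rewrite /fan_left; case: eqP; try by clear -h1 h2; lia.
    by move=> _ [e]; clear -e h1 h2; lia.
  by move=> _ [e]; clear -e h1 h2; lia.
- subst i j; exists x, (fan_right b y a); split=> //.
    by rewrite /fan_right; case: eqP; clear -h2 h3 ij; lia.
  right; have -> : (g < a)%N by clear -ij; lia.
  split=> //; rewrite /fan_right; case: eqP; try by clear -h3 h2; lia.
    by move=> _ [e]; clear -e h3 h2; lia.
  by move=> _ [e]; clear -e h3 h2; lia.
Qed.

Lemma upper_unique c u v g i j i' j' : upper_side c u v g i j ->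
  upper_side c u v g i' j' -> (i, j) = (i', j').
Proof.
case: c => [i0 j0 k0|x a b y] /=.
  by case: ifP => _ [-> ->] [-> ->].
by case: ifP => _; [|case: ifP => _ //] => -[-> ->] [-> ->].
Qed.

Lemma upper_side_of c u v g i j : is_face c -> lower_side c u v -> (u <= g < v)%N ->
  upper_side c u v g i j ->
  [/\ side_of c (Some i) (Some j) \/ side_of c (Some j) (Some i), (u <= i <= g)%N,
      (g < j <= v)%N & (i, j) <> (u, v)].
Proof.
move=> F; have := face_valid n D S E c F; case: c F => [i0 j0 k0|x a b y] F /=.
  move=> [ijk kn] [-> ->] guv; case: ifP => gj [-> ->].
    split; [by right; apply: Or33 | clear -ijk guv; lia | clear -ijk gj; lia|].
    by move=> [e]; clear -e ijk; lia.
  split; [by right; apply: Or32 | clear -ijk guv gj; lia | clear -ijk guv; lia|].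
  by move=> [e]; clear -e ijk; lia.
move=> [h1 h2 h3 h4] [g0 b0 [-> ->]]; rewrite /fan_left /fan_right => guv.
case: ifP => ga.
  have e0 : g0 = a by move: guv; case: eqP; clear -ga b0; lia.
  move: guv; rewrite e0 eqxx => guv [-> ->].
  have lt : (x < a)%N by clear -guv ga; lia.
  split; [by right; apply/Or32/or_introl | clear -guv; lia | |].
    by case: eqP; clear -ga h2 h3; lia.
  by case: eqP => _ [e]; clear -e h2 h3; lia.
case: ifP => gb // [-> ->].
have e0 : g0.+1 = b by move: guv; case: (g0.+1 =P b); clear -gb b0; lia.
move: guv; rewrite e0 eqxx => guv.
have lt : (b < y)%N by clear -guv gb; lia.
split; [by right; apply/Or32/or_intror | | clear -guv; lia |].
  by case: eqP; clear -gb h2 h1 e0; lia.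
by case: eqP => _ [e]; clear -e h2 h1 e0; lia.
Qed.

Section Member.
Variables (c : cell) (m : nat) (f : nat -> R * R) (P : set (R * R)).
Hypotheses (F : is_face c) (fP : polygon m f P) (ft : traces q p f c).

Let fm : cyclic_path m f. Proof. by case: fP. Qed.
Let Pf : bounded_by f P. Proof. by case: fP. Qed.
Let fp : chain_path n q p f. Proof. exact: (face_chain_path c). Qed.

Let over i j g : (i <= g < j)%N -> (j <= n)%N -> chain_side q f i j ->
  exists u v, [/\ lower_side c u v, (u <= g < v)%N &
    (i, j) = (u, v) \/
    [/\ upper_side c u v g i j, (u <= i)%N, (j <= v)%N & (i, j) <> (u, v)]].
Proof.
move=> igj jn h; apply: side_over => //.
by apply: (chain_side_of c f) => //; clear -igj jn; lia.
Qed.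

Lemma face_member_none g z : (g < n)%N -> column g z ->
  (forall u v, lower_side c u v -> ~ (u <= g < v)%N) -> ~ P z.
Proof.
move=> gn cz none; apply: (region_below n q p hc f P Pf fp g) => // i j igj jn h.
by have [u [v [l guv _]]] := over i j g igj jn h; case: (none u v).
Qed.

Section Lower.
Variables (g u v : nat).
Hypotheses (gn : (g < n)%N) (low : lower_side c u v) (guv : (u <= g < v)%N).

Let uvn : (v <= n)%N.
Proof.
have := face_valid n D S E c F; clear -low; case: c low => [i j k|x a b y] /=.
  by move=> [_ ->] [].
by move=> [h b0 [_ ->]] [h1 h2 h3 h4]; rewrite /fan_right; case: eqP; clear -h1 h2 h3 h4 b0; lia.
Qed.

Let low_side : chain_side q f u v.
Proof.
apply: (side_of_chain c) => //; left.
clear -low; case: c low => [i j k|x a b y] /=; first by move=> [-> ->]; apply: Or31.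
by move=> [h b0 [-> ->]]; apply: Or33; exists h.
Qed.

Let over' i j : (i <= g < j)%N -> (j <= n)%N -> chain_side q f i j ->
  (i, j) = (u, v) \/
  [/\ upper_side c u v g i j, (u <= i)%N, (j <= v)%N & (i, j) <> (u, v)].
Proof.
move=> igj jn h; have [u' [v' [l guv' hh]]] := over i j g igj jn h.
by have [-> ->] := lower_unique c u v u' v' g F low l guv guv'.
Qed.

Lemma face_member_below z : column g z -> orient (q u) (q v) z < 0 -> 
  (forall i j, upper_side c u v g i j -> orient (q i) (q j) z < 0) -> ~ P z.
Proof.
move=> cz oz up; apply: (region_below n q p hc f P Pf fp g) => // i j igj jn h.
by case: (over' i j igj jn h) => [[-> ->]|[hu _ _ _]] //; exact: up.
Qed.

Lemma face_member_between z : column g z -> above u v z ->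
  (forall i j, upper_side c u v g i j -> orient (q i) (q j) z < 0) -> P z.
Proof.
move=> cz az up.
have [|z' [cz' oz' keep eP]] := region_flip n q p hc m f P fm Pf fp g z u v gn cz guv uvn low_side az.
  move=> i j igj jn h ne; left.
  by case: (over' i j igj jn h) => [//|[hu _ _ _]]; exact: up.
apply/eP; apply: face_member_below => // i j hu.
have [s1 s2 s3 ne] := upper_side_of c u v g i j F low guv hu.
have jn : (j <= n)%N by move: uvn; clear -s3; lia.
have igj : (i <= g < j)%N by clear -s2 s3; lia.
by case: (keep i j igj jn (side_of_chain c f i j ft s1) ne) => + _; apply; exact: up.
Qed.

Lemma face_member_above z i j : column g z -> above u v z ->
  upper_side c u v g i j -> above i j z -> ~ P z.
Proof.
move=> cz az hu aij.
have [s1 s2 s3 ne] := upper_side_of c u v g i j F low guv hu.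
have jn : (j <= n)%N by move: uvn; clear -s3; lia.
have igj : (i <= g < j)%N by clear -s2 s3; lia.
have sij := side_of_chain c f i j ft s1.
have [|z' [cz' oz' keep eP]] := region_flip n q p hc m f P fm Pf fp g z i j gn cz igj jn sij aij.
  move=> i' j' igj' jn' h' ne'; right.
  case: (over' i' j' igj' jn' h') => [[-> ->]|[hu' _ _ _]].
    by split=> //; [clear -s2; lia | clear -s3; lia].
  by case: ne'; exact: upper_unique hu' hu.
move/eP; apply; apply: face_member_between => //.
  have [_ h] := keep u v guv uvn low_side (nesym ne).
  exact: h.
by move=> i' j' hu'; have [-> ->] := upper_unique _ _ _ _ _ _ _ _ hu' hu.
Qed.

(** The sides of a face over a gap are its lower side and at most one upper side.
    A ray from z away from the tip crosses exactly those below z. *)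
Lemma face_memberP z : generic z -> column g z ->
  P z <-> above u v z /\ (forall i j, upper_side c u v g i j -> ~ above i j z).
Proof.
move=> [_ gz] cz.
have neg i j : (i < j <= n)%N -> ~ above i j z -> orient (q i) (q j) z < 0.
  by move=> ij /negP; rewrite -leNgt lt_neqAle gz.
have upn i j : upper_side c u v g i j -> (i < j <= n)%N.
  move=> hu; have [_ s2 s3 _] := upper_side_of c u v g i j F low guv hu.
  by move: uvn; clear -s2 s3; lia.
split=> [Pz|[az up]].
  have az : above u v z.
    apply: contrapT => naz; have oz : orient (q u) (q v) z < 0.
      by apply: neg => //; move: uvn; clear -guv; lia.
    apply: (face_member_below z cz oz) => // i j hu; apply: neg; first exact: upn.
    have [_ s2 s3 _] := upper_side_of c u v g i j F low guv hu.
    by move=> aij; apply: naz; exact: (above_mono n q p hc g z u v i j).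
  by split=> // i j hu aij; exact: (face_member_above z i j cz az hu aij).
by apply: face_member_between => // i j hu; apply: neg; [exact: upn | exact: up].
Qed.

End Lower.
End Member.

Lemma near_generic z U : nbhs z U -> exists2 y, nbhs y U & generic y.
Proof.
move=> zU.
pose L1 := [seq (p, q i) | i <- iota 0 n.+1].
pose L2 := [seq (q ij.1, q ij.2) | ij <- [seq (i, j) | i <- iota 0 n.+1, j <- iota 0 n.+1] & (ij.1 < ij.2)%N].
have [l|y yU hy] := generic_point (L1 ++ L2) U z _ zU.
  rewrite mem_cat => /orP[/mapP[i]|/mapP[[i j]]].
    rewrite mem_iota => il ->; apply/nesym/(tip_neq n q p hc); clear -il; lia.
  rewrite mem_filter => /andP[ij]; move/allpairsPdep => [i' [j' [_ jl [_ ej]]]] -> /=.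
  apply: (chord_neq n q p hc).
  by subst j'; move: ij jl; rewrite mem_iota /=; clear; lia.
exists y => //; split=> [i il|i j ij].
  apply: (hy (p, q i)); rewrite mem_cat; apply/orP; left.
  by apply/mapP; exists i => //; rewrite mem_iota; clear -il; lia.
apply: (hy (q i, q j)); rewrite mem_cat; apply/orP; right.
apply/mapP; exists (i, j) => //; rewrite mem_filter; apply/andP; split.
  by rewrite /=; clear -ij; lia.
by apply/allpairsPdep; exists i, j; split=> //; rewrite mem_iota; clear -ij; lia.
Qed.

Lemma region_in_hull m f P z : polygon m f P -> (forall k, A (f k)) -> P z ->
  in_hull n q p z.
Proof.
move=> [fm Pf] fA Pz.
have half g : affine g -> (forall v, on_chain n v -> 0 <= g (pos v)) -> 0 <= g z.
  move=> ag hg; rewrite -oppr_le0.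
  apply: (region_half_plane f P Pf (fun z => - g z) 0 (affineN _ ag)) => // k.
  by have [v vn ->] := pos_onto n q p _ (fA k); rewrite oppr_le0; exact: hg.
have ch := chain_in_hull n q p hc.
split.
- by apply: half => [|v /ch[]//]; exact: affine_orient.
- rewrite -oppr_ge0; apply: (half (fun z => - orient p (q n) z)).
    by apply: affineN; exact: affine_orient.
  by move=> v /ch[_ + _]; rewrite oppr_ge0.
- by apply: half => [|v /ch[]//]; exact: affine_orient.
Qed.

Lemma generic_column m f P z : polygon m f P -> (forall k, A (f k)) -> P z ->
  generic z -> exists2 g, (g < n)%N & column g z.
Proof.
move=> fP fA Pz gz; have [h1 h2 _] := region_in_hull m f P z fP fA Pz.
have [gz1 _] := gz; apply: (ex_column n) => //.
  by rewrite lt_neqAle eq_sym gz1.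
by rewrite lt_neqAle gz1.
Qed.

Lemma face_path_in c f : is_face c -> traces q p f c -> forall k, A (f k).
Proof.
move=> F [tr _] k; have [v [w [/(face_drawn n D S E c v w F) d -> _]]] := tr k.
by have [vn _] := drawn_on_chain n D S E v w d; exact: (pos_in n q p).
Qed.

(** The sides decide which generic points are in the region, and these are dense
    in it. *)
Theorem face_region_unique c m f P m' f' P' : is_face c ->
  polygon m f P -> traces q p f c -> polygon m' f' P' -> traces q p f' c -> P = P'.
Proof.
move=> F; suff sub m1 f1 P1 m2 f2 P2 : polygon m1 f1 P1 -> traces q p f1 c ->
    polygon m2 f2 P2 -> traces q p f2 c -> P1 `<=` P2.
  move=> fP ft fP' ft'; apply/seteqP.
  by split; [exact: (sub m f P m' f' P') | exact: (sub m' f' P' m f P)].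
move=> fP ft fP' ft' z Pz; have [_ Pf'] := fP'; have [_ Pf] := fP.
apply: (region_closed f2 P2 Pf') => U Uz.
have [y Uy Py] := region_interior f1 P1 Pf z _ Pz (nbhs_interior Uz).
have [y' yU gy] := near_generic y _ (filterI (nbhs_interior Py) Uy).
have [Py' Uy'] := nbhs_singleton yU.
have {}Py' : P1 y' by exact: nbhs_singleton.
exists y'; split=> //.
have [g gn cg] := generic_column m1 f1 P1 y' fP (face_path_in c f1 F ft) Py' gy.
have [[u [v [low guv]]]|none] := pselect (exists u v, lower_side c u v /\ (u <= g < v)%N).
  apply/(face_memberP c m2 f2 P2 F fP' ft' g u v gn low guv y' gy cg).
  exact/(face_memberP c m1 f1 P1 F fP ft g u v gn low guv y' gy cg).
case: (face_member_none c m1 f1 P1 F fP ft g y' gn cg _ Py') => u v low guv.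
by apply: none; exists u, v.
Qed.

End FaceMember.

(** * Pointed pseudo-triangulations give edge sets *)

Lemma set2_eq {T : Type} (x y a b : T) : [set x; y] = [set a; b] ->
  (x = a /\ y = b) \/ (x = b /\ y = a).
Proof.
move=> e.
have [xa yb] : [set a; b] x /\ [set a; b] y by rewrite -e; split; [left|right].
have [ax bx] : [set x; y] a /\ [set x; y] b by rewrite e; split; [left|right].
case: xa => ex; case: yb => ey; [|by left|by right|].
  by left; split=> //; case: bx => /= ->; rewrite ?ex ?ey.
by right; split=> //; case: ax => /= ->; rewrite ?ex ?ey.
Qed.

(** A linear form vanishes on any linear relation between three vectors. *)
Lemma orient_relation {R : realType} (v u w a b d : R * R) :
  let g z := orient v w z + orient v z u in
  orient v a b * g d + orient v b d * g a + orient v d a * g b = 0.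
Proof. by move=> g; rewrite /g; clear g; coords; ring. Qed.

Lemma lower_side_of c u v : lower_side c u v -> side_of c (Some u) (Some v).
Proof.
case: c => [i j k|x a b y] /=; first by move=> [-> ->]; apply: Or31.
by move=> [g gab [-> ->]]; apply: Or33; exists g.
Qed.

Lemma side_of_lower n c u v : valid_cell n c -> (u < v)%N ->
  side_of c (Some u) (Some v) -> lower_side c u v.
Proof.
case: c => [i j k|x a b y] /=.
  move=> [ijk kn] uv [] [[e1] [e2]]; subst u v; [by []| |];
    by exfalso; clear -ijk uv; lia.
move=> [h1 h2 h3 h4] uv [[[//]|[_ //]]|[[lt [e1] [e2]]|[lt [e1] [e2]]]|[g gab [[e1] [e2]]]].
- by exfalso; subst u v; clear -lt uv; lia.
- by exfalso; subst u v; clear -lt uv; lia.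
- by exists g.
Qed.

Lemma side_on_chain n c v w : valid_cell n c -> side_of c v w ->
  on_chain n v /\ on_chain n w.
Proof.
case: c => [i j k|x a b y] /=.
  by move=> [ijk kn] [] [-> ->] /=; clear -ijk kn; lia.
move=> [h1 h2 h3 h4] [[] [-> ->]|[] [lt -> ->]|[g gab [-> ->]]] /=;
  rewrite ?/fan_left ?/fan_right; repeat case: eqP; clear -h1 h2 h3 h4 gab || clear -h1 h2 h3 h4; lia.
Qed.

Lemma ex_lower_side n D S c : is_face n D S c -> exists u v, lower_side c u v.
Proof.
case: c => [i j k|x a b y] F; first by exists i, k.
have [ab _ _ _ _] := F; exists (fan_left x a a), (fan_right b y a).
by exists a => //; rewrite leqnn.
Qed.

Section FromTriangulation.
Context {R : realType}.
Implicit Types (x y z w : (R * R)%type) (P Q : set (R * R)) (f : nat -> R * R)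
  (c : cell) (s t : R).
Variables (n : nat) (q : nat -> R * R) (p : R * R).
Hypothesis hc : chain n q p.
Hypothesis gp : general_position (chain_set n q p).
Local Notation A := (chain_set n q p).
Local Notation pos := (pos q p).

Definition faces (D : nat -> nat -> bool) (S : nat -> bool) : set (set (R * R)) :=
  [set P | exists c, is_face n D S c /\
    exists m f, polygon m f P /\ traces q p f c].

Section Cells.
Variable T : set (set (R * R)).
Hypothesis tT : pseudo_triangulation A T.

Let tri P : T P -> pseudo_triangle P. Proof. by case: tT => h *; exact: h. Qed.
Let disj : disjoint_interiors T. Proof. by case: tT. Qed.
Let cover : \bigcup_(P in T) P = hull A. Proof. by case: tT. Qed.
Let vert : \bigcup_(P in T) vertices P = A. Proof. by case: tT. Qed.

Lemma cell_path_in P m f : T P -> polygon m f P -> forall k, A (f k).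
Proof.
move=> TP fP k; rewrite -vert; exists P => //.
by apply/verticesP; exists m, f; split=> //; exists k.
Qed.

Lemma cell_polygon P : T P -> exists m f, polygon m f P.
Proof. by move=> /tri/pseudo_triangleP[m [f [fP _]]]; exists m, f. Qed.

Lemma point_off_interior z P : A z -> T P -> ~ P° z.
Proof.
move=> Az TP; have : (\bigcup_(P in T) vertices P) z by rewrite vert.
case=> Q TQ /verticesP[m [f [fP [k <-]]]].
by apply: (side_off_interior T P Q m f) => //; exists k; exact: segment_l.
Qed.

Lemma edge_sides x y : edge T x y ->
  exists P m f k, [/\ T P, polygon m f P & [set x; y] = [set f k; f k.+1]].
Proof. by move=> [P TP /sideP[m [f [fP [k e]]]]]; exists P, m, f, k. Qed.

Lemma edge_sym x y : edge T x y -> edge T y x.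
Proof.
by move=> [P TP /sideP[m [f [fP [k e]]]]]; exists P => //; apply/sideP; exists m, f;
  split=> //; exists k; rewrite setUC.
Qed.

Lemma side_edge P m f k : T P -> polygon m f P -> edge T (f k) (f k.+1).
Proof. by move=> TP fP; exists P => //; apply/sideP; exists m, f; split=> //; exists k. Qed.

Lemma edge_segment x y z : edge T x y -> segment x y z ->
  exists P m f k, [/\ T P, polygon m f P, [set x; y] = [set f k; f k.+1] &
    segment (f k) (f k.+1) z].
Proof.
move=> /edge_sides[P [m [f [k [TP fP e]]]]] h; exists P, m, f, k; split=> //.
by case: (set2_eq _ _ _ _ e) => -[<- <-] //; rewrite segmentC.
Qed.

Lemma edge_ends x y : edge T x y -> [/\ A x, A y & x <> y].
Proof.
move=> /edge_sides[P [m [f [k [TP fP e]]]]].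
have fA := cell_path_in P m f TP fP; have [fm _] := fP.
have ne := cyc_neqS m f fm k.
by case: (set2_eq _ _ _ _ e) => -[-> ->]; split=> //; exact: nesym.
Qed.

Lemma edge_off_interior x y z P : edge T x y -> segment x y z -> T P -> ~ P° z.
Proof.
move=> exy xyz TP; have [Q [m [f [k [TQ fQ _ h]]]]] := edge_segment x y z exy xyz.
by apply: (side_off_interior T P Q m f) => //; exists k.
Qed.

Lemma edge_cross x y x' y' s : edge T x y -> edge T x' y' -> 0 < s < 1 ->
  segment x' y' (lerp x y s) -> [set x; y] = [set x'; y'].
Proof.
move=> exy exy' s01 h.
have [Q [m [f [k [TQ fQ -> h']]]]] := edge_segment x' y' _ exy' h.
have [Ax Ay ne] := edge_ends x y exy.
have [//|[z xyz Qz]] := edge_side_or_enters A m f Q k x y s gp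
  (cell_path_in Q m f TQ fQ) Ax Ay ne fQ s01 h'.
by case: (edge_off_interior x y z Q exy xyz TQ Qz).
Qed.

(** The common point is on the frontier, hence on a side of the cell. *)
Lemma touching_side x y s P m f : A x -> A y -> x <> y -> 0 < s < 1 -> T P ->
  polygon m f P -> (forall z, segment x y z -> ~ P° z) -> P (lerp x y s) ->
  exists k, [set x; y] = [set f k; f k.+1].
Proof.
move=> Ax Ay ne s01 TP fP off Ps; have [fm Pf] := fP.
have off_s : ~ P° (lerp x y s).
  by apply: off; apply/segmentP; exists s => //; lra.
have [k hk] := regionE f P Pf _ Ps off_s; exists k.
have [//|[z xyz Pz]] := edge_side_or_enters A m f P k x y s gp
  (cell_path_in P m f TP fP) Ax Ay ne fP s01 hk.
by case: (off z xyz Pz).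
Qed.

Definition chord_edges u v := `[< (u < v <= n)%N /\ edge T (q u) (q v) >].
Definition tip_edges j := `[< (0 < j < n)%N /\ edge T p (q j) >].
Local Notation D := chord_edges.
Local Notation S := tip_edges.

Lemma chord_edges_lt u v : D u v -> (u < v <= n)%N.
Proof. by move=> /asboolP[]. Qed.

Lemma chord_edges_edge u v : D u v -> edge T (q u) (q v).
Proof. by move=> /asboolP[]. Qed.

Lemma chord_edges_nocross u v u' v' : D u v -> D u' v' ->
  ~ [&& u < u', u' < v & v < v']%N.
Proof.
move=> /asboolP[uv e] /asboolP[uv' e'] /and3P[h1 h2 h3].
have [s [t [s01 t01 est]]] := chords_cross n q p hc u u' v v' ltac:(by rewrite h1)
  ltac:(clear -h3 uv'; lia).
have : [set q u; q v] = [set q u'; q v'].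
  apply: (edge_cross _ _ _ _ s) => //; apply/segmentP; exists t => //.
  by lra.
have ul : (u <= n)%N by clear -uv; lia.
have ul' : (u' <= n)%N by clear -uv'; lia.
have vl' : (v' <= n)%N by clear -uv'; lia.
move=> es; case: (set2_eq _ _ _ _ es) => -[eu _].
  by have := chain_inj n q p hc _ _ ul ul' eu; clear -h1; lia.
by have := chain_inj n q p hc _ _ ul vl' eu; clear -h2 h3 uv; lia.
Qed.

(** At a pointed vertex some linear form is positive on all edges. The directions
    from q j to q i, q k and p positively span the plane, which excludes this. *)
Lemma chord_edges_pointed i j k : (forall v, A v -> pointed_vertex T v) ->
  S j -> D i j -> D j k -> False.
Proof.
move=> pt /asboolP[j0n ep] /asboolP[ij eij] /asboolP[jk ejk].
have [u [w [eu ew ouw others]]] := pt (q j) (chain_q_in n q p j ltac:(clear -j0n; lia)).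
pose g z := orient (q j) w z + orient (q j) z u.
have pos_g x : edge T (q j) x -> 0 < g x.
  move=> ex; rewrite /g.
  have [->|xu] := pselect (x = u); first by rewrite orient_abb addr0 orient_flip oppr_gt0.
  have [->|xw] := pselect (x = w).
    by rewrite orient_abb add0r orient_flip oppr_gt0.
  by have [h1 h2] := others x ex xu xw; exact: addr_gt0.
have gi := pos_g _ (edge_sym _ _ eij); have gk := pos_g _ ejk.
have gpp := pos_g _ (edge_sym _ _ ep).
have rel : orient (q j) (q i) (q k) * g p + orient (q j) (q k) p * g (q i) +
  orient (q j) p (q i) * g (q k) = 0 by exact: orient_relation.
have o1 : 0 < orient (q j) (q i) (q k).
  by rewrite -orient_cyc; apply: (chord_in n q p hc); clear -ij jk; lia.
have o2 : 0 < orient (q j) (q k) p by exact: (chord_tip n q p hc).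
have o3 : 0 < orient (q j) p (q i).
  by rewrite -orient_cyc; apply: (tip_pos n q p hc).
have := mulr_gt0 o1 gpp; have := mulr_gt0 o2 gi; have := mulr_gt0 o3 gk.
by move=> h1 h2 h3; move: rel; clearbody g; lra.
Qed.

Lemma chord_edges_base : D 0%N n.
Proof.
have [n0 _ _] := hc; apply/asboolP; split; first by rewrite n0 leqnn.
have Aq i : (i <= n)%N -> A (q i) := chain_q_in n q p i.
have ne : q 0%N <> q n by apply: (chord_neq n q p hc); rewrite n0 leqnn.
have h01 : 0 < (2^-1 : R) < 1 by lra.
have below z : hull A z -> 0 <= orient (q 0%N) (q n) z.
  by move=> /(hullP n q p hc)[].
have hm : hull A (lerp (q 0%N) (q n) 2^-1).
  by apply: hull_cvx; [by apply: hull_sub; apply: Aq | by apply: hull_sub; apply: Aq | lra].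
have [P TP Pm] : (\bigcup_(P in T) P) (lerp (q 0%N) (q n) 2^-1) by rewrite cover.
have [m [f fP]] := cell_polygon P TP.
have off z : segment (q 0%N) (q n) z -> ~ P° z.
  move=> /segment_orient0 oz Pz.
  have [z1 [_ [Pz1 _ + _]]] := orient_perturb _ _ z _ ne Pz; rewrite oz.
  by apply/negP; rewrite -leNgt; apply: below; rewrite -cover; exists P.
have [k e] := touching_side _ _ _ P m f (Aq 0%N (leq0n n)) (Aq n (leqnn n)) ne h01 TP fP off Pm.
by exists P => //; apply/sideP; exists m, f; split=> //; exists k.
Qed.

Lemma near_edge u v : D u v -> \forall z \near lerp (q u) (q v) 2^-1,
  forall x y, edge T x y -> segment x y z -> [set x; y] = [set q u; q v].
Proof.
move=> /asboolP[uv euv].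
have h01 : 0 < (2^-1 : R) < 1 by lra.
pose nd k := if k == n.+1 then p else q k.
have ndP x : A x -> exists2 k, (k < n.+2)%N & x = nd k.
  move=> /(pos_onto n q p)[[i|] /= il ->]; last by exists n.+1; rewrite // /nd eqxx.
  exists i; first by clear -il; lia.
  by rewrite /nd; case: eqP => // e; clear -e il; lia.
have near1 : \forall z \near lerp (q u) (q v) 2^-1, forall i, (i < n.+2)%N ->
    forall j, (j < n.+2)%N -> edge T (nd i) (nd j) -> segment (nd i) (nd j) z ->
    [set nd i; nd j] = [set q u; q v].
  apply: (near_ltn _ (fun i z => forall j, (j < n.+2)%N -> edge T (nd i) (nd j) ->
    segment (nd i) (nd j) z -> [set nd i; nd j] = [set q u; q v])) => i _.
  apply: (near_ltn _ (fun j z => edge T (nd i) (nd j) ->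
    segment (nd i) (nd j) z -> [set nd i; nd j] = [set q u; q v])) => j _.
  have [h|h] := pselect (segment (nd i) (nd j) (lerp (q u) (q v) 2^-1)).
    by near=> z => eij _; rewrite (edge_cross _ _ _ _ _ euv eij h01 h).
  have : nbhs (lerp (q u) (q v) 2^-1) (~` segment (nd i) (nd j)).
    by apply: open_nbhs_nbhs; split=> //; exact/closed_openC/segment_closed.
  by apply: filterS => z nz _ zs; case: nz.
apply: filterS near1 => z hz x y exy xyz.
have [/ndP[i il ex] /ndP[j jl ey] _] := edge_ends x y exy.
by move: exy xyz; rewrite ex ey; exact: hz.
Unshelve. all: by end_near. Qed.

(** Close to the middle of an edge, the way up to the tip meets no other
    edge, so it runs inside a single cell, which has this edge as a side. *)
Lemma cell_above u v : D u v -> exists P c m f, [/\ T P, valid_cell n c,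
  ccw_polygon m f P, traces q p f c & lower_side c u v].
Proof.
move=> Duv; have uv := chord_edges_lt _ _ Duv; have euv := chord_edges_edge _ _ Duv.
have h01 : 0 < (2^-1 : R) < 1 by lra.
set mid := lerp (q u) (q v) 2^-1.
have [Au Av ne] := edge_ends _ _ euv.
have up : 0 < orient (q u) (q v) p by exact: (chord_tip n q p hc).
have upl s : orient (q u) (q v) (lerp mid p s) = s * orient (q u) (q v) p.
  by rewrite !orient_lerp orient_aba orient_abb; ring.
have near_mid := near_edge u v Duv; rewrite -/mid -(lerp0 mid p) in near_mid.
have [e e0 he] := near_lerp mid p 0 _ near_mid.
have [r [r0 re r1]] := ex_smaller e 1 e0 ltr01.
have hz : hull A (lerp mid p r).
  apply: hull_cvx; last by lra.
    by apply: hull_cvx; [exact: hull_sub | exact: hull_sub | lra].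
  by apply: hull_sub; exact: chain_tip_in.
have [P TP Pr] : (\bigcup_(P in T) P) (lerp mid p r) by rewrite cover.
have [m [f fP]] := cell_polygon P TP; have [_ Pf] := fP.
pose C := [set z | exists2 s, 0 < s <= r & z = lerp mid p s].
have PC s : 0 < s <= r -> P (lerp mid p s).
  move=> sr; apply: (cvx_region f P Pf C _ _ (lerp mid p r)) => //.
  - move=> _ _ t [s1 h1 ->] [s2 h2 ->] t01.
    exists ((1 - t) * s1 + t * s2); last exact: lerp_lerp.
    by apply/andP; split; nra.
  - move=> _ [s' s'r ->] [k hk].
    have se := side_edge P m f k TP fP.
    have s'e : `|s' - 0| < e by rewrite subr0 gtr0_norm; lra.
    have oz : orient (q u) (q v) (lerp mid p s') = 0.
      have := segment_orient0 _ _ _ hk.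
      have [[-> ->] //|[-> ->]] := set2_eq _ _ _ _ (he s' s'e _ _ se hk).
      by rewrite orient_swap => /eqP; rewrite oppr_eq0 => /eqP.
    by move: oz; rewrite upl => /eqP; rewrite mulf_eq0 (gt_eqF up) orbF; lra.
  - by exists r => //; rewrite r0 lexx.
  - by exists s.
have Pmid : P mid.
  apply: (region_closed f P Pf) => U; rewrite -(lerp0 mid p) => mU.
  have [d d0 hd] := near_lerp mid p 0 _ mU.
  have [s [s0 sd /ltW sr]] := ex_smaller d r d0 r0.
  exists (lerp mid p s); split; first by apply: PC; rewrite s0.
  by apply: hd; rewrite subr0 gtr0_norm.
have off z : segment (q u) (q v) z -> ~ P° z.
  by move=> h; exact: (edge_off_interior (q u) (q v)).
have [c [m' [f' [vc fP' tr]]]] := face_classification n q p hc gp P m f (tri P TP) fP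
  (cell_path_in P m f TP fP) (fun z Az => point_off_interior z P Az TP).
exists P, c, m', f'; split=> //.
have [fP'' fl] := fP'.
have [k ek] := touching_side _ _ _ P m' f' Au Av ne h01 TP fP'' off Pmid.
have [w1 [w2 [sw ew1 ew2]]] := tr.1 k.
have [on1 on2] := side_on_chain n c w1 w2 vc sw.
have ul : on_chain n (Some u) by rewrite /=; clear -uv; lia.
have vl : on_chain n (Some v) by rewrite /=; clear -uv; lia.
have [[e1 e2]|[e1 e2]] := set2_eq _ _ _ _ ek.
  apply: (side_of_lower n) => //; first by clear -uv; lia.
  rewrite (pos_inj n q p hc (Some u) w1)//; last by rewrite -ew1.
  by rewrite (pos_inj n q p hc (Some v) w2)//; rewrite -ew2.
exfalso; have : \forall z \near mid, 0 < orient (q u) (q v) z -> ~ P z.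
  have := fl k _ h01; rewrite /left_at -e1 -e2 (_ : lerp (q v) (q u) 2^-1 = mid).
    apply: filterS => z [_ h] oz; apply: h; by rewrite orient_swap oppr_lt0.
  by rewrite /mid lerpC; congr lerp; lra.
rewrite -(lerp0 mid p) => nm.
have [d d0 hd] := near_lerp mid p 0 _ nm.
have [s [s0 sd /ltW sr]] := ex_smaller d r d0 r0.
apply: (hd s); first by rewrite subr0 gtr0_norm.
  by rewrite upl mulr_gt0.
by apply: PC; rewrite s0.
Qed.

Lemma cell_is_face P c m f : T P -> valid_cell n c -> polygon m f P ->
  traces q p f c -> is_face n D S c.
Proof.
move=> TP vc fP [_ tr].
have sides (v w : option nat) : side_of c v w -> edge T (pos v) (pos w).
  by move=> /tr[k [<- <-]]; exact: side_edge fP.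
case: c vc sides {tr} => [i j k|x a b y] /=.
  move=> [ijk kn] h; split; apply/asboolP; split; try by clear -ijk kn; lia.
  - by apply: edge_sym; apply: (h (Some j) (Some i)); apply: Or33.
  - by apply: edge_sym; apply: (h (Some k) (Some j)); apply: Or32.
  - by apply: (h (Some i) (Some k)); apply: Or31.
move=> [h1 h2 h3 h4] h; split=> //.
- have [a0|a0] := posnP a; first by rewrite a0.
  apply/orP; right; apply/asboolP; split; first by clear -a0 h2 h3 h4; lia.
  by apply: (h None (Some a)); apply/Or31/or_introl.
- have [bn|bn] := eqVneq b n; first by [].
  apply/asboolP; split; first by clear -bn h2 h3 h4; lia.
  by apply: edge_sym; apply: (h (Some b) None); apply/Or31/or_intror.
- split.
    have [->|xa] := eqVneq x a; [by left | right; apply/asboolP].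
    have lt : (x < a)%N by clear -xa h1; lia.
    split; first by clear -lt h2 h3 h4; lia.
    by apply: edge_sym; apply: (h (Some a) (Some x)); apply/Or32/or_introl.
  have [->|yb] := eqVneq y b; [by left | right; apply/asboolP].
  have lt : (b < y)%N by clear -yb h3; lia.
  split; first by clear -lt h4; lia.
  by apply: edge_sym; apply: (h (Some y) (Some b)); apply/Or32/or_intror.
- move=> g gab; apply/asboolP; split; last first.
    by apply: (h (Some _) (Some _)); apply: Or33; exists g.
  by rewrite /fan_left /fan_right; repeat case: eqP; clear -h1 h2 h3 h4 gab; lia.
Qed.

Lemma chord_edges_above u v : D u v ->
    (exists i, D u i /\ D i v) \/
    (exists a, [/\ (u <= a < v)%N, a = u \/ D u a /\ S a &
                   a.+1 = v \/ D a.+1 v /\ S a.+1]).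
Proof.
move=> Duv; have [P [c [m [f [TP vc [fP _] tr low]]]]] := cell_above u v Duv.
have := cell_is_face P c m f TP vc fP tr.
case: c vc low {tr} => [i j k|x a b y] /=.
  by move=> _ [-> ->] [D1 D2 _]; left; exists j.
move=> [h1 h2 h3 h4] [g gab [eu ev]] [_ Sa Sb [xa yb] lo]; right; exists g.
rewrite eu ev /fan_left /fan_right; split.
- by repeat case: eqP; clear -h1 h2 h3 h4 gab; lia.
- case: eqP => [->|]; last by left.
  case: xa => [->|Dx]; [by left | right; split=> //].
  by case/orP: Sa => // /eqP a0; move: (chord_edges_lt _ _ Dx); clear -a0; lia.
- case: eqP => [->|]; last by left.
  case: yb => [->|Dy]; [by left | right; split=> //].
  by case/orP: Sb => // /eqP bn; move: (chord_edges_lt _ _ Dy); clear -bn; lia.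
Qed.

Theorem triangulation_edge_set : (forall v, A v -> pointed_vertex T v) ->
  edge_set n D S.
Proof.
move=> pt; split.
- exact: chord_edges_lt.
- by move=> j /asboolP[].
- exact: chord_edges_nocross.
- by move=> i j k; exact: chord_edges_pointed.
- exact: chord_edges_base.
- exact: chord_edges_above.
Qed.

Theorem triangulation_faces : (forall v, A v -> pointed_vertex T v) ->
  T = faces D S.
Proof.
move=> pt; have E := triangulation_edge_set pt; apply/seteqP; split=> P.
  move=> TP; have [m [f fP]] := cell_polygon P TP.
  have [c [m' [f' [vc [fP' _] tr]]]] := face_classification n q p hc gp P m f (tri P TP) fP
    (cell_path_in P m f TP fP) (fun z Az => point_off_interior z P Az TP).
  by exists c; split; [exact: (cell_is_face P c m' f') | exists m', f'].
move=> [c [F [m [f [fP tr]]]]].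
have [u [v low]] := ex_lower_side n D S c F.
have Duv : D u v.
  have sd := lower_side_of _ _ _ low.
  have := face_valid n D S E c F; case: c F low {tr sd} => [i j k|x a b y] F.
    by move=> [-> ->] _; case: F.
  by move=> [g gab [-> ->]] _; case: F => _ _ _ _; apply.
have [P' [c' [m' [f' [TP' vc' [fP' _] tr' low']]]]] := cell_above u v Duv.
have F' := cell_is_face P' c' m' f' TP' vc' fP' tr'.
have ec := face_unique n D S E u v c c' F F' low low'; subst c'.
by rewrite (face_region_unique n q p hc D S E c m f P m' f' P').
Qed.

End Cells.
End FromTriangulation.

(** * Edge sets give pointed pseudo-triangulations *)

Section ToTriangulation.
Context {R : realType}.
Implicit Types (z : (R * R)%type) (P Q : set (R * R)) (f : nat -> R * R)
  (c : cell) (s t : R).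
Variables (n : nat) (q : nat -> R * R) (p : R * R).
Hypothesis hc : chain n q p.
Hypothesis gp : general_position (chain_set n q p).
Variables (D : nat -> nat -> bool) (S : nat -> bool).
Hypothesis E : edge_set n D S.
Local Notation A := (chain_set n q p).
Local Notation pos := (pos q p).
Local Notation above := (above q).
Local Notation column := (column q p).
Local Notation generic := (generic n q p).
Local Notation is_face := (is_face n D S).
Local Notation T := (faces n q p D S).
Let n0 : (0 < n)%N. Proof. by case: hc. Qed.
Let Dlt := edge_lt _ _ _ E.
Let nocross := edge_nocross _ _ _ E.

Lemma face_in_faces c : is_face c ->
  exists m f P, [/\ T P, polygon m f P & traces q p f c].
Proof.
move=> F; have [m [f [P [[fP _] tr _]]]] := face_region n q p hc gp D S E c F.
by exists m, f, P; split=> //; exists c; split=> //; exists m, f.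
Qed.

Lemma faces_pseudo_triangle P : T P -> pseudo_triangle P.
Proof.
move=> [c [F [m [f [fP tr]]]]].
have [m' [f' [P' [[fP' _] tr' tP']]]] := face_region n q p hc gp D S E c F.
by rewrite (face_region_unique n q p hc D S E c m f P m' f' P').
Qed.

Lemma lower_side_drawn c u v : is_face c -> lower_side c u v -> D u v.
Proof.
by case: c => [i j k|x a b y] /= [] => [_ _ Dik|_ _ _ _ lo]; [move=> [-> ->] | move=> [g gab [-> ->]]; exact: lo].
Qed.

(** An edge between the lower side and z would be inside the upper side of the
    face, so that z would be above the latter. *)
Lemma faces_lower_side c m f P z : is_face c -> polygon m f P ->
  traces q p f c -> P z -> generic z -> exists g u v,
  [/\ (g < n)%N /\ column g z, lower_side c u v, (u <= g < v)%N, above u v z &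
    forall u' v', D u' v' -> (u' <= g < v')%N -> above u' v' z ->
      (u <= u')%N -> (v' <= v)%N -> (u, v) = (u', v')].
Proof.
move=> F fP tr Pz gz.
have fA := face_path_in n q p D S E c f F tr.
have [g gn cg] := generic_column n q p hc m f P z fP fA Pz gz.
have [[u [v [low guv]]]|none] := pselect (exists u v, lower_side c u v /\ (u <= g < v)%N).
  have [az up] := (face_memberP n q p hc D S E c m f P F fP tr g u v gn low guv z gz cg).1 Pz.
  exists g, u, v; split=> // u' v' D' guv' az' uu' v'v.
  apply: contrapT => ne.
  have [u2 [v2 [hu D2 l1 l2]]] := upper_side_max n D S E c u v g u' v' F low D' uu' guv' v'v ne.
  case: (up u2 v2 hu); apply: (above_mono n q p hc g z u2 v2 u' v') => //.
  - by clear -l1 guv'; lia.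
  - by clear -l2 guv'; lia.
  - by have := Dlt _ _ D2; clear; lia.
case: (face_member_none n q p hc D S E c m f P F fP tr g z gn cg _ Pz) => u v low guv.
by apply: none; exists u, v.
Qed.

Lemma faces_disjoint : trivIset T (fun P => P°).
Proof.
move=> P P' [c [F [m [f [fP tr]]]]] [c' [F' [m' [f' [fP' tr']]]]] [z [Pz Pz']].
suff e : c = c' by subst c'; exact: (face_region_unique n q p hc D S E c m f P m' f' P').
have [y yU gy] := near_generic n q p hc z _ (filterI Pz Pz').
have [Py Py'] := nbhs_singleton yU.
have [g [u [v [[gn cg] low guv az hi]]]] := faces_lower_side c m f P y F fP tr Py gy.
have [g' [u' [v' [[gn' cg'] low' guv' az' hi']]]] := faces_lower_side c' m' f' P' y F' fP' tr' Py' gy.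
have eg : g = g'.
  have [gl gr] := cg; have [gl' gr'] := cg'.
  have := column_over n q p hc g y g' g'.+1 gn cg ltac:(clear -gn'; lia) gn' gl' gr'.
  by clear; lia.
subst g'; have Duv := lower_side_drawn c u v F low; have Duv' := lower_side_drawn c' u' v' F' low'.
suff [eu ev] : u = u' /\ v = v'.
  by subst u' v'; exact: (face_unique n D S E u v c c').
have n1 := nocross _ _ _ _ Duv Duv'; have n2 := nocross _ _ _ _ Duv' Duv.
have [[h1 h2]|[h1 h2]] : ((u <= u') /\ (v' <= v) \/ (u' <= u) /\ (v <= v'))%N.
- by clear -n1 n2 guv guv'; lia.
- by case: (hi u' v' Duv' guv' az' h1 h2).
- by case: (hi' u v Duv guv az h1 h2).
Qed.

(** It is the face above the highest edge below z. *)
Lemma generic_covered z : generic z -> 0 < orient p (q 0%N) z ->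
  orient p (q n) z < 0 -> 0 < orient (q 0%N) (q n) z -> exists2 P, T P & P z.
Proof.
move=> gz o0 on a0.
have [g gn cg] := ex_column n q p z gz o0 on.
have [u [v [[Duv guv az] hmin]]] : exists u v,
    [/\ D u v, (u <= g < v)%N & above u v z] /\ forall u' v', D u' v' ->
    (u' <= g < v')%N -> above u' v' z -> (v - u <= v' - u')%N.
  pose h d := `[< exists u v, [/\ D u v, (u <= g < v)%N & above u v z] /\ (v - u)%N = d >].
  have exh : exists d, h d.
    exists (n - 0)%N; apply/asboolP; exists 0%N, n; split=> //; split=> //.
    exact: (edge_base _ _ _ E).
  case: (ex_minnP exh) => d /asboolP[u [v [huv <-]]] dmin.
  exists u, v; split=> // u' v' D' guv' az'; apply: dmin; apply/asboolP.
  by exists u', v'.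
have [c [F low]] := face_above n D S E u v Duv.
have [m [f [P [TP fP tr]]]] := face_in_faces c F; exists P => //.
apply/(face_memberP n q p hc D S E c m f P F fP tr g u v gn low guv z gz cg).
split=> // i j hu aij.
have [sd s2 s3 ne] := upper_side_of n D S E c u v g i j F low guv hu.
have ij : (i < j <= n)%N by have := Dlt _ _ Duv; clear -s2 s3; lia.
have Dij : D i j.
  case: sd => /(face_drawn n D S E c _ _ F)[[i' [j' [D' [[[ei] [ej]]|[[ei] [ej]]]]]]|[i' _ [[//]|[_ //]]]];
    subst i' j' => //; have := Dlt _ _ D'; clear -ij; lia.
have := hmin i j Dij ltac:(clear -s2 s3; lia) aij.
suff : (i = u /\ j = v) -> False by clear -s2 s3 guv; lia.
by move=> [ei ej]; apply: ne; rewrite ei ej.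
Qed.

Lemma near_faces z : (forall P, T P -> ~ P z) ->
  \forall y \near z, forall P, T P -> ~ P y.
Proof.
move=> nz.
have near1 : \forall y \near z, forall u, (u < n.+1)%N -> forall v, (v < n.+1)%N ->
    forall c m f P, is_face c -> polygon m f P -> traces q p f c ->
    lower_side c u v -> ~ P y.
  apply: (near_ltn _ (fun u y => forall v, (v < n.+1)%N ->
    forall c m f P, is_face c -> polygon m f P -> traces q p f c ->
    lower_side c u v -> ~ P y)) => u _.
  apply: (near_ltn _ (fun v y => forall c m f P, is_face c -> polygon m f P ->
    traces q p f c -> lower_side c u v -> ~ P y)) => v _.
  have [[c [m [f [P [[F fP tr] low]]]]]|none] := pselect (exists c m f P,
    [/\ is_face c, polygon m f P & traces q p f c] /\ lower_side c u v); last first.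
    near=> y => c m f P F fP tr low; case: none; exists c, m, f, P; by split.
  have Pz : (~` P) z.
    by apply: nz; exists c; split=> //; exists m, f.
  have [_ Pf] := fP.
  have : nbhs z (~` P).
    by apply: open_nbhs_nbhs; split=> //; exact/closed_openC/(region_closed f P Pf).
  apply: filterS => y nPy c' m' f' P' F' fP' tr' low'.
  have e := face_unique n D S E u v c c' F F' low low'; subst c'.
  by rewrite -(face_region_unique n q p hc D S E c m f P m' f' P').
apply: filterS near1 => y hy P [c [F [m [f [fP tr]]]]].
have [u [v low]] := ex_lower_side n D S c F.
have := Dlt _ _ (lower_side_drawn c u v F low) => uv.
apply: (hy u _ v _ c m f P) => //; clear -uv; lia.
Unshelve. all: by end_near. Qed.

Lemma faces_cover : \bigcup_(P in T) P = hull A.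
Proof.
apply/seteqP; split=> [z [P [c [F [m [f [fP tr]]]]] Pz]|z /(hullP n q p hc)[h1 h2 h3]].
  have fA := face_path_in n q p D S E c f F tr.
  by apply/(hullP n q p hc); exact: (region_in_hull n q p hc m f P z fP fA Pz).
apply: contrapT => nz.
have nT : forall P, T P -> ~ P z by move=> P TP Pz; apply: nz; exists P.
have := near_faces z nT.
(* a point strictly inside the triangle, to move z inside *)
pose w := lerp (lerp (q 0%N) (q n) 2^-1) p 2^-1.
have o3 : 0 < orient p (q 0%N) (q n) by apply: (tip_pos n q p hc); rewrite n0 leqnn.
have w1 : 0 < orient p (q 0%N) w.
  by rewrite /w !orient_lerp orient_aba orient_abb; lra.
have w2 : orient p (q n) w < 0.
  by rewrite /w !orient_lerp orient_aba orient_abb (orient_flip p (q 0%N) (q n)); lra.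
have w3 : 0 < orient (q 0%N) (q n) w.
  by rewrite /w !orient_lerp orient_aba orient_abb (orient_cyc p); lra.
rewrite -{1}(lerp0 z w) => nm; have [e e0 he] := near_lerp z w 0 _ nm.
have [s [s0 se s1]] := ex_smaller e 1 e0 ltr01.
have z1 : 0 < orient p (q 0%N) (lerp z w s) by rewrite orient_lerp; nra.
have z2 : orient p (q n) (lerp z w s) < 0 by rewrite orient_lerp; nra.
have z3 : 0 < orient (q 0%N) (q n) (lerp z w s) by rewrite orient_lerp; nra.
have nT' : forall P, T P -> ~ P (lerp z w s) by apply: he; rewrite subr0 gtr0_norm.
have [y yU gy] := near_generic n q p hc (lerp z w s) _ (filterI (near_faces _ nT')
  (filterI (near_pos _ _ (continuous_orient _ _) z1)
  (filterI (near_neg _ _ (continuous_orient _ _) z2) (near_pos _ _ (continuous_orient _ _) z3)))).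
have [nTy [y1 [y2 y3]]] := nbhs_singleton yU.
by have [P TP Py] := generic_covered y gy y1 y2 y3; exact: (nTy P).
Qed.

(** The neighbours of the tip, including the two extreme ones. *)
Definition tip_neighbour j := [|| j == 0%N, j == n | S j].

Lemma fan_tips x a b y : is_face (Fan x a b y) -> tip_neighbour a /\ tip_neighbour b.
Proof.
by move=> [_ Sa Sb _ _]; rewrite /tip_neighbour; case/orP: Sa => ->; case/orP: Sb => ->;
  rewrite ?orbT.
Qed.

Lemma tip_fan j : (j <= n)%N -> tip_neighbour j -> exists x a b y,
  is_face (Fan x a b y) /\ (j = a \/ j = b).
Proof.
move=> jn tj; have [en|ne] := eqVneq j n.
  have [x [a [b [y [F gab]]]]] := fan_ex n D S E n.-1 ltac:(clear -n0; lia).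
  have [_ _ h3 h4] := face_valid n D S E _ F.
  by exists x, a, b, y; split=> //; right; clear -en gab h3 h4; lia.
have [x [a [b [y [F jab]]]]] := fan_ex n D S E j ltac:(clear -jn ne; lia).
exists x, a, b, y; split=> //; left; apply/eqP/negP => /negP ja.
have [nS _] := fan_mid n D S E x a b y j F ltac:(clear -ja jab; lia).
by move: tj; rewrite /tip_neighbour (negbTE nS) (negbTE ne) orbF; clear -ja jab; lia.
Qed.

Lemma faces_chord i j : D i j -> edge T (q i) (q j).
Proof.
move=> Dij; have [c [F low]] := face_above n D S E i j Dij.
have [m [f [P [TP fP tr]]]] := face_in_faces c F; exists P => //.
have [k [e1 e2]] := tr.2 _ _ (lower_side_of c i j low).
by apply/sideP; exists m, f; split=> //; exists k; rewrite e1 e2.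
Qed.

Lemma faces_tip j : (j <= n)%N -> tip_neighbour j -> edge T p (q j).
Proof.
move=> jn /(tip_fan j jn)[x [a [b [y [F jab]]]]].
have [m [f [P [TP fP tr]]]] := face_in_faces _ F; exists P => //.
apply/sideP; exists m, f; split=> //; case: jab => ->.
  have [k [e1 e2]] := tr.2 None (Some a) (Or31 _ _ (or_introl (conj erefl erefl))).
  by exists k; rewrite e1 e2.
have [k [e1 e2]] := tr.2 (Some b) None (Or31 _ _ (or_intror (conj erefl erefl))).
by exists k; rewrite e1 e2 setUC.
Qed.

Lemma faces_edge x y : edge T x y ->
  (exists i j, D i j /\ [set x; y] = [set q i; q j]) \/
  (exists j, [/\ (j <= n)%N, tip_neighbour j & [set x; y] = [set p; q j]]).
Proof.
move=> [P [c [F [m [f [fP tr]]]]] /(side_vertices A m f P x y gp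
  (face_path_in n q p D S E c f F tr) fP)[k ->]].
have [v [w [sd -> ->]]] := tr.1 k.
have := face_valid n D S E c F.
case: c F sd {fP tr} => [i j k'|x' a b y'] F /=.
  have [D1 D2 D3] := F; move=> sd _; left; case: sd => -[-> ->].
  - by exists i, k'.
  - by exists j, k'; rewrite setUC.
  - by exists i, j; rewrite setUC.
have [ta tb] := fan_tips _ _ _ _ F; have [_ _ _ [xa yb] lo] := F.
move=> sd [h1 h2 h3 h4]; case: sd => [[] [-> ->]|[] [lt -> ->]|[g gab [-> ->]]].
- by right; exists a; split=> //; clear -h2 h3 h4; lia.
- by right; exists b; split; rewrite 1?setUC//; clear -h3 h4; lia.
- left; exists x', a; rewrite setUC; split=> //.
  by case: xa => // e; clear -e lt; lia.
- left; exists b, y'; rewrite setUC; split=> //.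
  by case: yb => // e; clear -e lt; lia.
- by left; exists (fan_left x' a g), (fan_right b y' g); split=> //; exact: lo.
Qed.

Lemma faces_tip_edge x : edge T p x -> exists j, [/\ (j <= n)%N, tip_neighbour j & x = q j].
Proof.
move=> /faces_edge[[i [j [Dij e]]]|[j [jn tj e]]].
  have ij := Dlt _ _ Dij.
  have ni := tip_neq n q p hc i ltac:(clear -ij; lia).
  have nj := tip_neq n q p hc j ltac:(clear -ij; lia).
  by case: (set2_eq _ _ _ _ e) => -[h _]; [case: ni | case: nj].
exists j; split=> //; case: (set2_eq _ _ _ _ e) => -[h1 h2] //.
by case: (tip_neq n q p hc j jn).
Qed.

Lemma faces_chain_edge j x : (j <= n)%N -> edge T (q j) x ->
  [\/ exists2 i, D i j & x = q i, exists2 k, D j k & x = q k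
    | tip_neighbour j /\ x = p].
Proof.
move=> jn /faces_edge[[i [k [Dik e]]]|[k [kn tk e]]].
  have ik := Dlt _ _ Dik.
  have il : (i <= n)%N by clear -ik; lia.
  have kl : (k <= n)%N by clear -ik; lia.
  case: (set2_eq _ _ _ _ e) => -[/(chain_inj n q p hc _ _ jn) h ->].
    by apply: Or32; exists k; rewrite ?h.
  by apply: Or31; exists i; rewrite ?h.
case: (set2_eq _ _ _ _ e) => -[h ->]; first by case: (tip_neq n q p hc j jn).
by apply: Or33; rewrite (chain_inj n q p hc _ _ jn kn h).
Qed.

Lemma chord_edgesE : chord_edges n q T = D.
Proof.
apply/funext => i; apply/funext => j; apply/asboolP/idP => [[ij e]|Dij].
  have il : (i <= n)%N by clear -ij; lia.
  have jl : (j <= n)%N by clear -ij; lia.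
  case: (faces_chain_edge i (q j) il e) => [[k D' h]|[k D' h]|[_ h]].
  - have kn : (k <= n)%N by have := Dlt _ _ D'; clear; lia.
    have := chain_inj n q p hc _ _ jl kn h; have := Dlt _ _ D'; clear -ij; lia.
  - have kn : (k <= n)%N by have := Dlt _ _ D'; clear; lia.
    by rewrite (chain_inj n q p hc _ _ jl kn h).
  - by case: (tip_neq n q p hc j jl).
by split; [exact: Dlt | exact: faces_chord].
Qed.

Lemma tip_edgesE : tip_edges n q p T = S.
Proof.
apply/funext => j; apply/asboolP/idP => [[j0n /faces_tip_edge[k [kn tk h]]]|Sj].
  have jl : (j <= n)%N by clear -j0n; lia.
  have ej := chain_inj n q p hc _ _ jl kn h; subst k.
  by move: tk; rewrite /tip_neighbour; case: (S j); rewrite ?orbT// orbF; clear -j0n; lia.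
have jn := tip_lt _ _ _ E j Sj; split=> //; apply: faces_tip; first by clear -jn; lia.
by rewrite /tip_neighbour Sj !orbT.
Qed.

Lemma faces_vertices : \bigcup_(P in T) vertices P = A.
Proof.
apply/seteqP; split=> [z [P [c [F [m [f [fP tr]]]]]]|z].
  move=> /verticesP[m' [g [gP [j <-]]]].
  have [k <-] := vertex_unique m f m' g P fP gP j.
  exact: (face_path_in n q p D S E c f F tr).
have from P x y : T P -> side P x y -> (\bigcup_(P in T) vertices P) x.
  move=> TP /sideP[m [f [fP [k e]]]]; exists P => //; apply/verticesP.
  exists m, f; split=> //; case: (set2_eq _ _ _ _ e) => -[-> _].
    by exists k.
  by exists k.+1.
have from_edge x y : edge T x y -> (\bigcup_(P in T) vertices P) x.
  by move=> [P TP h]; exact: from h.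
have sym := edge_sym T.
have D0n := edge_base _ _ _ E.
move=> /(pos_onto n q p)[[j|] /= jn ->]; last first.
  by apply: (from_edge p (q 0%N)); apply: faces_tip; rewrite /tip_neighbour ?eqxx.
have [->|j0] := eqVneq j 0%N; first by apply: (from_edge _ (q n)); exact: faces_chord.
have [->|jn'] := eqVneq j n; first by apply: (from_edge _ (q 0%N)); apply: sym; exact: faces_chord.
have [[Sj _]|[i [k [Dij _]]]] := interior_point n D S E j ltac:(clear -j0 jn jn'; lia).
  by apply: (from_edge _ p); apply: sym; apply: faces_tip => //; rewrite /tip_neighbour Sj !orbT.
by apply: (from_edge _ (q i)); apply: sym; exact: faces_chord.
Qed.

Theorem faces_pseudo_triangulation : pseudo_triangulation A T.
Proof.
split; [exact: faces_pseudo_triangle | exact: faces_disjoint | exact: faces_cover |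
  exact: faces_vertices].
Qed.

Lemma orient_chain i j k : (i < j < k)%N -> (k <= n)%N ->
  [/\ 0 < orient (q j) (q i) (q k), 0 < orient (q k) (q j) (q i)
    & 0 < orient (q i) (q k) (q j)].
Proof.
move=> ijk kn; have h := chord_in n q p hc i k j ijk kn.
by split=> //; [rewrite -orient_cyc | rewrite orient_cyc].
Qed.

Lemma orient_tip i j : (i < j <= n)%N ->
  0 < orient (q i) (q j) p /\ 0 < orient (q j) p (q i).
Proof.
by move=> h; have := tip_pos n q p hc i j h; split; [rewrite orient_cyc | rewrite -orient_cyc].
Qed.

(** Counterclockwise around q j come its neighbours to the left, from near to far,
    then those to the right, from far to near, and then the tip. At an interior
    point of the chain one of these three groups is missing, which leaves an
    angle greater than pi. *)
Lemma faces_pointed z : A z -> pointed_vertex T z.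
Proof.
have sym := edge_sym T.
have D0n := edge_base _ _ _ E.
have n0n : (0 < n <= n)%N by rewrite n0 leqnn.
have t0 : edge T p (q 0%N) by apply: faces_tip; rewrite // /tip_neighbour eqxx.
have tn : edge T p (q n) by apply: faces_tip; rewrite // /tip_neighbour eqxx orbT.
move=> /(pos_onto n q p)[[j|] /= jn ->]; last first.
  exists (q n), (q 0%N); split=> //; first exact: (tip_neg n q p hc).
  move=> x /faces_tip_edge[j [jln tj ->]] xn x0.
  have j0 : j <> 0%N by move=> e; apply: x0; rewrite e.
  have jn1 : j <> n by move=> e; apply: xn; rewrite e.
  by split; apply: (tip_pos n q p hc); clear -j0 jln jn1; lia.
have [j0|j0] := posnP j.
  subst j; have [turn1 turn2] := orient_tip 0 n n0n.
  exists p, (q n); split; [exact: sym | exact: faces_chord | by rewrite orient_flip oppr_lt0|].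
  move=> x /(faces_chain_edge 0 x jn)[[i D' _]|[k D' ->]|[_ ->//]] _ xn.
    by have := Dlt _ _ D'; clear; lia.
  have kn := Dlt _ _ D'; have kn' : k <> n by move=> e; apply: xn; rewrite e.
  have [h1 h2 h3] := orient_chain 0 k n ltac:(clear -kn kn'; lia) (leqnn n).
  by have [h4 h5] := orient_tip 0 k kn.
have [jn'|jn'] := eqVneq j n.
  subst j; have [turn1 turn2] := orient_tip 0 n n0n.
  exists (q 0%N), p; split; [by apply: sym; exact: faces_chord | exact: sym | by rewrite orient_flip oppr_lt0|].
  move=> x /(faces_chain_edge n x jn)[[i D' ->]|[k D' _]|[_ ->//]] x0 _; last first.
    by have := Dlt _ _ D'; clear; lia.
  have kn := Dlt _ _ D'; have i0 : i <> 0%N by move=> e; apply: x0; rewrite e.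
  have [h1 h2 h3] := orient_chain 0 i n ltac:(clear -kn i0; lia) (leqnn n).
  by have [h4 h5] := orient_tip i n kn.
have j0n : (0 < j < n)%N by clear -j0 jn jn'; lia.
have tjS : tip_neighbour j -> S j.
  by rewrite /tip_neighbour (negbTE jn'); case: (S j); rewrite ?orbT// orbF; clear -j0; lia.
have ltn k : D k j -> (k <= n)%N by move/Dlt; clear; lia.
have gtn k : D j k -> (k <= n)%N by move/Dlt; clear; lia.
have [Sj|nSj] := boolP (S j).
  have pj : edge T (q j) p.
    by apply: sym; apply: faces_tip => //; rewrite /tip_neighbour Sj !orbT.
  have [[i0 Di0]|nol] := pselect (exists i, D i j).
    have nor k : ~ D j k by move=> D'; exact: (edge_pointed _ _ _ E i0 j k).
    case: (ex_minnP (ex_intro (fun i => D i j) i0 Di0)) => i Dij imin.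
    have [turn1 turn2] := orient_tip i j (Dlt _ _ Dij).
    exists (q i), p; split=> //; first by apply: sym; exact: faces_chord.
      by rewrite orient_flip oppr_lt0.
    move=> x /(faces_chain_edge j x jn)[[k D' ->]|[k D' _]|[_ ->//]] xi _; last by case: (nor k).
    have ki : k <> i by move=> e; apply: xi; rewrite e.
    have kj := Dlt _ _ D'; have ik := imin k D'.
    have [h1 h2 h3] := orient_chain i k j ltac:(clear -ki kj ik; lia) jn.
    by have [h4 h5] := orient_tip k j kj.
  have [k0 Dk0] : exists k, D j k.
    have [[_ [k [h|h]]]|[i [k [h _]]]] := interior_point n D S E j j0n.
    - by case: nol; exists k.
    - by exists k.
    - by case: nol; exists i.
  case: (ex_maxnP (ex_intro (fun k => D j k) k0 Dk0) gtn) => k Djk kmax.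
  have [turn1 turn2] := orient_tip j k (Dlt _ _ Djk).
  exists p, (q k); split=> //; first exact: faces_chord.
    by rewrite orient_flip oppr_lt0.
  move=> x /(faces_chain_edge j x jn)[[i D' _]|[i D' ->]|[_ ->//]] _ xk.
    by case: nol; exists i.
  have ik : i <> k by move=> e; apply: xk; rewrite e.
  have ji := Dlt _ _ D'; have kn := Dlt _ _ Djk; have lek := kmax i D'.
  have [h1 h2 h3] := orient_chain j i k ltac:(clear -ik ji lek; lia) ltac:(clear -kn; lia).
  by have [h4 h5] := orient_tip j i ji.
have [[Sj _]|[i0 [k0 [Di0 Dk0]]]] := interior_point n D S E j j0n.
  by rewrite Sj in nSj.
case: (ex_maxnP (ex_intro (fun i => D i j) i0 Di0) ltn) => i Dij imax.
case: (ex_minnP (ex_intro (fun k => D j k) k0 Dk0)) => k Djk kmin.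
have ij := Dlt _ _ Dij; have jk := Dlt _ _ Djk.
have [turn1 turn2 turn3] := orient_chain i j k ltac:(clear -ij jk; lia) ltac:(clear -jk; lia).
exists (q k), (q i); split; [exact: faces_chord | by apply: sym; exact: faces_chord |
  by rewrite orient_flip oppr_lt0 |].
move=> x /(faces_chain_edge j x jn)[[i' D' ->]|[k' D' ->]|[tj _]] xk xi.
- have ii : i' <> i by move=> e; apply: xi; rewrite e.
  have ij' := Dlt _ _ D'; have lei := imax i' D'.
  have [h1 h2 h3] := orient_chain i' i j ltac:(clear -ii ij lei; lia) jn.
  by have [h4 h5 h6] := orient_chain i' j k ltac:(clear -ij' jk; lia) ltac:(clear -jk; lia).
- have kk : k' <> k by move=> e; apply: xk; rewrite e.
  have jk' := Dlt _ _ D'; have lek := kmin k' D'.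
  have [h1 h2 h3] := orient_chain j k k' ltac:(clear -kk jk lek; lia) ltac:(clear -jk'; lia).
  by have [h4 h5 h6] := orient_chain i j k' ltac:(clear -ij jk'; lia) ltac:(clear -jk'; lia).
- by rewrite (tjS tj) in nSj.
Qed.

Theorem faces_PPT : PPT A T.
Proof. by split; [exact: faces_pseudo_triangulation | exact: faces_pointed]. Qed.

End ToTriangulation.

Theorem PPT_edge_sets {R : realType} n (q : nat -> R * R) p : chain n q p ->
  general_position (chain_set n q p) ->
  PPT (chain_set n q p) #=
    [set E : (nat -> nat -> bool) * (nat -> bool) | edge_set n E.1 E.2].
Proof.
move=> hc gp; apply/card_esym/card_set_bijP.
exists (fun E => faces n q p E.1 E.2); split.
- by move=> [D S] /= E; exact: faces_PPT.
- move=> [D S] [D' S']; rewrite !inE /= => E E' e.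
  congr pair.
    transitivity (chord_edges n q (faces n q p D S)); first by rewrite (chord_edgesE n q p hc gp D S E).
    by rewrite e (chord_edgesE n q p hc gp D' S' E').
  transitivity (tip_edges n q p (faces n q p D S)); first by rewrite (tip_edgesE n q p hc gp D S E).
  by rewrite e (tip_edgesE n q p hc gp D' S' E').
- move=> T [tT pt]; exists (chord_edges n q T, tip_edges n q p T).
    exact: triangulation_edge_set.
  by rewrite -(triangulation_faces n q p hc gp T tT pt).
Qed.

(** * Edge sets as trees *)

(** The face above the base edge splits an edge set into the edge sets above
    its two upper sides: those of a triangle, or those on both sides of the gap
    through which it reaches the tip. The latter may be empty. *)
Inductive tree := Empty | Node of tree & tree | Gap of tree & tree.

HB.instance Definition _ := gen_eqMixin tree.
HB.instance Definition _ := gen_choiceMixin tree.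

Fixpoint gaps t := match t with
  | Empty => 0%N
  | Node l r => (gaps l + gaps r)%N
  | Gap l r => (gaps l + (gaps r).+1)%N
  end.

Fixpoint wf t := match t with
  | Empty => true
  | Node l r => [&& wf l, wf r, 0 < gaps l & 0 < gaps r]%N
  | Gap l r => wf l && wf r
  end.

(** The edges of the tree placed on the points x, ..., x + gaps t. *)
Fixpoint tree_edge t x u v := match t with
  | Empty => false
  | Node l r => [|| (u == x) && (v == x + (gaps l + gaps r))%N,
      tree_edge l x u v | tree_edge r (x + gaps l)%N u v]
  | Gap l r => [|| (u == x) && (v == x + (gaps l + (gaps r).+1))%N,
      tree_edge l x u v | tree_edge r (x + gaps l).+1%N u v]
  end.

Fixpoint tree_tip t x j := match t with
  | Empty => false
  | Node l r => tree_tip l x j || tree_tip r (x + gaps l)%N j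
  | Gap l r => [|| (0 < gaps l)%N && (j == x + gaps l)%N,
      (0 < gaps r)%N && (j == (x + gaps l).+1)%N,
      tree_tip l x j | tree_tip r (x + gaps l).+1%N j]
  end.

Section TreeEdges.
Implicit Types (t l r : tree) (x y u v i j k : nat).

Lemma tree_edge_lt t x u v : wf t -> tree_edge t x u v ->
  (x <= u < v)%N /\ (v <= x + gaps t)%N.
Proof.
elim: t x => [|l IHl r IHr|l IHl r IHr] x //=.
  move=> /and4P[wl wr l0 r0] /or3P[/andP[/eqP-> /eqP->]|/(IHl _ wl)|/(IHr _ wr)].
  - by clear -l0; lia.
  - by clear; lia.
  - by clear; lia.
move=> /andP[wl wr] /or3P[/andP[/eqP-> /eqP->]|/(IHl _ wl)|/(IHr _ wr)].
- by clear; lia.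
- by clear; lia.
- by clear; lia.
Qed.

Lemma tree_tip_lt t x j : wf t -> tree_tip t x j -> (x < j < x + gaps t)%N.
Proof.
elim: t x => [|l IHl r IHr|l IHl r IHr] x //=.
  move=> /and4P[wl wr l0 r0] /orP[/(IHl _ wl)|/(IHr _ wr)].
  - by clear; lia.
  - by clear; lia.
move=> /andP[wl wr] /or4P[/andP[l0 /eqP->]|/andP[r0 /eqP->]|/(IHl _ wl)|/(IHr _ wr)].
- by clear -l0; lia.
- by clear -r0; lia.
- by clear; lia.
- by clear; lia.
Qed.

Lemma tree_edge_base t x : (0 < gaps t)%N -> tree_edge t x x (x + gaps t).
Proof. by case: t => //= l r; rewrite !eqxx. Qed.

Lemma tree_edge_nocross t x u v u' v' : wf t -> tree_edge t x u v ->
  tree_edge t x u' v' -> ~ [&& u < u', u' < v & v < v']%N.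
Proof.
elim: t x => [|l IHl r IHr|l IHl r IHr] x //=.
  move=> /and4P[wl wr l0 r0].
  move=> /or3P[/andP[/eqP-> /eqP->]|hl|hr] /or3P[/andP[/eqP-> /eqP->]|hl'|hr'].
  - by clear; lia.
  - by have := tree_edge_lt l x u' v' wl hl'; clear; lia.
  - by have := tree_edge_lt r _ u' v' wr hr'; clear; lia.
  - by have := tree_edge_lt l x u v wl hl; clear; lia.
  - exact: (IHl x).
  - have := tree_edge_lt l x u v wl hl; have := tree_edge_lt r _ u' v' wr hr'; clear; lia.
  - by have := tree_edge_lt r _ u v wr hr; clear; lia.
  - have := tree_edge_lt l x u' v' wl hl'; have := tree_edge_lt r _ u v wr hr; clear; lia.
  - exact: (IHr (x + gaps l)%N).
move=> /andP[wl wr].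
move=> /or3P[/andP[/eqP-> /eqP->]|hl|hr] /or3P[/andP[/eqP-> /eqP->]|hl'|hr'].
- by clear; lia.
- by have := tree_edge_lt l x u' v' wl hl'; clear; lia.
- by have := tree_edge_lt r _ u' v' wr hr'; clear; lia.
- by have := tree_edge_lt l x u v wl hl; clear; lia.
- exact: (IHl x).
- have := tree_edge_lt l x u v wl hl; have := tree_edge_lt r _ u' v' wr hr'; clear; lia.
- by have := tree_edge_lt r _ u v wr hr; clear; lia.
- have := tree_edge_lt l x u' v' wl hl'; have := tree_edge_lt r _ u v wr hr; clear; lia.
- exact: (IHr (x + gaps l).+1).
Qed.

Lemma tree_edge_pointed t x i j k : wf t -> tree_tip t x j ->
  tree_edge t x i j -> tree_edge t x j k -> False.
Proof.
elim: t x => [|l IHl r IHr|l IHl r IHr] x //=.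
  move=> /and4P[wl wr l0 r0] /orP[hj|hj]; have := tree_tip_lt _ _ _ _ hj => /(_ ltac:(done)) jl.
    move=> /or3P[/andP[_ /eqP e]|hij|/(tree_edge_lt r _ _ _ wr)].
    - by clear -jl e r0; lia.
    - move=> /or3P[/andP[/eqP e _]|hjk|/(tree_edge_lt r _ _ _ wr)].
      + by clear -jl e; lia.
      + exact: (IHl x).
      + by clear -jl; lia.
    - by clear -jl; lia.
  move=> /or3P[/andP[_ /eqP e]|/(tree_edge_lt l _ _ _ wl)|hij].
  - by clear -jl e; lia.
  - by clear -jl; lia.
  - move=> /or3P[/andP[/eqP e _]|/(tree_edge_lt l _ _ _ wl)|hjk].
    + by clear -jl e; lia.
    + by clear -jl; lia.
    + exact: (IHr (x + gaps l)%N).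
move=> /andP[wl wr] /or4P[/andP[l0 /eqP->]|/andP[r0 /eqP->]|hj|hj].
- move=> _ /or3P[/andP[/eqP e _]|/(tree_edge_lt l _ _ _ wl)|/(tree_edge_lt r _ _ _ wr)].
  + by clear -l0 e; lia.
  + by clear; lia.
  + by clear; lia.
- move=> /or3P[/andP[_ /eqP e]|/(tree_edge_lt l _ _ _ wl)|/(tree_edge_lt r _ _ _ wr)].
  + by clear -r0 e; lia.
  + by clear; lia.
  + by clear; lia.
- have jl := tree_tip_lt _ _ _ wl hj.
  move=> /or3P[/andP[_ /eqP e]|hij|/(tree_edge_lt r _ _ _ wr)].
  + by clear -jl e; lia.
  + move=> /or3P[/andP[/eqP e _]|hjk|/(tree_edge_lt r _ _ _ wr)].
    * by clear -jl e; lia.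
    * exact: (IHl x).
    * by clear -jl; lia.
  + by clear -jl; lia.
- have jl := tree_tip_lt _ _ _ wr hj.
  move=> /or3P[/andP[_ /eqP e]|/(tree_edge_lt l _ _ _ wl)|hij].
  + by clear -jl e; lia.
  + by clear -jl; lia.
  + move=> /or3P[/andP[/eqP e _]|/(tree_edge_lt l _ _ _ wl)|hjk].
    * by clear -jl e; lia.
    * by clear -jl; lia.
    * exact: (IHr (x + gaps l).+1).
Qed.

Lemma tree_edge_above t x u v : wf t -> tree_edge t x u v ->
  (exists i, tree_edge t x u i /\ tree_edge t x i v) \/
  (exists a, [/\ (u <= a < v)%N, a = u \/ tree_edge t x u a /\ tree_tip t x a &
                 a.+1 = v \/ tree_edge t x a.+1 v /\ tree_tip t x a.+1]).
Proof.
have mono (D D' : nat -> nat -> bool) (S S' : nat -> bool) :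
    (forall u v, D u v -> D' u v) -> (forall j, S j -> S' j) ->
    (exists i, D u i /\ D i v) \/
    (exists a, [/\ (u <= a < v)%N, a = u \/ D u a /\ S a &
                   a.+1 = v \/ D a.+1 v /\ S a.+1]) ->
    (exists i, D' u i /\ D' i v) \/
    (exists a, [/\ (u <= a < v)%N, a = u \/ D' u a /\ S' a &
                   a.+1 = v \/ D' a.+1 v /\ S' a.+1]).
  move=> hD hS [[i [h1 h2]]|[a [h1 h2 h3]]].
    by left; exists i; split; exact: hD.
  right; exists a; split=> //.
    by case: h2 => [|[/hD ? /hS ?]]; [left | right].
  by case: h3 => [|[/hD ? /hS ?]]; [left | right].
elim: t x => [|l IHl r IHr|l IHl r IHr] x //=.
  move=> /and4P[wl wr l0 r0] /or3P[/andP[/eqP-> /eqP->]|hl|hr].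
  - left; exists (x + gaps l)%N; split.
      by rewrite tree_edge_base// orbT.
    by rewrite addnA tree_edge_base// !orbT.
  - by apply: (mono (tree_edge l x) (tree_edge (Node l r) x) (tree_tip l x)
      (tree_tip (Node l r) x) _ _ (IHl x wl hl)) => [u' v'|j] /= ->; rewrite ?orbT.
  - by apply: (mono (tree_edge r (x + gaps l)) (tree_edge (Node l r) x) (tree_tip r (x + gaps l))
      (tree_tip (Node l r) x) _ _ (IHr _ wr hr)) => [u' v'|j] /= ->; rewrite ?orbT.
move=> /andP[wl wr] /or3P[/andP[/eqP-> /eqP->]|hl|hr].
- right; exists (x + gaps l)%N; split.
  + by clear; lia.
  + have [l0|l0] := posnP (gaps l); first by left; rewrite l0 addn0.
    by right; rewrite tree_edge_base// !eqxx !orbT; split.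
  + have [r0|r0] := posnP (gaps r); first by left; rewrite r0 addnS addn0 addnS.
    right; rewrite !eqxx !orbT /=.
    have -> : (x + (gaps l + (gaps r).+1) = (x + gaps l).+1 + gaps r)%N by clear; lia.
    by rewrite tree_edge_base// !orbT; split.
- by apply: (mono (tree_edge l x) (tree_edge (Gap l r) x) (tree_tip l x)
      (tree_tip (Gap l r) x) _ _ (IHl x wl hl)) => [u' v'|j] /= ->; rewrite ?orbT.
- by apply: (mono (tree_edge r (x + gaps l).+1) (tree_edge (Gap l r) x) (tree_tip r (x + gaps l).+1)
      (tree_tip (Gap l r) x) _ _ (IHr _ wr hr)) => [u' v'|j] /= ->; rewrite ?orbT.
Qed.

Theorem tree_edge_set t : wf t -> (0 < gaps t)%N ->
  edge_set (gaps t) (tree_edge t 0) (tree_tip t 0).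
Proof.
move=> wt t0; split.
- by move=> u v /(tree_edge_lt t 0 u v wt); clear; lia.
- by move=> j /(tree_tip_lt t 0 j wt).
- by move=> u v u' v'; exact: tree_edge_nocross.
- by move=> i j k; exact: tree_edge_pointed.
- exact: (tree_edge_base t 0 t0).
- by move=> u v; exact: tree_edge_above.
Qed.

End TreeEdges.

Section Describes.
Implicit Types (t l r : tree) (x y u v i j k : nat).
Variables (n : nat) (D : nat -> nat -> bool) (S : nat -> bool).
Hypothesis E : edge_set n D S.
Let Dlt := edge_lt _ _ _ E.
Let nocross := edge_nocross _ _ _ E.

Definition describes t x :=
  (forall u v, (x <= u)%N -> (v <= x + gaps t)%N -> D u v = tree_edge t x u v) /\
  (forall j, (x < j < x + gaps t)%N -> S j = tree_tip t x j).

Lemma describes_base t x : (0 < gaps t)%N -> describes t x -> D x (x + gaps t)%N.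
Proof. by move=> t0 [h _]; rewrite h// tree_edge_base. Qed.

Lemma describes_Node l r x : wf (Node l r) -> describes (Node l r) x ->
  [/\ describes l x, describes r (x + gaps l), D x (x + gaps l)%N &
    D (x + gaps l)%N (x + (gaps l + gaps r))%N].
Proof.
move=> /= /and4P[wl wr l0 r0] [hD hS].
have nl u v : (x + gaps l <= u)%N -> tree_edge l x u v = false.
  by move=> h; apply/negP => /(tree_edge_lt l x u v wl); clear -h; lia.
have nr u v : (v <= x + gaps l)%N -> tree_edge r (x + gaps l) u v = false.
  by move=> h; apply/negP => /(tree_edge_lt r _ u v wr); clear -h; lia.
have dl : describes l x.
  split=> [u v xu vl|j jl].
    rewrite hD//=; last by clear -vl; lia.
    by rewrite nr// orbF; case: eqP => //= _; case: eqP => //= e; clear -e vl r0; lia.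
  rewrite hS/=; last by clear -jl; lia.
  case h: (tree_tip r _ j); rewrite ?orbF//.
  by have := tree_tip_lt r _ j wr h; clear -jl; lia.
have dr : describes r (x + gaps l).
  split=> [u v xu vl|j jl].
    rewrite hD//=; [|by clear -xu; lia|by clear -vl; lia].
    by rewrite nl//; case: eqP => //= e; clear -e xu l0; lia.
  rewrite hS/=; last by clear -jl; lia.
  case h: (tree_tip l _ j) => //.
  by have := tree_tip_lt l _ j wl h; clear -jl; lia.
by split=> //; [exact: describes_base | rewrite addnA; exact: describes_base].
Qed.

Lemma describes_Gap l r x : wf (Gap l r) -> describes (Gap l r) x ->
  [/\ describes l x, describes r (x + gaps l).+1 &
    gap_edge D S (x + gaps l) x (x + (gaps l + (gaps r).+1))%N].
Proof.
move=> wg; have dg := describes_base (Gap l r) x ltac:(rewrite /=; clear; lia).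
move=> d; have {}dg := dg d; move: wg d dg => /= /andP[wl wr] [hD hS] dg.
have nl u v : (x + gaps l < u)%N -> tree_edge l x u v = false.
  by move=> h; apply/negP => /(tree_edge_lt l x u v wl); clear -h; lia.
have nr u v : (v <= x + gaps l)%N -> tree_edge r (x + gaps l).+1 u v = false.
  by move=> h; apply/negP => /(tree_edge_lt r _ u v wr); clear -h; lia.
have dl : describes l x.
  split=> [u v xu vl|j jl].
    rewrite hD//=; last by clear -vl; lia.
    by rewrite nr// orbF; case: eqP => //= _; case: eqP => //= e; clear -e vl; lia.
  rewrite hS/=; last by clear -jl; lia.
  have -> : (j == x + gaps l)%N = false by clear -jl; lia.
  have -> : (j == (x + gaps l).+1)%N = false by clear -jl; lia.
  rewrite !andbF /=; case h: (tree_tip r _ j); rewrite ?orbF//.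
  by have := tree_tip_lt r _ j wr h; clear -jl; lia.
have dr : describes r (x + gaps l).+1.
  split=> [u v xu vl|j jl].
    rewrite hD//=; [|by clear -xu; lia|by clear -vl; lia].
    by rewrite nl//; case: eqP => //= e; clear -e xu; lia.
  rewrite hS/=; last by clear -jl; lia.
  have -> : (j == x + gaps l)%N = false by clear -jl; lia.
  have -> : (j == (x + gaps l).+1)%N = false by clear -jl; lia.
  rewrite !andbF /=; case h: (tree_tip l _ j) => //.
  by have := tree_tip_lt l _ j wl h; clear -jl; lia.
split=> //; split=> //; first by clear; lia.
  have [l0|l0] := posnP (gaps l); first by left; rewrite l0 addn0.
  right; split; first exact: describes_base.
  by rewrite hS /= ?l0 ?eqxx//; clear -l0; lia.
have [r0|r0] := posnP (gaps r); first by left; rewrite r0 addnS addn0 addnS.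
right; split; last by rewrite hS /= ?r0 ?eqxx ?orbT//; clear -r0; lia.
have -> : (x + (gaps l + (gaps r).+1) = (x + gaps l).+1 + gaps r)%N by clear; lia.
exact: describes_base.
Qed.

(** The gap through which the tip sees the base edge is unique, and it excludes a
    triangle above the base edge; two triangles there would cross. *)
Lemma describes_unique t t' x : wf t -> wf t' -> gaps t = gaps t' ->
  describes t x -> describes t' x -> t = t'.
Proof.
have node_gap l r l' r' y : wf (Node l r) -> wf (Gap l' r') ->
    gaps (Node l r) = gaps (Gap l' r') -> describes (Node l r) y ->
    describes (Gap l' r') y -> False.
  move=> w w' eg /(describes_Node _ _ _ w)[_ _ D1 D2] /(describes_Gap _ _ _ w')[_ _ G].
  move: w eg; rewrite /= => /and4P[_ _ l0 r0] eg; rewrite eg in D2.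
  have [lt|le] := ltnP (y + gaps l') (y + gaps l).
    by have := gap_edge_min n D S E _ _ _ _ _ G D1; clear -lt eg r0; lia.
  by have := gap_edge_min n D S E _ _ _ _ _ G D2; clear -le eg l0; lia.
elim: t t' x => [|l IHl r IHr|l IHl r IHr] [|l' r'|l' r'] x // w w' eg d d'.
- by exfalso; move: w' eg => /= /and4P[_ _]; clear; lia.
- by exfalso; move: eg => /=; clear; lia.
- by exfalso; move: w eg => /= /and4P[_ _]; clear; lia.
- have [dl dr D1 D2] := describes_Node _ _ _ w d.
  have [dl' dr' D1' D2'] := describes_Node _ _ _ w' d'.
  move: w w' eg => /= /and4P[wl wr l0 r0] /and4P[wl' wr' l0' r0'] eg.
  have c1 := nocross _ _ _ _ D1 D2'; have c2 := nocross _ _ _ _ D1' D2.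
  have el : gaps l = gaps l' by clear -c1 c2 eg l0 l0' r0 r0'; lia.
  have er : gaps r = gaps r' by clear -el eg; lia.
  by rewrite -el in dr'; rewrite (IHl l' x)// (IHr r' (x + gaps l)%N).
- by case: (node_gap l r l' r' x).
- by exfalso; move: eg => /=; clear; lia.
- by case: (node_gap l' r' l r x).
have [dl dr G] := describes_Gap _ _ _ w d.
have [dl' dr' G'] := describes_Gap _ _ _ w' d'.
move: w w' eg => /= /andP[wl wr] /andP[wl' wr'] eg; rewrite -eg in G'.
have one g1 g2 y : gap_edge D S g1 x y -> gap_edge D S g2 x y -> (g1 < g2)%N -> False.
  move=> [_ h1 _ [h|[D1 _]]] G2 g12; have [_ h2 _ _] := G2; first by clear -h h1 h2 g12; lia.
  by have := gap_edge_min n D S E _ _ _ _ _ G2 D1; clear -h1 h2 g12; lia.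
have el : gaps l = gaps l'.
  have := one _ _ _ G G'; have := one _ _ _ G' G; clear; lia.
have er : gaps r = gaps r' by clear -el eg; lia.
by rewrite -el in dr'; rewrite (IHl l' x)// (IHr r' (x + gaps l).+1).
Qed.

(** The face above xy splits the edges below it: no edge crosses the sides of a
    triangle, and none but xy covers the gap of a fan. *)
Lemma ex_describes x y : x = y \/ D x y ->
  exists t, [/\ wf t, (x + gaps t)%N = y & describes t x].
Proof.
have [m] := ubnP (y - x)%N; elim: m x y => // m IHm x y yxm [<-|Dxy].
  exists Empty; split=> //=; first by rewrite addn0.
  split=> [u v xu vx|j]; last by rewrite /=; clear; lia.
  by apply/negP => /Dlt; move: vx; rewrite /=; clear -xu; lia.
have /andP[xy yn] := Dlt _ _ Dxy.
have [[i [Dxi Diy]]|[a [xa al ar]]] := edge_above _ _ _ E x y Dxy.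
  have xi := Dlt _ _ Dxi; have iy := Dlt _ _ Diy.
  have [l [wl el [lD lS]]] := IHm x i ltac:(clear -yxm xi iy; lia) (or_intror Dxi).
  have [r [wr er [rD rS]]] := IHm i y ltac:(clear -yxm xi iy; lia) (or_intror Diy).
  exists (Node l r); split=> /=.
  - by rewrite wl wr; clear -el er xi iy; lia.
  - by rewrite addnA el.
  rewrite /describes /= addnA el er; rewrite el in lD lS; rewrite er in rD rS.
  split=> [u v xu vy|j jxy].
    have [vi|iv] := leqP v i.
      rewrite lD//; have -> : (v == y) = false by clear -vi iy; lia.
      rewrite andbF /=; case h: (tree_edge r i u v); rewrite ?orbF//.
      by have := tree_edge_lt r i u v wr h; clear -vi; lia.
    have [iu|ui] := leqP i u.
      rewrite rD//; have -> : (u == x) = false by clear -iu xi; lia.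
      rewrite /=; case h: (tree_edge l x u v) => //.
      by have := tree_edge_lt l x u v wl h; clear -iu el; lia.
    have -> : tree_edge l x u v = false.
      by apply/negP => /(tree_edge_lt l x u v wl); clear -iv el; lia.
    have -> : tree_edge r i u v = false.
      by apply/negP => /(tree_edge_lt r i u v wr); clear -ui; lia.
    rewrite !orbF; apply/idP/andP => [Duv|[/eqP-> /eqP->]//].
    have := nocross _ _ _ _ Dxi Duv; have := nocross _ _ _ _ Duv Diy.
    by clear -iv ui xu vy xi iy; lia.
  have [ji|ij|ej] := ltngtP j i.
  - rewrite lS; last by clear -ji jxy; lia.
    case h: (tree_tip r i j); rewrite ?orbF//.
    by have := tree_tip_lt r i j wr h; clear -ji; lia.
  - rewrite rS; last by clear -ij jxy; lia.
    case h: (tree_tip l x j) => //.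
    by have := tree_tip_lt l x j wl h; clear -ij el; lia.
  - subst j; transitivity false.
      by apply/negP => Si; exact: (edge_pointed _ _ _ E x i y).
    case h: (tree_tip l x i); first by have := tree_tip_lt l x i wl h; clear -el; lia.
    by case h': (tree_tip r i i) => //; have := tree_tip_lt r i i wr h'; clear; lia.
have G : gap_edge D S a x y by split.
have [l [wl el [lD lS]]] := IHm x a ltac:(clear -yxm xa; lia)
  ltac:(by case: al => [->|[? _]]; [left | right]).
have [r [wr er [rD rS]]] := IHm a.+1 y ltac:(clear -yxm xa; lia)
  ltac:(by case: ar => [->|[? _]]; [left | right]).
exists (Gap l r); split=> /=.
- by rewrite wl wr.
- by rewrite addnS -addSn -er -el; clear; lia.
have ey : (x + (gaps l + (gaps r).+1))%N = y by rewrite -er -el; clear; lia.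
rewrite /describes /= ey el; rewrite el in lD lS; rewrite er in rD rS.
split=> [u v xu vy|j jxy].
  have [va|av] := leqP v a.
    rewrite lD//; have -> : (v == y) = false by clear -va xa; lia.
    rewrite andbF /=; case h: (tree_edge r _ u v); rewrite ?orbF//.
    by have := tree_edge_lt r _ u v wr h; clear -va; lia.
  have [au|ua] := ltnP a u.
    rewrite rD//; have -> : (u == x) = false by clear -au xa; lia.
    rewrite /=; case h: (tree_edge l x u v) => //.
    by have := tree_edge_lt l x u v wl h; clear -au el; lia.
  have -> : tree_edge l x u v = false.
    by apply/negP => /(tree_edge_lt l x u v wl); clear -av el; lia.
  have -> : tree_edge r a.+1 u v = false.
    by apply/negP => /(tree_edge_lt r _ u v wr); clear -ua; lia.
  rewrite !orbF; apply/idP/andP => [Duv|[/eqP-> /eqP->]//].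
  have := gap_edge_min n D S E a x y u v G Duv.
  by clear -av ua xu vy; lia.
have [ja|aj] := leqP j a.
  have -> : (j == a.+1) = false by clear -ja; lia.
  rewrite andbF /=; have -> : tree_tip r a.+1 j = false.
    by apply/negP => /(tree_tip_lt r _ j wr); clear -ja; lia.
  rewrite orbF; have [ej|nj] := eqVneq j a.
    subst j; have -> : (0 < gaps l)%N by clear -el jxy; lia.
    by case: al => [e|[_ ->//]]; clear -e jxy; lia.
  by rewrite andbF /=; apply: lS; clear -ja nj jxy; lia.
have -> : (j == a) = false by clear -aj; lia.
rewrite andbF /=; have -> : tree_tip l x j = false.
  by apply/negP => /(tree_tip_lt l _ j wl); clear -aj el; lia.
have [ej|nj] := eqVneq j a.+1.
  subst j; have -> : (0 < gaps r)%N by clear -er jxy; lia.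
  by case: ar => [e|[_ ->//]]; clear -e jxy; lia.
by rewrite andbF /=; apply: rS; clear -aj nj jxy; lia.
Qed.

End Describes.

Theorem edge_sets_trees n : (0 < n)%N ->
  [set E : (nat -> nat -> bool) * (nat -> bool) | edge_set n E.1 E.2] #=
    [set t | wf t /\ gaps t = n].
Proof.
move=> n0; apply/card_esym/card_set_bijP.
exists (fun t => (tree_edge t 0, tree_tip t 0)); split.
- by move=> t [wt tn] /=; rewrite -{1}tn; apply: tree_edge_set => //; rewrite tn.
- move=> t t'; rewrite !inE => -[wt tn] [wt' tn'] [eD eS].
  have E := tree_edge_set t wt ltac:(by rewrite tn).
  apply: (describes_unique _ _ _ E t t' 0 wt wt'); first by rewrite tn tn'.
    by split.
  by rewrite eD eS; split.
- move=> [D S] /= E; have [t [wt tn [hD hS]]] := ex_describes n D S E 0 n (or_intror (edge_base _ _ _ E)).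
  rewrite add0n in tn; exists t => //=.
  rewrite add0n tn in hD hS; congr pair; apply/funext => u.
    apply/funext => v; apply/esym; have [vn|nv] := leqP v n; first exact: hD.
    transitivity false.
      by apply/negP => /(edge_lt _ _ _ E); clear -nv; lia.
    by apply/esym/negP => /(tree_edge_lt t 0 u v wt); clear -nv tn; lia.
  apply/esym; have [un|nu] := boolP (0 < u < n)%N; first exact: hS.
  transitivity false.
    by apply/negP => /(tip_lt _ _ _ E) h; rewrite h in nu.
  by apply/esym/negP => /(tree_tip_lt t 0 u wt); rewrite add0n tn => h; rewrite h in nu.
Qed.

(** * Counting the trees *)

Section Trees.
Implicit Types (t l r : tree) (s : nat -> seq tree) (n i j k a b : nat).

(** The list of trees of size n is built from those of smaller sizes; any list
    with the property below has the same length. *)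
Definition lists_trees (u : seq tree) n :=
  uniq u /\ forall t, (t \in u) = wf t && (gaps t == n).

Definition combine (C : tree -> tree -> tree) a b k s :=
  [seq C y.1 y.2 | i <- index_iota a b, y <- [seq (l, r) | l <- s i, r <- s (k - i)%N]].

Lemma combine_size C a b k s : size (combine C a b k s) =
  (\sum_(a <= i < b) size (s i) * size (s (k - i)%N))%N.
Proof.
rewrite size_allpairs_dep sumnE big_map; apply: eq_bigr => i _.
by rewrite size_allpairs.
Qed.

Lemma combineP C a b k s :
  (forall l r l' r', C l r = C l' r' -> l = l' /\ r = r') ->
  (forall i, (a <= i < b)%N -> lists_trees (s i) i /\ lists_trees (s (k - i)%N) (k - i)) ->
  uniq (combine C a b k s) /\
  forall t, t \in combine C a b k s <-> exists l r, [/\ t = C l r, wf l && wf r,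
    (a <= gaps l < b)%N & gaps r = (k - gaps l)%N].
Proof.
move=> inj hs; split.
  apply: allpairs_uniq_dep; first exact: iota_uniq.
    move=> i; rewrite mem_index_iota => /hs[[ul _] [ur _]].
    by apply: allpairs_uniq => // -[x y] [x' y'].
  move=> [i [l r]] [j [l' r']].
  move=> /allpairsPdep[i1 [y1 [hi1 /allpairsP[[l1 r1] [/= hl1 hr1 ->]] e1]]].
  move=> /allpairsPdep[i2 [y2 [hi2 /allpairsP[[l2 r2] [/= hl2 hr2 ->]] e2]]].
  have ei1 := congr1 tag e1; have ei2 := congr1 tag e2.
  have ey1 := congr1 (fun z : {_ : nat & (tree * tree)%type} => tagged z) e1.
  have ey2 := congr1 (fun z : {_ : nat & (tree * tree)%type} => tagged z) e2.
  move: ei1 ei2 ey1 ey2 => /= ? ? [? ?] [? ?]; subst i1 i2 l1 r1 l2 r2.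
  move=> /inj[? ?]; subst l' r'.
  rewrite mem_index_iota in hi1; rewrite mem_index_iota in hi2.
  have [[_ h1] _] := hs _ hi1; have [[_ h2] _] := hs _ hi2.
  move: hl1 hl2; rewrite h1 h2 => /andP[_ /eqP g1] /andP[_ /eqP g2].
  by rewrite -g1 -g2.
move=> t; split.
  move=> /allpairsPdep[i [y [hi /allpairsP[[l r] [/= hl hr ->]] ->]]].
  rewrite mem_index_iota in hi; have [[_ h1] [_ h2]] := hs _ hi.
  move: hl hr; rewrite h1 h2 => /andP[wl /eqP gl] /andP[wr /eqP gr].
  by exists l, r; rewrite wl wr gl gr.
move=> [l [r [-> /andP[wl wr] gl gr]]]; apply/allpairsPdep.
have [[_ h1] [_ h2]] := hs _ gl.
exists (gaps l), (l, r); split=> //; first by rewrite mem_index_iota.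
by apply/allpairsP; exists (l, r); split=> //=; rewrite ?h1 ?h2 ?wl ?wr ?gr eqxx.
Qed.

Definition trees_step s n := if n is n'.+1
  then combine Node 1 n'.+1 n'.+1 s ++ combine Gap 0 n'.+1 n' s else [:: Empty].

Lemma trees_stepP s n : (forall i, (i < n)%N -> lists_trees (s i) i) ->
  lists_trees (trees_step s n) n.
Proof.
case: n => [_|n hs].
  split=> // t; rewrite inE; apply/eqP/andP => [->//|[]].
  by case: t => [|l r|l r] //=; [move=> /and4P[_ _] | move=> _]; clear; lia.
have [uN mN] := combineP Node 1 n.+1 n.+1 s ltac:(by move=> l r l' r' [])
  ltac:(by move=> i h; split; apply: hs; clear -h; lia).
have [uG mG] := combineP Gap 0 n.+1 n s ltac:(by move=> l r l' r' [])
  ltac:(by move=> i h; split; apply: hs; clear -h; lia).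
split.
  rewrite cat_uniq uN uG andbT; apply/hasPn => t /mG[l [r [-> _ _ _]]].
  by apply/negP => /mN[l' [r' []]].
move=> t; rewrite mem_cat; apply/orP/andP.
  case=> [/mN[l [r [-> /andP[wl wr] gl gr]]]|/mG[l [r [-> wlr gl gr]]]].
    by rewrite /= wl wr; split; clear -gl gr; lia.
  by split=> //=; clear -gl gr; lia.
case: t => [|l r|l r] [] //=.
  move=> /and4P[wl wr l0 r0] /eqP e; left; apply/mN; exists l, r.
  by rewrite wl wr; split=> //; clear -e l0 r0; lia.
move=> wlr /eqP e; right; apply/mG; exists l, r.
by split=> //; clear -e; lia.
Qed.

Fixpoint trees_upto n : nat -> seq tree :=
  if n is n'.+1 then fun i => if i == n' then trees_step (trees_upto n') n' else trees_upto n' i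
  else fun=> [::].

Lemma trees_uptoP n i : (i < n)%N -> lists_trees (trees_upto n i) i.
Proof.
elim: n i => // n IHn i; rewrite ltnS leq_eqVlt /= => /predU1P[->|lt].
  by rewrite eqxx; exact: trees_stepP.
by rewrite (ltn_eqF lt); exact: IHn.
Qed.

Definition trees n := trees_upto n.+1 n.

Lemma treesP n : lists_trees (trees n) n. Proof. exact: trees_uptoP. Qed.

Definition tree_count n := size (trees n).

Lemma tree_count_step n : tree_count n = size (trees_step trees n).
Proof.
have [u1 m1] := treesP n.
have [u2 m2] := trees_stepP trees n (fun i _ => treesP i).
by apply/perm_size/uniq_perm => // t; rewrite m1 m2.
Qed.

Lemma tree_count0 : tree_count 0 = 1%N.
Proof. by []. Qed.

Lemma tree_countS n : tree_count n.+1 =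
  (\sum_(1 <= i < n.+1) tree_count i * tree_count (n.+1 - i) +
   \sum_(0 <= i < n.+1) tree_count i * tree_count (n - i))%N.
Proof. by rewrite tree_count_step /trees_step size_cat !combine_size. Qed.

Lemma trees_card n : [set t | wf t /\ gaps t = n] #= `I_(tree_count n).
Proof.
have [u m] := treesP n.
have -> : [set t | wf t /\ gaps t = n] = [set t | t \in trees n].
  apply/seteqP; split=> t /=; rewrite m; first by move=> [-> ->]; rewrite eqxx.
  by move=> /andP[-> /eqP].
exact: card_seq.
Qed.

End Trees.

(** * The generating function *)

Section Series.
Context {R : numFieldType}.
Implicit Types (N n i : nat) (P Q : {poly R}).

(** Congruence to zero modulo 'X^N. *)
Definition small N P := forall i, (i < N)%N -> P`_i = 0.

Lemma smallMl N P Q : small N Q -> small N (P * Q).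
Proof.
move=> h i iN; rewrite coefM big1// => j _; rewrite h ?mulr0//.
by apply: leq_ltn_trans iN; exact: leq_subr.
Qed.

Lemma smallD N P Q : small N P -> small N Q -> small N (P + Q).
Proof. by move=> hP hQ i iN; rewrite coefD hP// hQ// addr0. Qed.

Lemma small_deriv N P : small N.+1 P -> small N P^`().
Proof. by move=> h i iN; rewrite coef_deriv h// mul0rn. Qed.

Lemma small_le M N P : (M <= N)%N -> small N P -> small M P.
Proof. by move=> MN h i iM; apply: h; exact: leq_trans MN. Qed.

(** If B = 2X + B^2, then (1 - 2B)^2 = 1 - 8X, and deriving the first equation
    gives (1 - 2B) B' = 2, so that (1 - 8X) B' = 2 (1 - 2B). *)
Lemma quadratic_deriv N (B : {poly R}) : small N.+1 (B - 'X *+ 2 - B ^+ 2) ->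
  small N (B^`() - ('X * B^`()) *+ 8 - 1 *+ 2 + B *+ 4).
Proof.
set F := B - 'X *+ 2 - B ^+ 2 => hF.
have dF : F^`() = B^`() - 1 *+ 2 - B * B^`() *+ 2.
  by rewrite /F !derivB derivMn derivX expr2 derivM; ring.
have -> : B^`() - ('X * B^`()) *+ 8 - 1 *+ 2 + B *+ 4 =
    (1 - B *+ 2) * F^`() + (B^`() *+ 4) * F.
  by rewrite dF /F; ring.
apply: smallD; apply: smallMl; first exact: small_deriv.
exact: small_le hF.
Qed.

Definition tree_series N : {poly R} := \poly_(i < N) (tree_count i)%:R.

(** Splitting off the root gives G = 1 + (G - 1)^2 + X G^2. *)
Lemma tree_series_quadratic N : let G := tree_series N in
  small N (G *+ 3 - 1 *+ 2 - (1 + 'X) * G ^+ 2).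
Proof.
move=> G i iN; have coefG j : (j <= i)%N -> G`_j = (tree_count j)%:R.
  by move=> ji; rewrite coef_poly (leq_ltn_trans ji iN).
have coefG2 j : (j <= i)%N -> (G ^+ 2)`_j = \sum_(0 <= k < j.+1) (tree_count k * tree_count (j - k)%N)%:R.
  move=> ji; rewrite expr2 coefM big_mkord; apply: eq_bigr => k _.
  have kj : (k <= j)%N by rewrite -ltnS.
  by rewrite !coefG ?natrM//; apply: (leq_trans _ ji); rewrite ?kj ?leq_subr.
rewrite !coefB !coefMn mulrDl mul1r coefD coefXM coefG// coefG2// coef1.
case: i iN coefG coefG2 => [|i] iN coefG coefG2 /=.
  by rewrite big_nat1 subn0 tree_count0 mul1n; ring.
rewrite coefG2//; set c := (tree_count i.+1)%:R; set s2 := \sum_(0 <= k < i.+1) _.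
set s1 : R := \sum_(1 <= k < i.+1) (tree_count k * tree_count (i.+1 - k)%N)%:R.
have -> : \sum_(0 <= k < i.+2) (tree_count k * tree_count (i.+1 - k)%N)%:R = c *+ 2 + s1.
  rewrite big_nat_recr//= big_ltn//= subn0 subnn tree_count0 mul1n muln1 -/s1 -/c.
  by ring.
have -> : c = s1 + s2 by rewrite /c tree_countS natrD !natr_sum.
by ring.
Qed.

(** The coefficients of B = (1 + X) G - 1, where G is the series of the trees; in
    contrast with G, it satisfies B = 2X + B^2. *)
Definition tree_pair n : R := (tree_count n + tree_count n.-1)%:R.

Lemma tree_pair_step n : (0 < n)%N ->
  n.+1%:R * tree_pair n.+1 = (8 * n%:R - 4) * tree_pair n.
Proof.
move=> n0; pose G := tree_series n.+2; pose B : {poly R} := (1 + 'X) * G - 1.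
have pairB i : (0 < i < n.+2)%N -> B`_i = tree_pair i.
  case: i => // i /andP[_ iN].
  rewrite /B mulrDl mul1r coefB coefD coefXM /= coef1 subr0 /tree_pair natrD.
  by rewrite !coef_poly iN (ltnW iN).
have hF : small n.+2 (B - 'X *+ 2 - B ^+ 2).
  have -> : B - 'X *+ 2 - B ^+ 2 = (1 + 'X) * (G *+ 3 - 1 *+ 2 - (1 + 'X) * G ^+ 2).
    by rewrite /B; ring.
  exact/smallMl/tree_series_quadratic.
have := quadratic_deriv n.+1 B hF n (ltnSn n).
rewrite coefD !coefB !coefMn coefXM !coef_deriv coef1 (gtn_eqF n0) prednK//=.
rewrite !pairB ?ltnS ?leqnn ?n0 ?leqnSn//.
by move=> /eqP; rewrite -subr_eq0 => /eqP h; apply/eqP; rewrite -subr_eq0; apply/eqP; rewrite -[RHS]h; ring.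
Qed.

End Series.

(** * Catalan numbers, bounds and limit *)

Section Bounds.
Context {R : realType}.
Implicit Types (l m n i j k : nat).
Local Notation cat := (catalan R).

Lemma catalan0 : cat 0 = 1.
Proof. by rewrite /catalan bin0 divr1. Qed.

Lemma catalan_gt0 n : 0 < cat n.
Proof. by rewrite /catalan divr_gt0// ltr0n bin_gt0 -addnn leq_addr. Qed.

Lemma catalanS n : n.+2%:R * cat n.+1 = (4 * n%:R + 2) * cat n.
Proof.
have cE k : k.+1%:R * cat k = 'C(k.*2, k)%:R.
  by rewrite /catalan mulrC divfK// pnatr_eq0.
have h : (n.+1 * 'C(n.+1.*2, n.+1) = (4 * n + 2) * 'C(n.*2, n))%N.
  have h1 := mul_bin_diag n.+1.*2 n; have h2 := mul_bin_down n.*2.+1 n.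
  have e : (n.*2.+1 - n = n.+1)%N by lia.
  rewrite doubleS /= in h1; rewrite /= e in h2.
  rewrite doubleS -h1 -[n.*2.+2]/((n.+1).*2) -muln2 -mulnA mulnCA mulnC; nia.
apply: (mulfI (_ : n.+1%:R != 0)); first by rewrite pnatr_eq0.
have := congr1 (fun k => k%:R : R) h; rewrite !natrM natrD natrM => hR.
by rewrite cE hR -cE; ring.
Qed.

Lemma tree_pair_catalan n : tree_pair n.+1 = 2 ^+ n.+1 * cat n :> R.
Proof.
elim: n => [|n IHn].
  by rewrite catalan0 expr1 mulr1 /tree_pair tree_countS big_geq// big_nat1 tree_count0.
apply: (mulfI (_ : n.+2%:R != 0)); first by rewrite pnatr_eq0.
rewrite tree_pair_step// IHn [in RHS]exprS.
have := catalanS n; move: (cat n) (cat n.+1) (2 ^+ n.+1) => c c' e h.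
have -> : n.+2%:R * (2 * e * c') = 2 * e * (n.+2%:R * c') by ring.
rewrite h -natr1; ring.
Qed.

(** The coefficient of the previous term in a l / (2^(l+1) C_l). *)
Definition ratio l : R := (l%:R + 1) / (4 * (2 * l%:R - 1)).

Definition scale l : R := 2 ^+ l.+1 * cat l.

Lemma scale_gt0 l : 0 < scale l.
Proof. by rewrite mulr_gt0 ?exprn_gt0 ?catalan_gt0. Qed.

Lemma ratio_den l : (0 < l)%N -> 1 <= 2 * l%:R - 1 :> R.
Proof.
move=> l0; have h : 1 <= l%:R :> R by rewrite ler1n.
lra.
Qed.

Lemma ratio_ge0 l : (0 < l)%N -> 0 <= ratio l.
Proof.
move=> l0; have d := ratio_den l l0; have : 0 <= l%:R :> R by [].
by move=> h; rewrite /ratio divr_ge0//; lra.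
Qed.

Lemma ratio_le l : (0 < l)%N -> ratio l <= 2^-1.
Proof.
move=> l0; have d := ratio_den l l0; have h : 1 <= l%:R :> R by rewrite ler1n.
by rewrite /ratio ler_pdivrMr; lra.
Qed.

Lemma scale_ratio l : scale l = ratio l.+1 * scale l.+1.
Proof.
have d := ratio_den l.+1 isT; have := catalanS l.
rewrite /scale /ratio [2 ^+ l.+2]exprS; set k := l%:R.
have -> : l.+2%:R = k + 2 by rewrite -addn2 natrD.
have -> : l.+1%:R = k + 1 by rewrite -natr1.
move: d; have -> : 2 * l.+1%:R - 1 = 2 * k + 1 by rewrite -natr1; ring.
move: (cat l) (cat l.+1) (2 ^+ l.+1) => c c' e d h.
have -> : 2 * (k + 1) - 1 = 2 * k + 1 by ring.
have -> : (k + 1 + 1) / (4 * (2 * k + 1)) * (2 * e * c') =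
  e * 2 * ((k + 2) * c') / (4 * (2 * k + 1)) by ring.
by rewrite h; field; lra.
Qed.

(** The alternating sums that bound a l / (2^(l+1) C_l), from an arbitrary
    index m on. *)
Definition alternating m l : R :=
  1 - \sum_(m <= i < l.+1) (-1) ^+ (l - i) * \prod_(i <= j < l.+1) ratio j.

Lemma alternating_small m l : (l < m)%N -> alternating m l = 1.
Proof. by move=> lm; rewrite /alternating big_geq// subr0. Qed.

Lemma alternatingS m l : (m <= l.+1)%N ->
  alternating m l.+1 = 1 - ratio l.+1 * alternating m l.
Proof.
move=> ml; rewrite /alternating big_nat_recr//= subnn expr0 mul1r big_nat1.
congr (1 - _); rewrite mulrBr mulr1 addrC; congr (_ + _).
rewrite mulr_sumr -sumrN; apply: eq_big_nat => i /andP[_ il].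
rewrite subSn// exprS big_nat_recr/=; last exact: ltnW.
by ring.
Qed.

Section Sequence.
Variable a : nat -> nat.
Hypothesis a0 : a 0%N = 1%N.
Hypothesis aS : forall l, (a l.+1 + a l)%:R = scale l.+1.

Definition normalized l : R := (a l)%:R / scale l.

Lemma normalizedS l : normalized l.+1 = 1 - ratio l.+1 * normalized l.
Proof.
have := aS l; rewrite natrD /normalized => h.
have s0 := lt0r_neq0 (scale_gt0 l); have s1 := lt0r_neq0 (scale_gt0 l.+1).
have -> : (a l.+1)%:R = scale l.+1 - (a l)%:R :> R by rewrite -h addrK.
rewrite mulrBl divff//; congr (1 - _).
by apply: (mulIf s1); rewrite divfK// mulrAC -scale_ratio mulrC divfK.
Qed.

Lemma normalized_le1 l : normalized l <= 1.
Proof.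
case: l => [|l].
  rewrite /normalized a0 /scale catalan0 expr1; lra.
rewrite normalizedS lerBlDr lerDl mulr_ge0 ?ratio_ge0//.
by rewrite /normalized divr_ge0// ltW// scale_gt0.
Qed.

(** Both sides follow the same recursion, whose factor is negative. *)
Lemma alternating_normalized m k : (0 < m)%N ->
  0 <= (-1) ^+ k * (alternating m (m.-1 + k) - normalized (m.-1 + k)).
Proof.
move=> m0; elim: k => [|k IHk].
  by rewrite addn0 expr0 mul1r alternating_small ?prednK// subr_ge0 normalized_le1.
rewrite addnS alternatingS ?normalizedS; last by rewrite -[m in (m <= _)%N]prednK// ltnS leq_addr.
have := mulr_ge0 (ratio_ge0 (m.-1 + k).+1 isT) IHk; congr (_ <= _).
by rewrite exprS; ring.
Qed.

(** At l = m - 1 the sum is empty and alternating m l = 1 bounds the sequence from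
    above; each further step exchanges the order. *)
Lemma alternating_le m l : (0 < m)%N -> (m <= l.+1)%N -> odd (l.+1 - m) ->
  alternating m l <= normalized l.
Proof.
move=> m0 ml od; have := alternating_normalized m (l.+1 - m) m0.
have -> : (m.-1 + (l.+1 - m) = l)%N by lia.
by rewrite -signr_odd od expr1 mulN1r oppr_ge0 subr_le0.
Qed.

End Sequence.

(** The floor is chosen so that l + 1 - m is odd. *)
Lemma lower_factorE l : lower_factor R l = alternating (if odd l then 1 else 2) l.
Proof.
rewrite /lower_factor; suff -> : Num.floor (2 + (-1) ^+ l / 2 : R) = (if odd l then 1 else 2)%:Z.
  by case: (odd l).
apply/eqP; rewrite floor_eq -signr_odd; case: (odd l).
  by rewrite expr1 /= -[(1%:Z + 1)]/2%:Z -!pmulrn; lra.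
by rewrite expr0 /= -[(2%:Z + 1)]/3%:Z -!pmulrn; lra.
Qed.

(** The fixed point of v -> 1 - v / 8 is 8 / 9. One step of the recursion halves
    the error at least, and adds at most 3 / (8 (2l - 1)), the distance of the
    ratio from 1 / 8. *)
Lemma alternating_near m l : (0 < m <= 2)%N -> (0 < l)%N ->
  `|alternating m l - 8 / 9| <= 2 * harmonic l.
Proof.
move=> m12; rewrite /harmonic /=; case: l => // l _; elim: l => [|l IHl].
  suff [->| ->] : alternating m 1 = 1 \/ alternating m 1 = 2^-1.
  - by rewrite ger0_norm; lra.
  - by rewrite ler0_norm; lra.
  have [e|e] : m = 1%N \/ m = 2%N by lia.
    right; rewrite e alternatingS// alternating_small// /ratio mulr1.
    by field.
  by left; rewrite e alternating_small.
rewrite alternatingS; last by lia.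
set v := alternating m l.+1 in IHl *; set k : R := l.+1%:R.
have k1 : 1 <= k by rewrite /k ler1n.
have e1 : l.+2%:R = k + 1 by rewrite -natr1.
have e2 : l.+3%:R = k + 2 by rewrite /k -addn2 natrD.
have r2 := ratio_le l.+2 isT; have r0 := ratio_ge0 l.+2 isT.
have -> : 1 - ratio l.+2 * v - 8 / 9 =
    - ((8 / 9) * (ratio l.+2 - 8^-1)) - ratio l.+2 * (v - 8 / 9) by field.
have rE : ratio l.+2 - 8^-1 = 3 / (8 * (2 * k + 1)).
  rewrite /ratio e1; have -> : 2 * (k + 1) - 1 = 2 * k + 1 by ring.
  by field; lra.
rewrite e1 in IHl; rewrite e2.
apply: (le_trans (ler_normB _ _)); rewrite normrN normrM [`|ratio _ * _|]normrM.
rewrite (ger0_norm r0) rE (ger0_norm (_ : 0 <= 8 / 9)); last by lra.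
rewrite ger0_norm; last by rewrite divr_ge0//; lra.
have h1 : ratio l.+2 * `|v - 8 / 9| <= 2^-1 * (2 * (k + 1)^-1).
  by apply: ler_pM.
have h2 : 8 / 9 * (3 / (8 * (2 * k + 1))) + 2^-1 * (2 * (k + 1)^-1) <= 2 * (k + 2)^-1.
  have -> : 8 / 9 * (3 / (8 * (2 * k + 1))) + 2^-1 * (2 * (k + 1)^-1) =
    ((k + 1) + 3 * (2 * k + 1)) / (3 * (2 * k + 1) * (k + 1)) by field; lra.
  rewrite ler_pdivrMr; last by rewrite !mulr_gt0//; lra.
  rewrite mulrAC ler_pdivlMr; last lra.
  nra.
lra.
Qed.

Lemma lower_factor_cvg : lower_factor R l @[l --> \oo] --> (8 / 9 : R).
Proof.
apply: (squeeze_cvgr (f := fun l => 8 / 9 - 2 * harmonic l) (h := fun l => 8 / 9 + 2 * harmonic l)).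
- near=> l; have l0 : (0 < l)%N by near: l; exact: nbhs_infty_gt.
  rewrite lower_factorE -ler_distl; apply: alternating_near => //.
  by case: (odd l).
- rewrite -[X in _ --> X]subr0 -[X in _ - X](mulr0 2); apply: cvgB; first exact: cvg_cst.
  by apply: cvgMr; exact: cvg_harmonic.
- rewrite -[X in _ --> X]addr0 -[X in _ + X](mulr0 2); apply: cvgD; first exact: cvg_cst.
  by apply: cvgMr; exact: cvg_harmonic.
Unshelve. all: by end_near. Qed.

End Bounds.

Theorem corollary16 (R : realType) :
  exists a : nat -> nat,
  [/\ (forall (l : nat) (A : set (R * R)),
         single_chain l A -> PPT A #= `I_(a l)),
      (forall l : nat, (1 <= l)%N ->
         (a l)%:R = 2 ^+ l.+1 * catalan R l - (a l.-1)%:R),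
      (forall l : nat, (1 <= l)%N ->
         lower_factor R l * (2 ^+ l.+1 * catalan R l) <= (a l)%:R
         <= 2 ^+ l.+1 * catalan R l)
    & lower_factor R l @[l --> \oo] --> (8 / 9 : R)].
Proof.
pose a l := tree_count l.+1; exists a.
have aS l : (a l.+1 + a l)%:R = scale l.+1 :> R by exact: tree_pair_catalan l.+1.
have a0 : a 0%N = 1%N by rewrite /a tree_countS big_geq// big_nat1 tree_count0.
split.
- move=> l A /single_chainP[q [p [hc -> gp]]].
  apply: card_eq_trans (PPT_edge_sets l.+1 q p hc gp) _.
  exact: card_eq_trans (edge_sets_trees l.+1 isT) (trees_card l.+1).
- by case=> // l _ /=; rewrite -[X in X - _](aS l) natrD addrK.
- case=> // l _; rewrite -/(scale l.+1); apply/andP; split; last first.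
    by rewrite -aS ler_nat leq_addr.
  rewrite -ler_pdivlMr ?scale_gt0// lower_factorE -/(normalized a l.+1).
  apply: alternating_le => //; first by case: (odd _).
    by case: (odd _).
  by rewrite /= ; case: ifP => h; rewrite ?subn1 ?subn2 /=; [|]; move: h => /=; lia.
- exact: lower_factor_cvg.
Qed.
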